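(* Let $d\ge 2$ and let $w=(w_1,\dots,w_d)$ be a $d$-tuple of positive real numbers with $\sum_{i=1}^d w_i=1$ and $w_1\ge\cdots\ge w_d$. For any unimodular lattice $\Lambda\in\mathcal{L}_{d+1}$ and any nonempty open subset $U$ of $\mathbb{R}^d$, the Hausdorff dimension of the set $$\{x\in U:\ (a_t h(x)\Lambda)_{t\ge 0}\ \text{is divergent}\}$$ is at least $d-\frac{1}{1+w_1}$.
   Context: $\mathcal{L}_{d+1}$ denotes the space of unimodular (covolume one) lattices in $\mathbb{R}^{d+1}$, identified with $\mathrm{SL}_{d+1}(\mathbb{R})/\mathrm{SL}_{d+1}(\mathbb{Z})$. For $t\in\mathbb{R}$, $a_t=\operatorname{diag}(e^{w_1t},\dots,e^{w_dt},e^{-t})\in \mathrm{SL}_{d+1}(\mathbb{R})$, and for $x\in\mathbb{R}^d$ (a column vector), $h(x)=\begin{pmatrix} I_d & x\\ 0&1\end{pmatrix}\in \mathrm{SL}_{d+1}(\mathbb{R})$. A trajectory $(y_t)_{t\ge0}$ in $\mathcal{L}_{d+1}$ is divergent if it eventually leaves every compact subset of $\mathcal{L}_{d+1}$. *)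

(* Defs.v *)
From HB Require Import structures.
From mathcomp Require Import all_boot all_order all_algebra.
From mathcomp Require Import generic_quotient.
From mathcomp Require Import all_classical all_reals all_analysis.
Import numFieldNormedType.Exports.
Import Order.TTheory GRing.Theory Num.Theory.

Set Implicit Arguments.
Unset Strict Implicit.
Unset Printing Implicit Defensive.

Local Open Scope classical_set_scope.
Local Open Scope ring_scope.

Section hausdorff.
Context {R : realType} {T : choiceType}.
Variable dist : T -> T -> R.
Implicit Types (A : set T) (F : (set T)^nat) (s delta : R).

(* [0] is added to the set of distances so that [diam set0 = 0]. *)
Definition diam A : \bar R :=
  ereal_sup [set r | r = 0%:E \/ exists x y, [/\ A x, A y & r = (dist x y)%:E]].

(* Since [poweR 0 0 = 1], the empty set has to be singled out when [s = 0]. *)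
Definition diam_pow s A : \bar R :=
  if A == set0 then 0%E else poweR (diam A) s.

Definition delta_cover delta A F :=
  A `<=` \bigcup_i F i /\ forall i, (diam (F i) <= delta%:E)%E.

Definition hausdorff_content delta s A : \bar R :=
  ereal_inf [set (\sum_(0 <= i <oo) diam_pow s (F i))%E |
             F in delta_cover delta A].

Definition hausdorff_measure s A : \bar R :=
  ereal_sup [set hausdorff_content delta s A |
             delta in [set delta | 0 < delta]].

Definition hausdorff_dim A : \bar R :=
  ereal_inf [set s%:E | s in [set s | 0 <= s /\ hausdorff_measure s A = 0%E]].

End hausdorff.

Definition euclidean_dist {R : realType} {d : nat} (x y : 'cV[R]_d) : R :=
  Num.sqrt (\sum_(i < d) (x i 0 - y i 0) ^+ 2).

Section SL.
Context (R : realType) (n : nat).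

Record SL := MkSL { SLmx : 'M[R]_n ; SLmxP : \det SLmx == 1 }.

HB.instance Definition _ := [isSub for SLmx].
HB.instance Definition _ := [Choice of SL by <:].
HB.instance Definition _ := Topological.copy SL (initial_topology SLmx).

Lemma det_SLmx (g : SL) : \det (SLmx g) = 1.
Proof. exact/eqP/SLmxP. Qed.

Lemma mulSL_subproof (g h : SL) : \det (SLmx g *m SLmx h) == 1.
Proof. by rewrite det_mulmx !det_SLmx mulr1. Qed.

Definition mulSL (g h : SL) : SL := MkSL (mulSL_subproof g h).

(* [SL_modZ g h] means that [g] and [h] have the same left coset modulo
   [SL_n(Z)], i.e. that the columns of [g] and of [h] span the same lattice. *)
Definition SL_modZ (g h : SL) : bool :=
  `[< exists2 c : 'M[int]_n,
        \det c = 1 & SLmx h = SLmx g *m map_mx intr c >].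

Lemma SL_modZ_refl : reflexive SL_modZ.
Proof.
move=> g; apply/asboolP; exists 1%:M; first exact: det1.
by rewrite map_mx1 mulmx1.
Qed.

Lemma SL_modZ_trans : transitive SL_modZ.
Proof.
move=> g h k /asboolP[c c1 hE] /asboolP[c' c'1 kE]; apply/asboolP.
exists (c *m c'); first by rewrite det_mulmx c1 c'1 mulr1.
by rewrite kE hE map_mxM mulmxA.
Qed.

Lemma SL_modZ_sym : symmetric SL_modZ.
Proof.
suff sub g h : SL_modZ g h -> SL_modZ h g by move=> g h; apply/idP/idP => /sub.
move=> /asboolP[c c1 hE]; apply/asboolP; exists (\adj c).
  by have := congr1 determinant (mul_mx_adj c); rewrite det_mulmx c1 mul1r det1.
by rewrite hE -mulmxA -map_mxM mul_mx_adj c1 map_mx1 mulmx1.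
Qed.

Canonical SL_modZ_equiv :=
  EquivRel SL_modZ SL_modZ_refl SL_modZ_sym SL_modZ_trans.

Definition lattice_space : Type := quotient_topology {eq_quot SL_modZ}%qT.

HB.instance Definition _ := Topological.on lattice_space.
HB.instance Definition _ := Quotient.on lattice_space.

Definition lattice_act (g : SL) (L : lattice_space) : lattice_space :=
  \pi_lattice_space%qT (mulSL g (repr L)).

Lemma lattice_actE (g h : SL) :
  lattice_act g (\pi_lattice_space%qT h) = \pi_lattice_space%qT (mulSL g h).
Proof.
apply/(@eqmodP _ SL_modZ_equiv); apply/asboolP.
have /(@eqmodP _ SL_modZ_equiv)/asboolP[c c1 hE] :
  \pi_lattice_space%qT (repr (\pi_lattice_space%qT h)) = \pi_lattice_space%qT h.
  exact: reprK.
by exists c => //=; rewrite -mulmxA -hE.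
Qed.

Definition divergent (y : R -> lattice_space) :=
  forall K : set lattice_space, compact K -> \forall t \near +oo, ~ K (y t).

End SL.

Section flow.
Context (R : realType) (d : nat).

Definition flow_mx (w : 'I_d -> R) (t : R) : 'M[R]_(d + 1) :=
  diag_mx (row_mx (\row_i expR (w i * t)) (const_mx (expR (- t)))).

Lemma det_flow_mx (w : 'I_d -> R) (w1 : \sum_i w i = 1) (t : R) :
  \det (flow_mx w t) == 1.
Proof.
rewrite det_diag big_split_ord /= big_ord1 row_mxEr mxE.
under eq_bigr do rewrite row_mxEl mxE.
by rewrite -expR_sum -mulr_suml w1 mul1r -expRD subrr expR0.
Qed.

Definition flow (w : 'I_d -> R) (w1 : \sum_i w i = 1) (t : R) : SL R (d + 1) :=
  MkSL (det_flow_mx w1 t).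

Lemma det_horo (x : 'cV[R]_d) :
  \det (block_mx 1%:M x 0 1%:M : 'M[R]_(d + 1)) == 1.
Proof. by rewrite det_ublock !det1 mulr1. Qed.

Definition horo (x : 'cV[R]_d) : SL R (d + 1) := MkSL (det_horo x).

End flow.

(* Main.v *)
(** Write the lattice as [g Z^(d+1)] and give [v : Z^(d+1)] the coordinates
    [(p, q) = g v]; the horospherical translate of [v] by [x] is [(p + q x, q)],
    so [v] is short along a stretch of the trajectory of [x] when [x] lies in a
    small box around [- p / q].  At the scales [Q_k = exp (H k^3)] one builds a
    tree of nested boxes around points [- p / q] with [Q_k <= q <= 2 Q_k], such
    that every point of a nested intersection has a divergent trajectory.

    Children exist in abundance by duality: by transference, a point [x] of the
    box of [v] is near a centre of the next level unless some nonzero dual vector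
    [m] satisfies [|phi_i| <= b_i] and [|phi_0 - sum phi_i x_i| <= s].  For each
    such [m] the bad [x] fill a thin slab, and the dual vectors in question are
    separated by [m . v] and by the integer parts of their coordinates, because
    [v] itself is chosen with no short dual vector orthogonal to it.  Summing the
    slabs, at most half of the cells of the box of [v] are bad.

    The proportion of level-[k] boxes meeting a set of diameter [r] telescopes to
    at most [r^(d - 1 + w_1 / (1 + w_1) - eta)], the exponent [w_1 / (1 + w_1)]
    coming from the direction [w_1], along which consecutive boxes are more widely
    spaced than they are long.  Hence any cover of small [s']-dimensional size is
    avoided by some branch of the tree, chosen child after child. *)

Require Import Defs.
From HB Require Import structures.
From mathcomp Require Import all_boot all_order all_algebra.
From mathcomp Require Import generic_quotient.
From mathcomp Require Import all_classical all_reals all_analysis.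
From mathcomp Require Import ring lra zify.
Import numFieldNormedType.Exports.
Import Order.TTheory GRing.Theory Num.Theory.

Set Implicit Arguments.
Unset Strict Implicit.
Unset Printing Implicit Defensive.

Local Open Scope ring_scope.

(** * Transference *)

Section Transference.
Variable R : realType.

(** Why one direction is singled out: if no nonzero dual vector orthogonal to [v] lies in the box
    [b], Minkowski's theorem bounds the product of the [b i] by a constant times Q_k. Boxes whose
    vector stays short up to the next scale would call for [b i] near Q_(k+1)^(w_i), with product
    Q_(k+1). The whole deficit is charged to the direction of w_1. In the other directions the
    spacing and the length of the children agree to leading order; along w_1 the spacing exceeds the
    length by a factor lambda close to Q_(k+1) / Q_k. One level shortens the boxes there by
    lambda^(1 + w_1) but offers only lambda^(w_1) places, and w_1 / (1 + w_1) is the quotient of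
    these exponents. To leading order lambda is exp (3 H k^2), while the losses per level
    (constants, harmonic sums over dual vectors, the slack that drives short vectors to 0) are exp
    (O(k^2)) with a constant independent of H. Boxes of level k have size at most exp (- H k^3), so
    taking H large against 1 / eta turns the accumulated loss into r^(- eta). *)

Definition dot N (u v : 'rV[R]_N) : R := \sum_i u 0 i * v 0 i.

Lemma dotE N (u v : 'rV[R]_N) : u *m v^T = (dot u v)%:M.
Proof.
apply/matrixP => i j; rewrite !ord1 !mxE eqxx mulr1n.
by apply: eq_bigr => k _; rewrite mxE.
Qed.

Lemma dotC N (u v : 'rV[R]_N) : dot u v = dot v u.
Proof. by apply: eq_bigr => i _; rewrite mulrC. Qed.

Lemma dotDl N (u v w : 'rV[R]_N) : dot (u + v) w = dot u w + dot v w.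
Proof. by rewrite -big_split; apply: eq_bigr => i _; rewrite mxE mulrDl. Qed.

Lemma dotZl N a (u v : 'rV[R]_N) : dot (a *: u) v = a * dot u v.
Proof. by rewrite /dot mulr_sumr; apply: eq_bigr => i _; rewrite mxE mulrA. Qed.

Lemma dotDr N (u v w : 'rV[R]_N) : dot u (v + w) = dot u v + dot u w.
Proof. by rewrite dotC dotDl !(dotC u). Qed.

Lemma dotZr N a (u v : 'rV[R]_N) : dot u (a *: v) = a * dot u v.
Proof. by rewrite dotC dotZl dotC. Qed.

Lemma dotNr N (u v : 'rV[R]_N) : dot u (- v) = - dot u v.
Proof. by rewrite -scaleN1r dotZr mulN1r. Qed.

Lemma dotNl N (u v : 'rV[R]_N) : dot (- u) v = - dot u v.
Proof. by rewrite dotC dotNr dotC. Qed.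

Lemma dot0r N (u : 'rV[R]_N) : dot u 0 = 0.
Proof. by rewrite -(scale0r u) dotZr mul0r. Qed.

Lemma dot_ge0 N (u : 'rV[R]_N) : 0 <= dot u u.
Proof. by apply: sumr_ge0 => i _; rewrite -expr2 sqr_ge0. Qed.

Lemma dot_eq0 N (u : 'rV[R]_N) : dot u u = 0 -> u = 0.
Proof.
move=> /eqP; rewrite psumr_eq0 => [/allP u0|i _]; last by rewrite -expr2 sqr_ge0.
apply/rowP => i; rewrite mxE; apply/eqP.
by have := u0 i (mem_index_enum _); rewrite -expr2 sqrf_eq0.
Qed.

Lemma nearest_int (x : R) : exists j : int, `|x - j%:~R| <= 2^-1.
Proof.
exists (Num.floor (x + 2^-1)).
have /andP[h1 h2] := floor_itv (x + 2^-1).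
rewrite ler_norml; rewrite intrD in h2; set f := _%:~R in h1 h2 *.
by apply/andP; split; lra.
Qed.

Lemma sqr_le_quarter (e : R) : `|e| <= 2^-1 -> e ^+ 2 <= 4^-1.
Proof. by rewrite ler_norml => /andP[h1 h2]; nra. Qed.

Lemma tripling (x y : R) : 1 <= x -> 3 * x <= y -> 4^-1 + 2 * x <= y.
Proof. lra. Qed.

(** Descent: as long as a vector fails the conclusion, another nonzero one has less than half its
    squared norm, and the lower bound [a] stops this after [K] halvings. Nonzero [m] with
    [ell m = 0] are allowed for, since projecting makes the rows of [B] dependent. *)
Lemma near_shortest n N (B : 'M[R]_(n, N)) (a : R) (m0 : 'rV[int]_n) :
    let ell (m : 'rV[int]_n) := map_mx intr m *m B in
    0 < a -> (forall m, ell m = 0 \/ a <= dot (ell m) (ell m)) ->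
    ell m0 != 0 ->
  exists m1, ell m1 != 0 /\
    forall m, ell m = 0 \/ dot (ell m1) (ell m1) / 2 <= dot (ell m) (ell m).
Proof.
move=> ell a0 ha m0n0.
have [K hK] : exists K, dot (ell m0) (ell m0) < a * 2 ^+ K.
  exists (Num.bound (dot (ell m0) (ell m0) / a)).
  rewrite -ltr_pdivrMl // mulrC.
  apply: lt_trans (_ : _ < (Num.bound (dot (ell m0) (ell m0) / a))%:R) _.
    by rewrite archi_boundP // divr_ge0 ?dot_ge0 // ltW.
  by rewrite -natrX ltr_nat ltn_expl.
elim: K m0 m0n0 hK => [|K IH] m0 m0n0 hK.
  rewrite expr0 mulr1 in hK; case: (ha m0) => [/eqP|]; first by rewrite (negPf m0n0).
  by move=> /(lt_le_trans hK); rewrite ltxx.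
have [h|] := pselect (forall m, ell m = 0 \/ dot (ell m0) (ell m0) / 2 <= dot (ell m) (ell m)).
  by exists m0.
move=> /existsNP[m1 /not_orP[m1n0 hm1]]; apply: (IH m1); first exact/eqP.
move/negP: hm1; rewrite -ltNge => hm1; apply: lt_le_trans hm1 _.
rewrite ler_pdivrMr // -mulrA -exprSr; exact: ltW.
Qed.

(* Induction on the rank: split off a nearly shortest vector and project the
   lattice along it; the minimum of the projected lattice drops by at most a
   factor 2 in squared norm. *)
Lemma dual_covering n N (B : 'M[R]_(n, N)) (c : 'cV[R]_n) (a : R) :
    let ell (m : 'rV[int]_n) := map_mx intr m *m B in
    let val (m : 'rV[int]_n) := (map_mx intr m *m c) 0 0 in
    0 < a -> (forall m, ell m = 0 \/ a <= dot (ell m) (ell m)) ->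
    (forall m, ell m = 0 -> val m \is a Num.int) ->
  exists z : 'rV[R]_N, dot z z <= 3 ^+ \rank B / a /\
    forall m, dot (ell m) z - val m \is a Num.int.
Proof.
move: {2}(\rank B) (leqnn (\rank B)) => r.
elim: r B c a => [|r IH] B c a rB ell val a0 ha hc.
  have B0 : B = 0 by apply/eqP; rewrite -mxrank_eq0 -leqn0.
  exists 0; split; first by rewrite dot0r divr_ge0 ?exprn_ge0 // ltW.
  move=> m; rewrite dot0r sub0r rpredN; apply: hc.
  by rewrite /ell B0 mulmx0.
have [h|/existsNP[m0 /eqP m0n0]] := pselect (forall m, ell m = 0).
  exists 0; split; first by rewrite dot0r divr_ge0 ?exprn_ge0 // ltW.
  by move=> m; rewrite dot0r sub0r rpredN; apply: hc.
have [m1 [m1n0 hm1]] := near_shortest a0 ha m0n0.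
set b := ell m1 in m1n0 hm1; set beta := dot b b.
have beta0 : 0 < beta.
  by rewrite lt_neqAle dot_ge0 andbT eq_sym; apply: contra m1n0 => /eqP/dot_eq0/eqP.
have betan0 : beta != 0 by rewrite gt_eqF.
have abeta : a <= beta.
  by case: (ha m1) => [/eqP|//]; rewrite -/b (negPf m1n0).
have [j hj] := nearest_int (val m1).
(* [t * beta] is congruent to [val m1] modulo 1 and at most 1/2 in absolute value. The solution will
   have [t *: b] as its component along [b], and [c'] is [c] with that contribution removed. *)
set t := (val m1 - j%:~R) / beta.
pose B' := B - (beta^-1 *: (B *m b^T)) *m b.
pose c' := c - t *: (B *m b^T).
pose ell' (m : 'rV[int]_n) := map_mx intr m *m B'.
pose val' (m : 'rV[int]_n) := (map_mx intr m *m c') 0 0.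
have BbE (m : 'rV[int]_n) : map_mx intr m *m (B *m b^T) = (dot (ell m) b)%:M.
  by rewrite mulmxA dotE.
have ell'E m : ell' m = ell m - (dot (ell m) b / beta) *: b.
  rewrite /ell' /B' mulmxBr; congr (_ - _).
  rewrite [LHS]mulmxA -scalemxAr BbE scale_scalar_mx mul_scalar_mx.
  by rewrite mulrC.
have val'E m : val' m = val m - t * dot (ell m) b.
  rewrite /val' /c' mulmxBr -scalemxAr BbE scale_scalar_mx.
  by rewrite [LHS]mxE; congr (_ + _); rewrite !mxE eqxx mulr1n.
have ell'b m : dot (ell' m) b = 0.
  by rewrite ell'E dotDl dotNl dotZl -mulrA mulVf // mulr1 subrr.
(* [b] lies in the row space of [B] but not in that of [B'], whose rows are orthogonal to it. *)
have rlt : (\rank B' < \rank B)%N.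
  have bB : (b <= B)%MS by apply: submxMl.
  have sB : (B' <= B)%MS.
    by rewrite addmx_sub // eqmx_opp (submx_trans _ bB) // submxMl.
  rewrite ltn_neqAle mxrankS // andbT; apply/negP => /eqP eqr.
  have /submxP[y by_] : (b <= B')%MS.
    by apply: submx_trans bB _; rewrite -(geq_leqif (mxrank_leqif_sup sB)) eqr.
  have : b *m b^T = 0.
    rewrite {1}by_ -mulmxA /B' mulmxBl -mulmxA dotE -/beta mul_mx_scalar.
    by rewrite scalerA mulfV // scale1r subrr mulmx0.
  move/matrixP => /(_ 0 0); rewrite dotE !mxE eqxx mulr1n => h.
  by move: betan0; rewrite /beta h eqxx.
have rB' : (\rank B' <= r)%N by rewrite -ltnS; apply: leq_trans rlt rB.
(* integral translation bringing [ell m] close to the hyperplane orthogonal to [b] *)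
have red m : exists j0 : int, exists e : R, `|e| <= 2^-1 /\
    ell (m - j0 *: m1) = ell' m + e *: b.
  have [j0 hj0] := nearest_int (dot (ell m) b / beta).
  exists j0, (dot (ell m) b / beta - j0%:~R); split => //.
  rewrite ell'E scalerBl addrA subrK /ell map_mxB mulmxBl map_mxZ -scalemxAl.
  by rewrite -/(ell m) -/(ell m1) -/b.
have dotred m e : dot (ell' m + e *: b) (ell' m + e *: b) =
    dot (ell' m) (ell' m) + e ^+ 2 * beta.
  rewrite dotDl !dotDr !dotZr !dotZl (dotC b) ell'b -/beta; ring.
have esq (e : R) : `|e| <= 2^-1 -> e ^+ 2 * beta <= beta / 4.
  move=> he; rewrite mulrC; apply: ler_wpM2l; first exact: ltW.
  exact: sqr_le_quarter.
(* Lifting with [|e| <= 1 / 2] adds at most [beta / 4] to the squared norm, and by the choice of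
   [m1] this is at most half of the squared norm of the lift. *)
have min' m : ell' m = 0 \/ a / 2 <= dot (ell' m) (ell' m).
  have [->|/eqP n0] := pselect (ell' m = 0); [by left | right].
  have [j0 [e [he E]]] := red m.
  have en0 : ell (m - j0 *: m1) <> 0.
    move=> h; have : dot (ell' m) (ell' m) = 0.
      have := dotred m e; rewrite -E h dot0r => h2.
      have := dot_ge0 (ell' m); have : 0 <= e ^+ 2 * beta.
        by rewrite mulr_ge0 ?sqr_ge0 // ltW.
      lra.
    by move/dot_eq0/eqP; rewrite (negPf n0).
  have := esq _ he; have := dotred m e; rewrite -E.
  case: (hm1 (m - j0 *: m1)) => // h1; rewrite -/beta in h1.
  case: (ha (m - j0 *: m1)) => // h4 h2 h3; lra.
(* A vector that projects to 0 has a lift of squared norm at most [beta / 4], which is therefore 0.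
   So it is an integer multiple of [b], where [t] was chosen to give integral values. *)
have int' m : ell' m = 0 -> val' m \is a Num.int.
  move=> h0; have [j0 [e [he E]]] := red m.
  have en0 : ell (m - j0 *: m1) = 0.
    case: (hm1 (m - j0 *: m1)) => // h1; exfalso.
    have := esq _ he; have := dotred m e; rewrite -E h0 dot0r.
    rewrite -/beta in h1; lra.
  have valB : val (m - j0 *: m1) = val m - j0%:~R * val m1.
    by rewrite /val map_mxB mulmxBl map_mxZ -scalemxAl !mxE.
  have e1 : dot (ell m) b = j0%:~R * beta.
    move: en0; rewrite /ell map_mxB mulmxBl map_mxZ -scalemxAl -/(ell m) -/(ell m1).
    by move/subr0_eq ->; rewrite dotZl.
  rewrite val'E e1.
  have -> : val m - t * (j0%:~R * beta) = val (m - j0 *: m1) + j0%:~R * j%:~R.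
    rewrite valB /t; field; exact: betan0.
  by rewrite rpredD ?rpredM ?intr_int //; apply: hc.
have [z' [hz' hzi]] := IH B' c' (a / 2) rB' (divr_gt0 a0 (ltr0n _ 2)) min' int'.
pose z := z' + (t - dot z' b / beta) *: b.
have zz : dot z z <= t ^+ 2 * beta + dot z' z'.
  have -> : dot z z = t ^+ 2 * beta + dot z' z' - dot z' b ^+ 2 / beta.
    rewrite /z dotDl !dotDr !dotZr !dotZl (dotC b z') -/beta; field; exact: betan0.
  by rewrite gerBl divr_ge0 ?sqr_ge0 // ltW.
exists z; split.
  apply: le_trans zz _.
  have h1 : t ^+ 2 * beta <= 4^-1 / a.
    have -> : t ^+ 2 * beta = (val m1 - j%:~R) ^+ 2 / beta.
      rewrite /t; field; exact: betan0.
    apply: ler_pM; rewrite ?sqr_ge0 ?invr_ge0 ?(ltW beta0) //.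
      exact: sqr_le_quarter.
    by rewrite lef_pV2.
  have h2 : dot z' z' <= 2 * 3 ^+ \rank B' / a.
    by apply: le_trans hz' _; rewrite invf_div mulrCA mulrA.
  (* [1 / 4] comes from the component along [b], and the 2 in front of [3 ^ \rank B'] from the
     halved minimum; tripling the constant at each rank covers both. *)
  apply: le_trans (lerD h1 h2) _; rewrite -mulrDl ler_wpM2r ?invr_ge0 ?(ltW a0) //.
  have : (3 : R) ^+ (\rank B').+1 <= 3 ^+ \rank B by rewrite ler_eXn2l ?ltr1n.
  have : (1 : R) <= 3 ^+ \rank B' by rewrite exprn_ege1 ?ler1n.
  rewrite exprS; exact: tripling.
move=> m; have := hzi m.
have -> // : dot (ell' m) z' - val' m = dot (ell m) z - val m.
rewrite val'E ell'E /z dotDl dotNl dotZl dotDr dotZr (dotC b z'); field; exact: betan0.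
Qed.

End Transference.

(** * Coordinates of lattice vectors and dual vectors, and covering near a point *)

Section LatticeCoordinates.
Variables (R : realType) (d : nat) (g : 'M[R]_(d + 1)).
Hypothesis gU : g \in unitmx.
Implicit Types (k : 'cV[int]_(d + 1)) (m : 'rV[int]_(d + 1)) (x : 'cV[R]_d).

Definition vecp k (i : 'I_d) : R := (g *m map_mx intr k) (lshift 1 i) 0.
Definition vecq k : R := (g *m map_mx intr k) (rshift d 0) 0.
Definition form m (i : 'I_d) : R := (map_mx intr m *m invmx g) 0 (lshift 1 i).
Definition form0 m : R := (map_mx intr m *m invmx g) 0 (rshift d 0).
(** Last coordinate of the dual vector once the lattice is translated by [hmx x]; the coordinates
    [form m i] do not change. *)
Definition formx m x : R := form0 m - \sum_i form m i * x i 0.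
Definition pairing m k : int := (m *m k) 0 0.

Definition hmx x : 'M[R]_(d + 1) := block_mx 1%:M x 0 1%:M.

Lemma hmxK x : hmx x *m hmx (- x) = 1%:M.
Proof.
rewrite /hmx mulmx_block !(mul0mx, mulmx0, mul1mx, mulmx1, addr0, add0r) addNr.
by rewrite -scalar_mx_block.
Qed.

Lemma vecpE x k i : (hmx x *m (g *m map_mx intr k)) (lshift 1 i) 0 =
  vecp k i + vecq k * x i 0.
Proof.
rewrite -[g *m _]vsubmxK /hmx mul_block_col mul1mx mul0mx mul1mx add0r.
rewrite col_mxEu mxE; congr (_ + _); first by rewrite mxE.
by rewrite mxE big_ord1 mulrC mxE.
Qed.

Lemma vecqE x k : (hmx x *m (g *m map_mx intr k)) (rshift d 0) 0 = vecq k.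
Proof.
rewrite -[g *m _]vsubmxK /hmx mul_block_col mul1mx mul0mx mul1mx add0r.
by rewrite col_mxEd mxE.
Qed.

Lemma formE x m i :
  (map_mx intr m *m invmx g *m hmx (- x)) 0 (lshift 1 i) = form m i.
Proof.
rewrite -[_ *m invmx g]hsubmxK /hmx mul_row_block !mulmx1 mulmx0 addr0.
by rewrite row_mxEl mxE.
Qed.

Lemma formxE x m :
  (map_mx intr m *m invmx g *m hmx (- x)) 0 (rshift d 0) = formx m x.
Proof.
rewrite -[_ *m invmx g]hsubmxK /hmx mul_row_block !mulmx1 row_mxEr mxE addrC.
congr (_ + _); first by rewrite mxE.
rewrite mulmxN mxE; congr (- _); rewrite mxE.
by apply: eq_bigr => i _; rewrite mxE.
Qed.

(** The pairing is invariant when the lattice moves by [hmx x] and the dual lattice by [hmx (- x)].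
    Thus [x] is a free parameter: a grid point in the counting, and 0 when no point is preferred. *)
Lemma pairingE x m k : (pairing m k)%:~R =
  \sum_i form m i * (vecp k i + vecq k * x i 0) + formx m x * vecq k.
Proof.
have -> : (pairing m k)%:~R = ((map_mx intr m *m invmx g *m hmx (- x)) *m
    (hmx x *m (g *m map_mx intr k))) 0 0 :> R.
  rewrite -[_ *m hmx (- x) *m _]mulmxA [hmx (- x) *m _]mulmxA.
  rewrite -{2}[x]opprK hmxK mul1mx mulmxA mulmxKV // -map_mxM.
  by rewrite /pairing [RHS]mxE.
rewrite mxE big_split_ord /=; congr (_ + _).
  by apply: eq_bigr => i _; rewrite formE vecpE.
by rewrite big_ord1 formxE vecqE.
Qed.

Lemma form_sub m m' i : form (m - m') i = form m i - form m' i.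
Proof. by rewrite /form map_mxB mulmxBl mxE [X in _ + X]mxE. Qed.

Lemma pairing_sub m m' k : pairing (m - m') k = pairing m k - pairing m' k.
Proof. by rewrite /pairing mulmxBl mxE [X in _ + X]mxE. Qed.

(** Bound of [dual_covering] for rank [d + 1] and minimum 1. *)
Definition cst : R := 3 ^+ (d + 1).

Lemma cst_ge1 : 1 <= cst. Proof. by rewrite exprn_ege1 ?ler1n. Qed.

Definition dual_bad (b : 'I_d -> R) (s : R) x :=
  exists m, [/\ m != 0, forall i, `|form m i| <= b i & `|formx m x| <= s].

(** Rescaling turns the box given by [b] and [s] into the unit box, so that the absence of bad dual
    vectors says that the rescaled dual lattice has minimum at least 1. The [z] supplied by
    [dual_covering] is then the bounded, rescaled difference between the target [(0, t0)] and a
    translated lattice vector. *)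
Lemma lattice_covering x (b : 'I_d -> R) (s t0 : R) :
    (forall i, 0 < b i) -> 0 < s -> ~ dual_bad b s x ->
  exists k, (forall i, `|vecp k i + vecq k * x i 0| <= cst / b i) /\
    `|vecq k - t0| <= cst / s.
Proof.
move=> b0 s0 good.
pose dg : 'M[R]_(d + 1) :=
  diag_mx (row_mx (\row_i (b i)^-1) (const_mx s^-1)).
pose B := invmx g *m hmx (- x) *m dg.
pose tgt : 'cV[R]_(d + 1) := col_mx 0 (const_mx t0).
pose c := invmx g *m hmx (- x) *m tgt.
have BE (m : 'rV[int]_(d + 1)) : map_mx intr m *m B =
    map_mx intr m *m invmx g *m hmx (- x) *m dg by rewrite /B !mulmxA.
have Bl (m : 'rV[int]_(d + 1)) i : (map_mx intr m *m B) 0 (lshift 1 i) = form m i / b i.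
  by rewrite BE mul_mx_diag mxE formE row_mxEl mxE.
have Br (m : 'rV[int]_(d + 1)) : (map_mx intr m *m B) 0 (rshift d 0) = formx m x / s.
  by rewrite BE mul_mx_diag mxE formxE row_mxEr mxE.
have sq1 (y : R) : 1 < `|y| -> 1 <= y * y.
  by move=> h; rewrite -expr2 -real_normK ?num_real // exprn_ege1 // ltW.
have [||z [hz hzi]] := @dual_covering R _ _ B c 1 ltr01.
- move=> m; have [->|m0] := eqVneq m 0; first by left; rewrite map_mx0 mul0mx.
  right; rewrite /dot big_split_ord /= big_ord1 Br.
  have h1 : 0 <= \sum_i form m i / b i * (form m i / b i).
    by apply: sumr_ge0 => i _; rewrite -expr2 sqr_ge0.
  under eq_bigr do rewrite Bl.
  have [h2|h2] := lerP `|formx m x| s.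
    have [i hi] : exists i, b i < `|form m i|.
      apply/not_existsP => h; apply: good; exists m; split => // i.
      by rewrite leNgt; apply/negP/h.
    rewrite (bigD1 i) //= -addrA ler_wpDr //.
      rewrite addr_ge0 -?expr2 ?sqr_ge0 //; apply: sumr_ge0 => j _.
      by rewrite -expr2 sqr_ge0.
    by apply: sq1; rewrite normrM normfV (gtr0_norm (b0 i)) ltr_pdivlMr // mul1r.
  rewrite ler_wpDl //; apply: sq1.
  by rewrite normrM normfV (gtr0_norm s0) ltr_pdivlMr // mul1r.
- move=> m m0; suff -> : m = 0 by rewrite map_mx0 mul0mx mxE.
  have [//|mn0] := eqVneq m 0; exfalso; apply: good; exists m; split => //.
  + move=> i; have := Bl m i; rewrite m0 mxE => /esym/eqP.
    rewrite mulf_eq0 invr_eq0 (gt_eqF (b0 i)) orbF => /eqP ->.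
    by rewrite normr0 ltW.
  + have := Br m; rewrite m0 mxE => /esym/eqP.
    rewrite mulf_eq0 invr_eq0 (gt_eqF s0) orbF => /eqP ->.
    by rewrite normr0 ltW.
have [k hk] : exists k : 'cV[int]_(d + 1), map_mx intr k = c - B *m z^T.
  exists (\col_j Num.floor ((c - B *m z^T) j 0)).
  apply/matrixP => j l; rewrite !ord1 !mxE floorK //.
  have := hzi (delta_mx 0 j); rewrite map_delta_mx -rowE.
  have -> : dot (row j B) z = (B *m z^T) j 0.
    by rewrite mxE; apply: eq_bigr => l' _; rewrite !mxE.
  rewrite -rowE [row j c 0 0]mxE -rpredN opprB.
  by rewrite !mxE.
have hxk : hmx x *m (g *m map_mx intr k) = tgt - dg *m z^T.
  rewrite hk !mulmxBr /c /B !mulmxA; congr (_ - _); rewrite mulmxK //.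
  - by rewrite hmxK mul1mx.
  - by rewrite hmxK mul1mx.
have zle j : `|z 0 j| <= cst.
  have h1 : `|z 0 j| ^+ 2 <= cst.
    rewrite real_normK ?num_real //; apply: le_trans (_ : dot z z <= _).
      rewrite /dot (bigD1 j) //= -expr2 lerDl; apply: sumr_ge0 => l _.
      by rewrite -expr2 sqr_ge0.
    apply: le_trans hz _; rewrite divr1 /cst ler_eXn2l ?ltr1n //.
    exact: rank_leq_row.
  have [h|/ltW h] := lerP `|z 0 j| 1; first exact: le_trans h cst_ge1.
  by apply: le_trans h1; rewrite expr2 ler_peMr.
have Zl i : (dg *m z^T) (lshift 1 i) 0 = z 0 (lshift 1 i) / b i.
  by rewrite mul_diag_mx mxE row_mxEl !mxE mulrC.
have Zr : (dg *m z^T) (rshift d 0) 0 = z 0 (rshift d 0) / s.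
  by rewrite mul_diag_mx mxE row_mxEr !mxE mulrC.
exists k; split.
  move=> i; rewrite -vecpE hxk mxE col_mxEu [X in `|X + _|]mxE [X in `|_ + X|]mxE Zl sub0r.
  by rewrite normrN normrM normfV (gtr0_norm (b0 i)) ler_pM2r ?invr_gt0.
rewrite -(vecqE x) hxk mxE col_mxEd [X in `|X + _ - _|]mxE [X in `|_ + X - _|]mxE Zr.
rewrite addrAC subrr sub0r normrN normrM normfV (gtr0_norm s0).
by rewrite ler_pM2r ?invr_gt0.
Qed.

End LatticeCoordinates.

(** * Counting cells that meet thin slabs *)

Section FinCounting.
Variable R : realType.

Lemma card_ord_spread P (A : {set 'I_P}) (r : R) : 0 <= r ->
  (forall a a', a \in A -> a' \in A -> (a <= a')%N -> (a' - a)%:R <= r) ->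
  #|A|%:R <= r + 1.
Proof.
move=> r0 hA; have [->|[a0 a0A]] := set_0Vmem A.
  by rewrite cards0 addr_ge0.
pose lo := [arg min_(a < a0 in A) (a : nat)]%N.
pose hi := [arg max_(a > a0 in A) (a : nat)]%N.
have [loA hlo] : lo \in A /\ forall a, a \in A -> (lo <= a)%N.
  by rewrite /lo; case: arg_minnP => // a aA h; split.
have [hiA hhi] : hi \in A /\ forall a, a \in A -> (a <= hi)%N.
  by rewrite /hi; case: arg_maxnP => // a aA h; split.
have le1 : (#|A| <= (hi - lo).+1)%N.
  have -> : (hi - lo).+1 = size (iota lo (hi - lo).+1) by rewrite size_iota.
  rewrite cardE -(size_map (@nat_of_ord P)); apply: uniq_leq_size.
    by rewrite map_inj_uniq ?enum_uniq //; exact: val_inj.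
  move=> x /mapP[a]; rewrite mem_enum => aA ->; rewrite mem_iota.
  by rewrite hlo //= addnS ltnS subnKC ?hhi // hlo.
apply: le_trans (_ : ((hi - lo).+1)%:R <= _); first by rewrite ler_nat.
by rewrite -natr1 lerD2r; apply: hA => //; apply: hlo.
Qed.

Lemma card_ltn_ord P m : (m <= P)%N -> #|[pred a : 'I_P | (a < m)%N]| = m.
Proof.
move=> mP; rewrite -sum1_card -[RHS](card_ord m) -sum1_card.
by rewrite (big_ord_widen P (fun=> 1%N) mP).
Qed.

Variables (d P : nat).
Implicit Types (n : 'I_d -> nat) (t : {ffun 'I_d -> 'I_P}).

Definition grid n : {set {ffun 'I_d -> 'I_P}} := [set t : {ffun 'I_d -> 'I_P} | [forall i, (t i < n i)%N]].

Lemma card_box (S : 'I_d -> pred 'I_P) :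
  #|[set t : {ffun 'I_d -> 'I_P} | [forall i, S i (t i)]]| = (\prod_i #|S i|)%N.
Proof.
rewrite cardsE; transitivity #|family S|.
  by apply: eq_card => t; apply/forallP/familyP.
by rewrite card_family foldrE big_map big_enum.
Qed.

Lemma card_grid n : (forall i, n i <= P)%N -> #|grid n| = (\prod_i n i)%N.
Proof.
move=> nP; rewrite /grid (card_box (fun i (a : 'I_P) => (a < n i)%N)).
by apply: eq_bigr => i _; exact: card_ltn_ord.
Qed.

(** On a grid line parallel to axis [i], [h] moves in steps of [delta], so the points of the slab
    lie in a window of [2 * s / |delta|] steps; the lines are counted by the other coordinates. *)
Lemma slab_card n i (h : {ffun 'I_d -> 'I_P} -> R) (delta s : R) :
    (forall j, n j <= P)%N -> delta != 0 -> 0 <= s ->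
    (forall t t', (forall j, j != i -> t j = t' j) ->
       h t - h t' = delta * ((t i)%:R - (t' i)%:R)) ->
  #|[set t in grid n | `|h t| <= s]|%:R <=
    (1 + 2 * s / `|delta|) * \prod_(j | j != i) (n j)%:R.
Proof.
move=> nP dn0 s0 hh; set A := [set t in _ | _].
have [->|[t0 t0A]] := set_0Vmem A.
  rewrite cards0 mulr_ge0 //; last by apply: prodr_ge0 => j _.
  by rewrite addr_ge0 // divr_ge0 // mulr_ge0.
have P0 : (0 < P)%N by exact: leq_ltn_trans (leq0n _) (ltn_ord (t0 i)).
(* Resetting coordinate [i] to 0 names the line through [t]. *)
pose er t := [ffun j => if j == i then Ordinal P0 else t j].
pose G0 := [set t : {ffun 'I_d -> 'I_P} |
  [forall j, if j == i then (t j == Ordinal P0) else (t j < n j)%N]].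
have cG0 : #|G0| = (\prod_(j | j != i) n j)%N.
  rewrite /G0 (card_box (fun j (a : 'I_P) => if j == i then a == Ordinal P0 else (a < n j)%N)).
  rewrite (bigD1 i) //= eqxx; set c1 := #|_|.
  have -> : c1 = 1%N by rewrite /c1 -(card1 (Ordinal P0)); apply: eq_card.
  rewrite mul1n; apply: eq_bigr => j ji; rewrite (negPf ji).
  exact: card_ltn_ord.
have -> : #|A| = (\sum_(u in G0) #|[set t in A | er t == u]|)%N.
  rewrite -sum1_card (partition_big er (mem G0)) /=; last first.
    move=> t; rewrite !inE => /andP[/forallP tn _]; apply/forallP => j.
    by rewrite ffunE; case: (j == i); [exact: eqxx | exact: tn].
  apply: eq_bigr => u _; rewrite -sum1_card; apply: eq_bigl => t.
  by rewrite !inE.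
rewrite natr_sum; apply: le_trans (_ : \sum_(u in G0) (1 + 2 * s / `|delta|) <= _).
  apply: ler_sum => u _.
  pose f t : 'I_P := t i.
  have inj : {in [set t in A | er t == u] &, injective f}.
    move=> t t'; rewrite !inE => /andP[_ /eqP e1] /andP[_ /eqP e2] e3.
    apply/ffunP => j; have [->//|ji] := eqVneq j i.
    have := congr1 (fun v : {ffun 'I_d -> 'I_P} => v j) (etrans e1 (esym e2)).
    by rewrite !ffunE (negPf ji).
  rewrite -(card_in_imset inj) addrC; apply: card_ord_spread.
    by rewrite divr_ge0 // mulr_ge0.
  move=> x x' /imsetP[t tA ->] /imsetP[t' t'A ->] le_tt'.
  move: tA t'A; rewrite !inE => /andP[/andP[_ b1] /eqP e1] /andP[/andP[_ b2] /eqP e2].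
  have e3 : h t' - h t = delta * ((t' i)%:R - (t i)%:R).
    apply: hh => j ji.
    have := congr1 (fun v : {ffun 'I_d -> 'I_P} => v j) (etrans e2 (esym e1)).
    by rewrite !ffunE (negPf ji).
  rewrite ler_pdivlMr ?normr_gt0 // natrB //.
  have <- : `|delta * ((t' i)%:R - (t i)%:R)| = ((t' i)%:R - (t i)%:R) * `|delta|.
    by rewrite normrM mulrC (ger0_norm (_ : 0 <= (t' i)%:R - (t i)%:R)) // subr_ge0 ler_nat.
  rewrite -e3; apply: le_trans (ler_normB _ _) _.
  by rewrite mulr2n mulrDl mul1r lerD.
by rewrite sumr_const cG0 -natr_prod mulr_natr.
Qed.

Lemma union_weight (T I : finType) (Q : pred I) (beta : I -> R) (S : I -> {set T})
    (Bad : {set T}) (V : R) :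
    (forall u, u \in Bad -> exists2 a, Q a & u \in S a) ->
    (forall a, Q a -> #|S a|%:R <= beta a * V) ->
  #|Bad|%:R <= (\sum_(a | Q a) beta a) * V.
Proof.
move=> h1 h2.
have sub : Bad \subset \bigcup_(a | Q a) S a.
  by apply/fintype.subsetP => u /h1[a qa ua]; apply/finset.bigcupP; exists a.
have le1 : (#|Bad| <= \sum_(a | Q a) #|S a|)%N.
  apply: leq_trans (subset_leq_card sub) _.
  elim/big_rec2: _ => [|a k B qa IH]; first by rewrite cards0.
  by apply: leq_trans (leq_card_setU _ _) _; rewrite leq_add2l.
apply: le_trans (_ : (\sum_(a | Q a) #|S a|)%:R <= _); first by rewrite ler_nat.
by rewrite natr_sum mulr_suml; apply: ler_sum.
Qed.

(** There are [N - 1] terms: the index will be an integer part [j] with [0 < j < N]. *)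
Definition harm (N : nat) : R := \sum_(1 <= j < N) j%:R^-1.

End FinCounting.

Lemma slab_ratio (R : realFieldType) (f c D N s : R) :
  0 < f -> 0 < c -> 0 < D -> 0 < s -> D <= N * c ->
  4 * s / (f * c) <= 4 * s / (f * D) * N.
Proof.
move=> f0 c0 D0 s0 hD; rewrite ler_pdivrMr ?mulr_gt0 //.
have -> : 4 * s / (f * D) * N * (f * c) = 4 * s * (N * c / D).
  by field; rewrite !gt_eqF.
by rewrite ler_peMr ?mulr_ge0 ?(ltW s0) // ler_pdivlMr // mul1r.
Qed.

Section CodeSums.
Variable R : realType.

Lemma sum_bool_ord W N (F : nat -> R) (lo : nat) : (N <= W.+1)%N ->
  \sum_(a : bool * 'I_W.+1 | (lo <= a.2 < N)%N) F a.2 = 2 * \sum_(lo <= j < N) F j.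
Proof.
move=> NW; rewrite (@big_nat_widenl _ _ _ lo 0) // big_mkord.
rewrite (big_ord_widen_cond W.+1 (fun j => (lo <= j)%N) F NW).
rewrite -[LHS](pair_big_dep xpredT (fun _ (j : 'I_W.+1) => (lo <= j < N)%N)
  (fun _ (j : 'I_W.+1) => F j)) /=.
rewrite big_bool mulr2n mulrDl mul1r.
by congr (_ + _); apply: eq_bigl => j; rewrite andbC.
Qed.

(** The summand depends on coordinate [i] alone, so the sum factors over the coordinates. Each
    factor 2 accounts for a sign; [W] makes the codes a finite type. *)
Lemma sum_code d W (N : 'I_d -> nat) (i : 'I_d) : (forall l, (N l <= W.+1)%N) ->
  \sum_(f : {ffun 'I_d -> bool * 'I_W.+1} |
     [forall l, ((l == i) <= (f l).2 < N l)%N]) ((f i).2)%:R^-1 =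
  2 * harm R (N i) * \prod_(l | l != i) (2 * (N l)%:R) :> R.
Proof.
move=> NW; pose w l (a : bool * 'I_W.+1) : R := if l == i then (a.2)%:R^-1 else 1.
pose Q l (a : bool * 'I_W.+1) := ((l == i) <= a.2 < N l)%N.
transitivity (\sum_(f in family Q) \prod_l w l (f l)).
  apply: eq_big => [f|f _]; first by apply/forallP/familyP.
  rewrite (bigD1 i) //= {1}/w eqxx big1 ?mulr1 // => l /negPf li.
  by rewrite /w li.
rewrite -bigA_distr_big_dep (bigD1 i) //=; congr (_ * _).
  by rewrite /Q /w eqxx (sum_bool_ord (fun j => j%:R^-1)).
apply: eq_bigr => l /negPf li; rewrite /Q /w li (sum_bool_ord (fun=> 1)) //.
by rewrite big_mkord sumr_const card_ord.
Qed.

Lemma sum_code2 d W M (N : 'I_d -> nat) : (forall l, (N l <= W.+1)%N) -> (M <= W.+1)%N ->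
  \sum_(f : (bool * 'I_W.+1) * {ffun 'I_d -> bool * 'I_W.+1} |
     (1 <= f.1.2 < M)%N && [forall l, ((f.2 l).2 < N l)%N]) (f.1.2)%:R^-1 =
  2 * harm R M * \prod_l (2 * (N l)%:R) :> R.
Proof.
move=> NW MW; rewrite -(pair_big_dep (fun a : bool * 'I_W.+1 => 1 <= a.2 < M)%N
  (fun _ (f : {ffun 'I_d -> bool * 'I_W.+1}) => [forall l, ((f l).2 < N l)%N])
  (fun a _ => (a.2)%:R^-1)) /=.
pose Q l (a : bool * 'I_W.+1) := (0 <= a.2 < N l)%N.
have E : \sum_(f : {ffun 'I_d -> bool * 'I_W.+1} | [forall l, ((f l).2 < N l)%N]) 1 =
    \prod_l (2 * (N l)%:R) :> R.
  transitivity (\sum_(f in family Q) \prod_(l < d) (1 : R)).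
    by apply: eq_big => [f|f _]; [apply/forallP/familyP | rewrite big1].
  rewrite -(bigA_distr_big_dep Q (fun _ _ => 1)); apply: eq_bigr => l _.
  by rewrite (sum_bool_ord (fun=> 1)) // big_mkord sumr_const card_ord.
rewrite -E /harm -(@sum_bool_ord W M (fun j => j%:R^-1)) // mulr_suml.
by apply: eq_bigr => a _; rewrite mulr_sumr; apply: eq_bigr => f _; rewrite mulr1.
Qed.

End CodeSums.

(** * Proportion of the cells of a box that are spoilt by dual vectors *)

Section BadCandidates.
Variables (R : realType) (d : nat) (g : 'M[R]_(d + 1)).
Hypothesis gU : g \in unitmx.
Variables (v : 'cV[int]_(d + 1)) (b b' D c : 'I_d -> R) (s : R) (x0 : 'cV[R]_d).
Variables (P : nat) (n : 'I_d -> nat).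
Let q := vecq g v.
Hypotheses (q0 : 0 < q) (b0 : forall i, 0 < b i) (D0 : forall i, 0 < D i).
Hypotheses (c0 : forall i, 0 < c i) (s0 : 0 < s) (nP : forall i, (n i <= P)%N).
Hypothesis nD : forall i, D i <= (n i)%:R * c i.
Hypothesis bc : forall i, b' i * c i <= 2 * s.
Hypothesis vfree : forall m, pairing m v = 0 -> (forall i, `|form g m i| <= b i) -> m = 0.

Definition pt (t : {ffun 'I_d -> 'I_P}) : 'cV[R]_d :=
  \col_i (x0 i 0 + c i * (t i)%:R).

Definition badat m t := (forall i, `|form g m i| <= b' i) /\ `|formx g m (pt t)| <= s.

(** One step of the grid along axis [i] changes [formx] by at most [b' i * c i <= 2 * s]. Hence the
    additive 1 of [slab_card] is no larger than its other term, and doubling that term gives the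
    4. *)
Lemma formx_slab m i : 0 < `|form g m i| -> `|form g m i| <= b' i ->
  #|[set t in grid P n | `|formx g m (pt t)| <= s]|%:R <=
  4 * s / (`|form g m i| * D i) * \prod_j (n j)%:R.
Proof.
move=> f0 fb; have fc0 : 0 < `|form g m i| * c i by rewrite mulr_gt0.
have fn0 : - (form g m i * c i) != 0.
  by rewrite oppr_eq0 mulf_neq0 ?(gt_eqF (c0 i)) // -normr_gt0.
apply: le_trans (slab_card (i := i) (delta := - (form g m i * c i)) nP fn0 (ltW s0) _) _.
  move=> t t' tt'; rewrite /formx opprD opprK addrACA subrr add0r.
  rewrite (bigD1 i) //= [X in _ + X](bigD1 i) //= !mxE.
  have -> : \sum_(j | j != i) form g m j * pt t j 0 = \sum_(j | j != i) form g m j * pt t' j 0.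
    by apply: eq_bigr => j ji; rewrite !mxE tt'.
  ring.
rewrite normrN normrM (gtr0_norm (c0 i)) [X in _ <= _ * X](bigD1 i) //= mulrA.
apply: ler_wpM2r; first by apply: prodr_ge0 => j _.
have h1 : 1 <= 2 * s / (`|form g m i| * c i).
  rewrite ler_pdivlMr // mul1r; apply: le_trans (bc i).
  by rewrite ler_pM2r.
have h2 : 4 * s / (`|form g m i| * c i) <= 4 * s / (`|form g m i| * D i) * (n i)%:R.
  exact: slab_ratio.
apply: le_trans h2; move: h1; rewrite -!mulrA; lra.
Qed.

(** The union bound runs over codes: each code stands for at most one dual vector of the class, so a
    single slab is charged to it. *)
Lemma class_card (Cl : 'rV[int]_(d + 1) -> Prop) (I : finType)
    (cd : 'rV[int]_(d + 1) -> I) (Q : pred I) (beta : I -> R) (V : R)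
    (A : {set {ffun 'I_d -> 'I_P}}) : 0 <= V ->
    (forall m m', Cl m -> Cl m' -> cd m = cd m' -> m = m') ->
    (forall m, Cl m -> Q (cd m)) -> (forall a, Q a -> 0 <= beta a) ->
    (forall m, Cl m -> (forall i, `|form g m i| <= b' i) ->
      #|[set t in grid P n | `|formx g m (pt t)| <= s]|%:R <= beta (cd m) * V) ->
    (forall t, t \in A -> t \in grid P n /\ exists2 m, Cl m & badat m t) ->
  #|A|%:R <= (\sum_(a | Q a) beta a) * V.
Proof.
move=> V0 inj hQ hb hslab hA.
pose S a := [set t in grid P n | `[< exists m, [/\ Cl m, cd m = a & badat m t] >]].
apply: (union_weight (S := S)).
  move=> t /hA[tg [m mC mt]]; exists (cd m); first exact: hQ.
  by rewrite inE tg; apply/asboolP; exists m.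
move=> a Qa; have [[m [mC ma mb]]|h] := pselect
  (exists m, [/\ Cl m, cd m = a & forall i, `|form g m i| <= b' i]).
  apply: le_trans (_ : #|[set t in grid P n | `|formx g m (pt t)| <= s]|%:R <= _).
    rewrite ler_nat; apply: subset_leq_card; apply/fintype.subsetP => t.
    rewrite !inE => /andP[-> /asboolP[m' [m'C m'a [_ m't]]]] /=.
    by rewrite (inj m m') // ma m'a.
  by rewrite -ma; apply: hslab.
have -> : S a = finset.set0.
  apply/finset.setP => t; rewrite !inE; apply/negP => /andP[_ /asboolP[m [mC ma [mb _]]]].
  by apply: h; exists m.
by rewrite cards0 mulr_ge0 // hb.
Qed.

Variable W : nat.
(* [code m] is a sign and an integer part for each [form m i / b i]; two dual vectors
   with the same code and the same pairing with [v] differ by a vector that the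
   hypothesis [vfree] forces to be [0]. *)
Definition code m : {ffun 'I_d -> bool * 'I_W.+1} :=
  [ffun l => (form g m l < 0, inord (Num.truncn (`|form g m l| / b l)))].

Lemma code_val m l : `|form g m l| < b l * W.+1%:R ->
  ((code m l).2 : nat) = Num.truncn (`|form g m l| / b l).
Proof.
move=> h; rewrite ffunE /= inordK // truncn_lt_nat ?divr_ge0 ?(ltW (b0 l)) //.
by rewrite ltr_pdivrMr // mulrC.
Qed.

Lemma code_inj m m' : pairing m v = pairing m' v ->
    (forall l, `|form g m l| < b l * W.+1%:R) ->
    (forall l, `|form g m' l| < b l * W.+1%:R) -> code m = code m' -> m = m'.
Proof.
move=> pmm hm hm' cc; apply/eqP; rewrite -subr_eq0; apply/eqP; apply: vfree.
  by rewrite pairing_sub pmm subrr.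
move=> l; rewrite form_sub.
have e2 := congr1 (fun f : {ffun 'I_d -> bool * 'I_W.+1} => ((f l).2 : nat)) cc.
have e1 := congr1 (fun f : {ffun 'I_d -> bool * 'I_W.+1} => (f l).1) cc.
rewrite /= !code_val // in e2; rewrite !ffunE /= in e1.
have := truncn_itv (divr_ge0 (normr_ge0 (form g m l)) (ltW (b0 l))).
have := truncn_itv (divr_ge0 (normr_ge0 (form g m' l)) (ltW (b0 l))).
rewrite e2; move: (Num.truncn _) => k.
rewrite !ler_pdivlMr // !ltr_pdivrMr // -natr1 mulrDl mul1r.
move: e1 (k%:R * b l) => e1 z /andP[h1 h2] /andP[h3 h4].
move: e1 h1 h2 h3 h4; move: (form g m l) (form g m' l) => f f'.
have [f0|f0] := ltrP f 0; have [f'0|f'0] := ltrP f' 0 => // _.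
  by rewrite (ltr0_norm f0) (ltr0_norm f'0) ler_norml => *; apply/andP; split; lra.
by rewrite (ger0_norm f0) (ger0_norm f'0) ler_norml => *; apply/andP; split; lra.
Qed.

(** If [j >= 1] is the integer part of [|form m i| / b i], the slab of [m] fills a share at most
    [4 * s / (b i * D i * j)] of the grid; summing over codes produces the harmonic sum. *)
Lemma bad_zero_card i (N : 'I_d -> nat) (A : {set {ffun 'I_d -> 'I_P}}) :
    (forall l, (N l <= W.+1)%N) ->
    (forall t, t \in A -> t \in grid P n /\ exists2 m, [/\ pairing m v = 0,
       b i <= `|form g m i| & forall l, `|form g m l| < b l * (N l)%:R] & badat m t) ->
  #|A|%:R <= 4 * s / (b i * D i) *
    (2 * harm R (N i) * \prod_(l | l != i) (2 * (N l)%:R)) * \prod_l (n l)%:R.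
Proof.
move=> NW hA.
have lW m : (forall l, `|form g m l| < b l * (N l)%:R) ->
    forall l, `|form g m l| < b l * W.+1%:R.
  move=> h l; apply: lt_le_trans (h l) _.
  by rewrite ler_wpM2l ?ler_nat // ltW.
have i1 m : b i <= `|form g m i| -> (1 <= Num.truncn (`|form g m i| / b i))%N.
  by move=> h; rewrite truncn_gt0 ler_pdivlMr // mul1r.
rewrite -(@sum_code R d W N i NW) mulr_sumr.
apply: (class_card (cd := code)) hA.
- by apply: prodr_ge0 => l _.
- move=> m m' [pm _ hm] [pm' _ hm'] cc; apply: code_inj cc; rewrite ?pm ?pm' //; exact: lW.
- move=> m [pm im hm]; apply/forallP => l; rewrite code_val; last exact: lW.
  apply/andP; split; first by have [->|] := eqVneq l i; [exact: i1|].
  rewrite truncn_lt_nat ?divr_ge0 ?(ltW (b0 l)) //.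
  by rewrite ltr_pdivrMr // mulrC.
- move=> a _; rewrite mulr_ge0 ?invr_ge0 // divr_ge0 ?mulr_ge0 ?(ltW s0) ?(ltW (b0 i)) ?(ltW (D0 i)) //.
- move=> m [pm im hm] mb'; have f0 : 0 < `|form g m i| by exact: lt_le_trans im.
  apply: le_trans (formx_slab f0 (mb' i)) _.
  apply: ler_wpM2r; first by apply: prodr_ge0 => l _.
  rewrite code_val; last exact: lW.
  have := i1 _ im.
  have := truncn_itv (divr_ge0 (normr_ge0 (form g m i)) (ltW (b0 i))).
  move: (Num.truncn _) => k /andP[hk _] k1.
  rewrite -[leRHS]mulrA -invfM ler_wpM2l ?mulr_ge0 ?(ltW s0) //.
  have kR : 0 < k%:R :> R by rewrite ltr0n.
  rewrite lef_pV2 ?posrE ?mulr_gt0 // mulrAC ler_wpM2r ?(ltW (D0 i)) //.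
  by rewrite ler_pdivlMr // in hk; rewrite mulrC.
Qed.

(** If the pairing is [e], some [|form m i| * D i] is at least [|e| / (2 * d * q)], so the slab
    fills a share at most [8 * d * q * s / |e|], whichever [i] it is. The value [e] joins the code
    and carries the harmonic sum. *)
Lemma bad_nonzero_card M (N : 'I_d -> nat) (A : {set {ffun 'I_d -> 'I_P}}) :
    (forall l, (N l <= W.+1)%N) -> (M <= W.+1)%N ->
    (forall t, t \in A -> t \in grid P n /\ exists2 m,
       [/\ pairing m v != 0, (`|pairing m v| < M)%N,
           forall l, `|form g m l| < b l * (N l)%:R &
           exists i, `|pairing m v|%:R <= 2 * d%:R * q * (`|form g m i| * D i)] & badat m t) ->
  #|A|%:R <= 8 * d%:R * q * s *
    (2 * harm R M * \prod_l (2 * (N l)%:R)) * \prod_l (n l)%:R.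
Proof.
move=> NW MW hA.
have lW m : (forall l, `|form g m l| < b l * (N l)%:R) ->
    forall l, `|form g m l| < b l * W.+1%:R.
  move=> h l; apply: lt_le_trans (h l) _.
  by rewrite ler_wpM2l ?ler_nat // ltW.
pose cd m := ((pairing m v < 0, inord `|pairing m v|%N) : bool * 'I_W.+1, code m).
have cdE m : (`|pairing m v| < M)%N -> ((cd m).1.2 : nat) = `|pairing m v|%N.
  by move=> h; rewrite /= inordK // (leq_trans h).
rewrite -(@sum_code2 R d W M N NW MW) mulr_sumr.
apply: (class_card (cd := cd)) hA.
- by apply: prodr_ge0 => l _.
- move=> m m' [pm h1 hm _] [pm' h2 hm' _] cc.
  have [c1 c2] : (cd m).1 = (cd m').1 /\ (cd m).2 = (cd m').2 by rewrite cc.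
  apply: code_inj c2; try exact: lW.
  have a1 : `|pairing m v|%N = `|pairing m' v|%N by rewrite -(cdE m) // -(cdE m') // c1.
  have /= a2 : (pairing m v < 0) = (pairing m' v < 0) by case: c1.
  by case: (pairing m v) (pairing m' v) a1 a2 pm pm' => [k|k] [k'|k'] //=; lia.
- move=> m [pm h1 hm _]; rewrite cdE // h1 absz_gt0 pm /=.
  apply/forallP => l; rewrite code_val; last exact: lW.
  rewrite truncn_lt_nat ?divr_ge0 ?(ltW (b0 l)) //.
  by rewrite ltr_pdivrMr // mulrC.
- move=> a _; rewrite !mulr_ge0 ?invr_ge0 // ltW //.
- move=> m [pm h1 hm [i hi]] mb'; rewrite cdE //.
  have e0 : 0 < `|pairing m v|%:R :> R by rewrite ltr0n absz_gt0.
  have f0 : 0 < `|form g m i|.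
    rewrite normr_gt0; apply/eqP => z; move: hi; rewrite z normr0 mul0r mulr0.
    by rewrite leNgt e0.
  apply: le_trans (formx_slab f0 (mb' i)) _.
  apply: ler_wpM2r; first by apply: prodr_ge0 => l _.
  move: e0 hi; move: (`|pairing m v|%:R : R) => e e0 hi.
  rewrite ler_pdivrMr ?mulr_gt0 // mulrAC ler_pdivlMr //.
  apply: le_trans (_ : 4 * s * (2 * d%:R * q * (`|form g m i| * D i)) <= _).
    by apply: ler_wpM2l => //; rewrite mulr_ge0 ?(ltW s0).
  by rewrite le_eqVlt; apply/orP; left; apply/eqP; ring.
Qed.

(** The direction [i0] is kept apart because, for the scales used later, its term cannot afford the
    product of the other [N l]. Once the vectors reaching [b l] for some other [l] are set aside,
    the remaining ones have integer part 0 there, and only signs are left to count, whence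
    [2 ^ d]. *)
Lemma bad_card (i0 : 'I_d) M (N : 'I_d -> nat) :
    (forall l, (0 < N l <= W.+1)%N) -> (M <= W.+1)%N ->
    (forall t i, t \in grid P n -> `|vecp g v i + q * pt t i 0| <= q * D i) ->
    q * s <= 2^-1 -> (forall i, b' i < b i * (N i)%:R) ->
    2 * q * \sum_i b' i * D i < M%:R ->
  #|[set t in grid P n | `[< dual_bad g b' s (pt t) >]]|%:R <=
  (8 * d%:R * q * s * (2 * harm R M * \prod_l (2 * (N l)%:R)) +
   \sum_(i | i != i0) 4 * s / (b i * D i) *
     (2 * harm R (N i) * \prod_(l | l != i) (2 * (N l)%:R)) +
   4 * s / (b i0 * D i0) * (2 * harm R (N i0) * 2 ^+ d)) * \prod_l (n l)%:R.
Proof.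
move=> hN MW hbox qs hb' hM.
have N0 l : (0 < N l)%N by case/andP: (hN l).
have NW l : (N l <= W.+1)%N by case/andP: (hN l).
have d0 : (0 < d)%N by exact: leq_ltn_trans (leq0n _) (ltn_ord i0).
pose A1 := [set t in grid P n | `[< exists2 m, pairing m v != 0 & badat m t >]].
pose A2 i := [set t in grid P n | `[< exists2 m, pairing m v = 0 /\ b i <= `|form g m i| & badat m t >]].
pose A3 := [set t in grid P n | `[< exists2 m, [/\ pairing m v = 0,
   b i0 <= `|form g m i0| & forall l, l != i0 -> `|form g m l| < b l] & badat m t >]].
have ltN m t l : badat m t -> `|form g m l| < b l * (N l)%:R.
  by move=> [h _]; exact: le_lt_trans (h l) (hb' l).
have h1 : #|A1|%:R <= 8 * d%:R * q * s *
    (2 * harm R M * \prod_l (2 * (N l)%:R)) * \prod_l (n l)%:R.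
  apply: bad_nonzero_card => // t; rewrite inE => /andP[tg /asboolP[m pm mt]].
  split => //; exists m => //.
  have e1 : (1 : R) <= `|pairing m v|%:R by rewrite ler1n absz_gt0.
  have e2 : `|pairing m v|%:R <= q * (\sum_i `|form g m i| * D i) + q * s.
    rewrite natr_absz intr_norm (pairingE gU (pt t)) -/q.
    apply: le_trans (ler_normD _ _) _; apply: lerD.
      rewrite mulr_sumr; apply: le_trans (ler_norm_sum _ _ _) _.
      apply: ler_sum => i _; rewrite normrM mulrCA ler_wpM2l //; exact: hbox.
    rewrite normrM (gtr0_norm q0) mulrC ler_wpM2l ?(ltW q0) //.
    by case: mt.
  have e3 : `|pairing m v|%:R <= 2 * q * (\sum_i `|form g m i| * D i).
    by move: e1 e2 qs; rewrite -mulrA; lra.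
  split => //; last 2 first.
  - by move=> l; exact: ltN mt.
  - apply/not_existsP => h.
    have : \sum_i `|form g m i| * D i < \sum_(i < d) (`|pairing m v|%:R / (2 * d%:R * q)).
      apply: ltr_sum; first by apply/hasP; exists i0; rewrite ?mem_index_enum.
      move=> i _; rewrite ltr_pdivlMr ?mulr_gt0 ?ltr0n // mulrC ltNge.
      exact/negP/h.
    rewrite sumr_const card_ord -[_ *+ d]mulr_natr => h2.
    have h3 : 2 * q * (\sum_i `|form g m i| * D i) < `|pairing m v|%:R.
      apply: lt_le_trans (_ : 2 * q * (`|pairing m v|%:R / (2 * d%:R * q) * d%:R) <= _).
        by rewrite ltr_pM2l // mulr_gt0.
      rewrite le_eqVlt; apply/orP; left; apply/eqP; field.
      by rewrite pnatr_eq0 -lt0n d0 gt_eqF.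
    by move: (le_lt_trans e3 h3); rewrite ltxx.
  - rewrite -(ltr_nat R); apply: le_lt_trans e3 (le_lt_trans _ hM).
    rewrite ler_wpM2l ?mulr_ge0 ?(ltW q0) //; apply: ler_sum => i _.
    by rewrite ler_wpM2r ?(ltW (D0 i)) //; case: mt.
have h2 i : #|A2 i|%:R <= 4 * s / (b i * D i) *
    (2 * harm R (N i) * \prod_(l | l != i) (2 * (N l)%:R)) * \prod_l (n l)%:R.
  apply: bad_zero_card => // t; rewrite inE => /andP[tg /asboolP[m [pm im] mt]].
  by split => //; exists m => //; split => // l; exact: ltN mt.
have h3 : #|A3|%:R <= 4 * s / (b i0 * D i0) * (2 * harm R (N i0) * 2 ^+ d) *
    \prod_l (n l)%:R.
  apply: le_trans (_ : 4 * s / (b i0 * D i0) * (2 * harm R (N i0) *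
     \prod_(l < d | l != i0) (2 * 1%:R)) * \prod_l (n l)%:R <= _); last first.
    apply: ler_wpM2r; first by apply: prodr_ge0 => l _.
    apply: ler_wpM2l.
      by rewrite divr_ge0 ?mulr_ge0 ?(ltW s0) ?(ltW (b0 i0)) ?(ltW (D0 i0)).
    apply: ler_wpM2l; first by rewrite mulr_ge0 // /harm sumr_ge0 // => j _; rewrite invr_ge0.
    rewrite mulr1 prodr_const ler_eXn2l ?ltr1n //.
    by rewrite -[X in (_ <= X)%N](card_ord d) max_card.
  have := @bad_zero_card i0 (fun l => if l == i0 then N i0 else 1%N) A3.
  rewrite eqxx => H; apply: le_trans (H _ _) _.
  - by move=> l; case: ifP => // _; exact: NW.
  - move=> t; rewrite inE => /andP[tg /asboolP[m [pm im hm] mt]].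
    split => //; exists m => //; split => // l.
    by have [->|li] := eqVneq l i0; [exact: ltN mt | rewrite mulr1; exact: hm].
  - apply: ler_wpM2r; first by apply: prodr_ge0 => l _.
    rewrite le_eqVlt; apply/orP; left; apply/eqP; congr (_ * (_ * _)).
    by apply: eq_bigr => l /negPf ->.
have sub : [set t in grid P n | `[< dual_bad g b' s (pt t) >]] \subset
    A1 :|: ((\bigcup_(i | i != i0) A2 i)%SET :|: A3).
  apply/fintype.subsetP => t; rewrite inE => /andP[tg /asboolP[m [m0 mb ms]]].
  have mt : badat m t by [].
  rewrite 2!finset.in_setU; have [pm|pm] := eqVneq (pairing m v) 0; last first.
    by apply/orP; left; rewrite inE tg; apply/asboolP; exists m.
  apply/orP; right; have [[i ii0 hi]|hn] := pselect (exists2 i, i != i0 & b i <= `|form g m i|).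
    apply/orP; left; apply/finset.bigcupP; exists i => //.
    by rewrite inE tg; apply/asboolP; exists m.
  apply/orP; right; rewrite inE tg; apply/asboolP; exists m => //.
  have hl l : l != i0 -> `|form g m l| < b l.
    by move=> li; rewrite ltNge; apply/negP => h; apply: hn; exists l.
  (* If [|form m i0|] were below [b i0] too, [m] would lie in the box that [vfree] excludes. *)
  split => //; rewrite leNgt; apply/negP => h; move/eqP: m0; apply.
  by apply: vfree => // l; have [->|/hl/ltW] := eqVneq l i0; rewrite ?(ltW h).
have c2 : #|(\bigcup_(i | i != i0) A2 i)%SET|%:R <= (\sum_(i | i != i0) 4 * s / (b i * D i) *
     (2 * harm R (N i) * \prod_(l | l != i) (2 * (N l)%:R))) * \prod_l (n l)%:R.
  apply: (union_weight (S := A2)) => [t /finset.bigcupP[i ii ti]|i _]; last exact: h2.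
  by exists i.
rewrite [leRHS]mulrDl [X in _ <= X + _]mulrDl.
apply: le_trans (_ : (#|A1| + (#|(\bigcup_(i | i != i0) A2 i)%SET| + #|A3|))%:R <= _).
  rewrite ler_nat; apply: leq_trans (subset_leq_card sub) _.
  apply: leq_trans (leq_card_setU _ _) _; rewrite leq_add2l.
  exact: leq_trans (leq_card_setU _ _) _.
rewrite natrD -[leRHS]addrA; apply: lerD; first exact: h1.
by rewrite natrD; apply: lerD; [exact: c2 | exact: h3].
Qed.

End BadCandidates.

Local Open Scope classical_set_scope.

(** * Avoiding a cover along a branch of a tree *)

Section Tree.
Variables (R : realType) (X T : Type).
Variables (valid : nat -> T -> Prop) (B : nat -> T -> set X).
Variables (F : nat -> set X) (rho : nat -> nat -> R) (K : nat -> nat).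
Hypothesis rho_ge0 : forall k j, 0 <= rho k j.
Hypothesis step : forall k v, valid k v ->
  exists N (ch : 'I_N.+1 -> T),
    [/\ forall i, valid k.+1 (ch i), forall i, B k.+1 (ch i) `<=` B k v &
        forall j, #|[set i | `[< B k.+1 (ch i) `&` F j !=set0 >]]%SET|%:R <=
          rho k j * N.+1%:R].

(* The infinite sum over [j] of the proportion of level-[K j] descendants meeting
   [F j] is an average over the children, so some child does not increase it. *)
Lemma avoiding_path v0 : valid 0 v0 ->
    (\sum_(0 <= j <oo) (\prod_(0 <= k < K j) rho k j)%:E < 1)%E ->
  exists p : nat -> T, [/\ p 0%N = v0, forall k, valid k (p k),
    forall k, B k.+1 (p k.+1) `<=` B k (p k) &
    forall j, B (K j) (p (K j)) `&` F j = set0].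
Proof.
move=> v00 hsum.
have [ch hch] : exists ch : nat -> T -> {N : nat & 'I_N.+1 -> T},
    forall k v, valid k v -> let: existT N c := ch k v in
    [/\ forall i, valid k.+1 (c i), forall i, B k.+1 (c i) `<=` B k v &
        forall j, #|[set i | `[< B k.+1 (c i) `&` F j !=set0 >]]%SET|%:R <=
          rho k j * N.+1%:R].
  have /choice[ch hch] : forall kv : nat * T, exists c : {N : nat & 'I_N.+1 -> T},
      valid kv.1 kv.2 -> let: existT N c := c in
    [/\ forall i, valid kv.1.+1 (c i), forall i, B kv.1.+1 (c i) `<=` B kv.1 kv.2 &
        forall j, #|[set i | `[< B kv.1.+1 (c i) `&` F j !=set0 >]]%SET|%:R <=
          rho kv.1 j * N.+1%:R].
    move=> [k v]; have [vv|nv] := pselect (valid k v); last first.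
      by exists (existT _ 0%N (fun=> v)).
    by have [N [c hc]] := step vv; exists (existT _ N c).
  by exists (fun k v => ch (k, v)) => k v; exact: (hch (k, v)).
pose NN k v := projT1 (ch k v).
pose cc k v : 'I_(NN k v).+1 -> T := projT2 (ch k v).
have hcc k v : valid k v ->
    [/\ forall i, valid k.+1 (cc k v i), forall i, B k.+1 (cc k v i) `<=` B k v &
        forall j, #|[set i | `[< B k.+1 (cc k v i) `&` F j !=set0 >]]%SET|%:R <=
          rho k j * (NN k v).+1%:R].
  by move=> /hch; rewrite /cc /NN; case: (ch k v).
pose ind j k v : R := if `[< B k v `&` F j !=set0 >] then 1 else 0.
(* Average, over the descendants [fuel] levels below [v], of the indicator that the box meets
   [F j]. *)
pose M := fix M (fuel : nat) j k v : R := match fuel with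
  | 0 => ind j k v
  | f.+1 => (\sum_i M f j k.+1 (cc k v i)) / (NN k v).+1%:R end.
have M0 f j k v : 0 <= M f j k v.
  elim: f k v => [|f IH] k v /=; first by rewrite /ind; case: ifP.
  by rewrite divr_ge0 // sumr_ge0.
have Mnone f j k v : valid k v -> ~ (B k v `&` F j !=set0) -> M f j k v = 0.
  elim: f k v => [|f IH] k v vv hn /=; first by rewrite /ind; case: asboolP.
  have [h1 h2 _] := hcc k v vv.
  rewrite big1 ?mul0r // => i _; apply: IH => // -[x [xB xF]]; apply: hn.
  by exists x; split => //; exact: h2 xB.
have Mle f j k v : valid k v -> M f j k v <= \prod_(k <= l < k + f) rho l j.
  elim: f k v => [|f IH] k v vv /=.
    by rewrite addn0 big_geq // /ind; case: ifP.
  have [h1 h2 h3] := hcc k v vv.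
  rewrite addnS big_ltn ?ltnS ?leq_addr // -addSn.
  rewrite ler_pdivrMr ?ltr0n //.
  apply: le_trans (_ : #|[set i | `[< B k.+1 (cc k v i) `&` F j !=set0 >]]%SET|%:R *
     \prod_(k.+1 <= l < k.+1 + f) rho l j <= _); last first.
    by rewrite mulrAC ler_wpM2r ?h3 // prodr_ge0.
  rewrite (bigID (mem [set i | `[< B k.+1 (cc k v i) `&` F j !=set0 >]]%SET)) /=.
  rewrite [X in _ + X]big1 ?addr0; last first.
    by move=> i; rewrite inE => /asboolPn; apply: Mnone.
  rewrite mulrC mulr_natr -sumr_const.
  by apply: ler_sum => i _; exact: IH.
(* The subtraction is truncated: from level [K j] on, this is the indicator at the current node,
   which cannot increase along nested boxes. *)
pose m j k v := M (K j - k)%N j k v.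
have m_avg k v j : valid k v ->
    \sum_i m j k.+1 (cc k v i) <= (NN k v).+1%:R * m j k v.
  move=> vv; rewrite /m; have [kK|Kk] := ltnP k (K j).
    have -> : (K j - k = (K j - k.+1).+1)%N by lia.
    by rewrite /= mulrC divfK // pnatr_eq0.
  have -> : (K j - k = 0)%N by lia.
  have -> : (K j - k.+1 = 0)%N by lia.
  have [_ h2 _] := hcc k v vv.
  rewrite /= mulrC mulr_natr -[X in _ *+ X]card_ord -sumr_const.
  apply: ler_sum => i _; rewrite /ind; case: asboolP => [[x [xB xF]]|_]; last by case: ifP.
  by case: asboolP => // hn; exfalso; apply: hn; exists x; split => //; exact: h2 xB.
pose Phi k v := (\sum_(0 <= j <oo) (m j k v)%:E)%E.
have next k v : valid k v /\ (Phi k v < 1)%E ->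
    exists v', [/\ valid k.+1 v', B k.+1 v' `<=` B k v & (Phi k.+1 v' < 1)%E].
  move=> [vv hP]; have [h1 h2 _] := hcc k v vv.
  apply: contrapT => hn.
  have ge1 i : (1 <= Phi k.+1 (cc k v i))%E.
    by rewrite leNgt; apply/negP => h; apply: hn; exists (cc k v i).
  have : ((NN k v).+1%:R%:E <= (NN k v).+1%:R%:E * Phi k v)%E.
    rewrite -nneseriesZl; last by move=> i _; rewrite lee_fin; exact: M0.
    apply: le_trans (_ : \sum_i Phi k.+1 (cc k v i) <= _)%E.
      rewrite -[X in X%:R]card_ord -sumr_const -sumEFin.
      by apply: lee_sum => i _; exact: ge1.
    rewrite /Phi -nneseries_sum; last by move=> i j _; rewrite lee_fin; exact: M0.
    apply: lee_nneseries => [j _ _|j _]; first by rewrite sume_ge0 // => i _; rewrite lee_fin; exact: M0.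
    by rewrite sumEFin -EFinM lee_fin; exact: m_avg.
  apply/negP; rewrite -ltNge -[ltRHS]mule1 lte_pmul2l // lte_fin ltr0n.
have /choice[nx hnx] : forall kv : nat * T, exists v',
    valid kv.1 kv.2 /\ (Phi kv.1 kv.2 < 1)%E ->
    [/\ valid kv.1.+1 v', B kv.1.+1 v' `<=` B kv.1 kv.2 & (Phi kv.1.+1 v' < 1)%E].
  move=> [k v]; have [/next[v' hv']|hn] := pselect (valid k v /\ (Phi k v < 1)%E).
    by exists v'.
  by exists v.
pose p := fix p k := match k with 0 => v0 | k'.+1 => nx (k', p k') end.
have pP k : valid k (p k) /\ (Phi k (p k) < 1)%E.
  elim: k => [|k IH] /=.
    split => //; apply: le_lt_trans hsum; apply: lee_nneseries => [j _ _|j _].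
      by rewrite lee_fin; exact: M0.
    by rewrite lee_fin /m subn0 Mle.
  by have [] := hnx (k, p k) IH.
exists p; split => // [k|k|j].
- by case: (pP k).
- by have [] := hnx (k, p k) (pP k).
- have [vv hP] := pP (K j).
  have : ((m j (K j) (p (K j)))%:E < 1)%E.
    apply: le_lt_trans hP; rewrite /Phi (nneseriesD1 (n := j)) //.
      by rewrite leeDl // nneseries_ge0 // => i _ _; rewrite lee_fin; exact: M0.
    by move=> i _; rewrite lee_fin; exact: M0.
  rewrite /m subnn /= /ind lte_fin; case: asboolP => [_|]; first by rewrite ltxx.
  by move=> /set0P/negP; rewrite negbK => /eqP.
Qed.

End Tree.

(** * From avoidance of covers to Hausdorff dimension *)

Section HausdorffLower.
Variables (R : realType) (T : choiceType) (dist : T -> T -> R).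
Implicit Types (A : set T).

(** A null set has covers of arbitrarily small [s]-sum. Since [avoid] asks for positive radii,
    members that are empty or of diameter 0 receive the radius [small j], and the [s']-powers of
    these sum to at most [eta / 2]. Raising [s] to [s'] costs nothing because all radii are at most
    1. *)
Lemma hausdorff_measure_neq0 A (s s' eta r0 : R) :
    0 <= s -> s < s' -> 0 < eta -> 0 < r0 -> r0 <= 1 ->
    (forall (F : nat -> set T) (r : nat -> R), (forall j, 0 < r j <= r0) ->
       (forall j x y, F j x -> F j y -> dist x y <= r j) ->
       (\sum_(0 <= j <oo) (r j `^ s')%:E < eta%:E)%E ->
       exists2 x, A x & forall j, ~ F j x) ->
  hausdorff_measure dist s A <> 0%E.
Proof.
move=> s0 ss' eta0 r00 r01 avoid hm.
have s'0 : 0 < s' by exact: le_lt_trans ss'.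
have : (hausdorff_content dist r0 s A < (eta / 2)%:E)%E.
  apply: (@le_lt_trans _ _ 0%E); last by rewrite lte_fin divr_gt0.
  by rewrite -hm; apply: ereal_sup_ubound; exists r0.
move=> /ereal_inf_lt[_ [F [Acov Fdiam] <-] Fsum].
pose small j := Num.min r0 ((eta / 2 / (2 ^ j.+1)%:R) `^ s'^-1).
have small0 j : 0 < small j.
  by rewrite /small lt_min r00 powR_gt0 // !divr_gt0 // ltr0n expn_gt0.
have diam_ge0 j : (0 <= diam dist (F j))%E.
  by apply: ereal_sup_ubound; left.
pose D j := fine (diam dist (F j)).
have DE j : diam dist (F j) = (D j)%:E.
  by rewrite /D fineK // ge0_fin_numE //; apply: le_lt_trans (Fdiam j) (ltry _).
have Dr0 j : D j <= r0 by have := Fdiam j; rewrite DE lee_fin.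
have D_ge0 j : 0 <= D j by have := diam_ge0 j; rewrite DE lee_fin.
have distD j x y : F j x -> F j y -> dist x y <= D j.
  by move=> Fx Fy; rewrite -lee_fin -DE; apply: ereal_sup_ubound; right; exists x, y.
pose r j := if (F j == set0) || (D j == 0) then small j else D j.
have [|||x Ax xF] := avoid F r.
- move=> j; rewrite /r; case: ifP => [_|/negbT]; first by rewrite small0 ge_min lexx.
  by rewrite negb_or => /andP[_ Dn0]; rewrite lt_neqAle eq_sym Dn0 D_ge0 Dr0.
- move=> j x y Fx Fy; apply: le_trans (distD _ _ _ Fx Fy) _; rewrite /r.
  case: ifP => // /orP[/eqP F0|/eqP ->]; last exact: ltW.
  by move: Fx; rewrite F0.
- apply: (@le_lt_trans _ _ (\sum_(0 <= j <oo) diam_pow dist s (F j) + (eta / 2)%:E)%E).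
    apply: le_trans (epsilon_trick _ _ _); last 2 first.
    + by move=> j; rewrite /diam_pow; case: ifP => // _; exact: poweR_ge0.
    + by rewrite ltW // divr_gt0.
    apply: lee_nneseries => [j _ _|j _]; first by rewrite lee_fin powR_ge0.
    have small_le : small j `^ s' <= eta / 2 / (2 ^ j.+1)%:R.
      have e0 : 0 <= eta / 2 / (2 ^ j.+1)%:R by rewrite !divr_ge0 // ltW.
      have m0 := small0 j; rewrite /small in m0 *.
      have ue : ((eta / 2 / (2 ^ j.+1)%:R) `^ s'^-1) `^ s' = eta / 2 / (2 ^ j.+1)%:R.
        by rewrite -powRrM mulVf ?gt_eqF // powRr1.
      rewrite -[leRHS]ue; apply: ge0_ler_powR; rewrite ?nnegrE ?powR_ge0 ?(ltW s'0) ?(ltW m0) //.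
      by rewrite ge_min lexx orbT.
    rewrite /r; case: ifP => [_|/negbT].
      rewrite -[leLHS]add0e; apply: leeD; last by rewrite lee_fin.
      by rewrite /diam_pow; case: ifP => // _; exact: poweR_ge0.
    rewrite negb_or => /andP[Fn0 Dn0]; rewrite -[leLHS]adde0; apply: leeD.
      rewrite /diam_pow (negPf Fn0) DE poweR_EFin lee_fin.
      have Dgt0 : 0 < D j by rewrite lt_neqAle eq_sym Dn0 D_ge0.
      by apply: ger_powR; rewrite ?Dgt0 ?(le_trans (Dr0 j)) // ltW.
    by rewrite lee_fin !divr_ge0 // ltW.
  by rewrite [ltRHS](_ : _ = (eta / 2)%:E + (eta / 2)%:E)%E ?lte_leD // -EFinD -splitr.
- by have [j _ Fjx] := Acov _ Ax; exact: xF Fjx.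
Qed.

Lemma hausdorff_dim_ge A (s0 : R) :
    (forall s, 0 <= s -> s < s0 -> hausdorff_measure dist s A <> 0%E) ->
  (s0%:E <= hausdorff_dim dist A)%E.
Proof.
move=> h; apply: le_ereal_inf_tmp => _ [s [s_ge0 hs] <-].
by rewrite lee_fin leNgt; apply/negP => ss; exact: h hs.
Qed.

End HausdorffLower.

(** * Mahler's criterion *)

Section ShortVectors.
Variable R : realType.

Lemma coord_le_norm m n (M : 'M[R]_(m, n)) i j : `|M i j| <= `|M|.
Proof.
rewrite /Num.norm /= mx_normrE.
exact: (le_bigmax _ (fun ij => `|M ij.1 ij.2|) (i, j)).
Qed.

Lemma norm_le_coord m n (M : 'M[R]_(m, n)) e : 0 <= e ->
  (forall i j, `|M i j| <= e) -> `|M| <= e.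
Proof.
by move=> e0 h; rewrite /Num.norm /= mx_normrE; apply/bigmax_leP; split => // ij _; exact: h.
Qed.

Lemma norm_mulmx m n p (A : 'M[R]_(m, n)) (B : 'M[R]_(n, p)) :
  `|A *m B| <= n%:R * `|A| * `|B|.
Proof.
apply: norm_le_coord => [|i j]; first by rewrite !mulr_ge0.
rewrite mxE; apply: le_trans (ler_norm_sum _ _ _) _.
apply: le_trans (_ : \sum_(k < n) `|A| * `|B| <= _).
  by apply: ler_sum => k _; rewrite normrM ler_pM ?coord_le_norm.
by rewrite sumr_const card_ord -[leLHS]mulr_natl mulrA.
Qed.

Variable n : nat.
Local Notation Lat := (lattice_space R n).
Local Notation lat := (\pi_(lattice_space R n)%qT).

Lemma lat_eqP (g h : SL R n) : lat g = lat h -> SL_modZ g h.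
Proof. by move/eqmodP. Qed.

Lemma lat_eq (g h : SL R n) : SL_modZ g h -> lat g = lat h.
Proof. by move=> H; apply/eqmodP. Qed.

(** For [g] near [g0], [|k|] is at most [C g0 * |g k|] plus half of [|k|], which keeps [|g k|] away
    from 0 for integral [k != 0]. The property [P] ranges over all representatives of a lattice, so
    it makes sense on the quotient, and compactness makes the bound uniform. *)
Lemma compact_no_short (K : set Lat) : compact K ->
  exists2 eta : R, 0 < eta & forall (g : SL R n) (k : 'cV[int]_n),
    K (lat g) -> k != 0 -> eta <= `|SLmx g *m map_mx intr k|.
Proof.
move=> cK.
pose C (g : SL R n) : R := n%:R * `|invmx (SLmx g)| + 1.
have C0 g : 0 < C g by rewrite ltr_wpDl // mulr_ge0.
pose del (g : SL R n) : R := (2 * C g * n.+1%:R)^-1.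
have del0 g : 0 < del g by rewrite invr_gt0 !mulr_gt0.
have gU (g : SL R n) : SLmx g \in unitmx by rewrite unitmxE det_SLmx unitr1.
have low g0 g (k : 'cV[int]_n) : `|SLmx g - SLmx g0| < del g0 -> k != 0 ->
    (2 * C g0)^-1 <= `|SLmx g *m map_mx intr k|.
  move=> hg k0; set kr : 'cV[R]_n := map_mx intr k.
  have [j kj] : exists j, k j 0 != 0.
    apply/not_existsP => h; move/eqP: k0; apply; apply/matrixP => i j.
    by rewrite ord1 mxE; apply/eqP/negPn/negP/h.
  have k1 : 1 <= `|kr|.
    apply: le_trans (coord_le_norm _ j 0); rewrite mxE -intr_norm ler1z.
    by rewrite -gtz0_ge1 normr_gt0.
  have e1 : kr = invmx (SLmx g0) *m (SLmx g *m kr - (SLmx g - SLmx g0) *m kr).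
    by rewrite mulmxBl opprB addrC subrK mulKmx.
  have h1 : `|kr| <= C g0 * (`|SLmx g *m kr| + n%:R * del g0 * `|kr|).
    rewrite {1}e1; apply: le_trans (norm_mulmx _ _) _.
    apply: ler_pM; rewrite ?mulr_ge0 //; first by rewrite lerDl.
    apply: le_trans (ler_normB _ _) _; rewrite lerD2l.
    apply: le_trans (norm_mulmx _ _) _; apply: ler_wpM2r => //.
    by apply: ler_wpM2l => //; exact: ltW.
  have h2 : C g0 * (n%:R * del g0 * `|kr|) <= `|kr| / 2.
    have -> : C g0 * (n%:R * del g0 * `|kr|) = `|kr| / 2 * (n%:R / n.+1%:R).
      rewrite /del; field; by rewrite nat1r pnatr_eq0 (gt_eqF (C0 g0)).
    rewrite -[leRHS]mulr1; apply: ler_wpM2l; first by rewrite divr_ge0.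
    by rewrite ler_pdivrMr ?ltr0n // mul1r ler_nat.
  have h3 : 1 / 2 <= C g0 * `|SLmx g *m kr|.
    by move: h1 h2 k1; rewrite mulrDr; move: (_ * `|SLmx g *m kr|) => z; lra.
  rewrite -div1r ler_pdivrMr ?mulr_gt0 //.
  by move: h3; rewrite mulrC mulrCA; lra.
pose f (g0 : SL R n) : set Lat :=
  [set L | exists2 g, lat g = L & `|SLmx g - SLmx g0| < del g0].
have fopen g0 : open (f g0).
  rewrite /open /= /quotient_open openE => g [h hg hd].
  (* Openness is checked on representatives: [h] is [g] times an integral [c], and a neighbour [g']
     of [g] gives the neighbour [g' c] of [h] in the same lattice as [g']. *)
  have /asboolP[c c1 hE] := lat_eqP (esym hg).
  pose cr : 'M[R]_n := map_mx intr c.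
  have dcr : \det cr == 1 by rewrite det_map_mx c1.
  pose e := (del g0 - `|SLmx h - SLmx g0|) / (n%:R * `|cr| + 1).
  have D0 : 0 < n%:R * `|cr| + 1 by rewrite ltr_wpDl // mulr_ge0.
  have e0 : 0 < e by rewrite divr_gt0 // subr_gt0.
  have nb : nbhs g (@SLmx R n @^-1` ball (SLmx g) e).
    by apply: (initial_continuous (f := @SLmx R n)); exact: nbhsx_ballx.
  apply: filterS nb => g' /=; rewrite mx_norm_ball /ball_ /= => hg'.
  exists (mulSL g' (MkSL dcr)).
    apply: lat_eq; rewrite SL_modZ_sym; apply/asboolP; exists c => //.
  rewrite /= (_ : _ - _ = (SLmx g' - SLmx g) *m cr + (SLmx h - SLmx g0)); last first.
    by rewrite hE mulmxBl addrA subrK.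
  apply: le_lt_trans (ler_normD _ _) _.
  rewrite -ltrBrDr; apply: le_lt_trans (norm_mulmx _ _) _.
  move: hg'; rewrite distrC /e ltr_pdivlMr // => hg'.
  apply: le_lt_trans hg'; rewrite [n%:R * _]mulrC -mulrA.
  by rewrite ler_wpM2l // lerDl.
pose P (i : nat) (L : Lat) := forall (g : SL R n) (k : 'cV[int]_n),
  lat g = L -> k != 0 -> i.+1%:R^-1 <= `|SLmx g *m map_mx intr k|.
have fP g0 i L : f g0 L -> 2 * C g0 <= i.+1%:R -> P i L.
  move=> [h hL hd] hi g k gL k0.
  have /asboolP[c c1 hE] := lat_eqP (etrans gL (esym hL)).
  have [c' cc'] : exists c' : 'M[int]_n, c *m c' = 1%:M.
    by exists (\adj c); rewrite mul_mx_adj c1.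
  have gk : SLmx g *m map_mx intr k = SLmx h *m map_mx intr (c' *m k).
    by rewrite hE map_mxM !mulmxA -[_ *m _ *m map_mx intr c']mulmxA -map_mxM cc' map_mx1 mulmx1.
  rewrite gk; apply: le_trans (low _ _ (c' *m k) hd _).
    by rewrite lef_pV2 // posrE // mulr_gt0.
  apply: contra k0 => /eqP ck; apply/eqP.
  by rewrite -[k]mul1mx -cc' -mulmxA ck mulmx0.
have /(_ nat \oo P _)[|N _ HN] := (compact_near_coveringP K).1 cK.
  move=> L KL; pose g0 := repr L.
  exists (f g0, [set i | 2 * C g0 <= i.+1%:R]); last by move=> [L' i] [/fP h /h].
  split => /=.
    apply: open_nbhs_nbhs; split; first exact: fopen.
    by exists g0; [exact: reprK|rewrite subrr normr0].
  exists (Num.bound (2 * C g0)) => // i /= hi.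
  have /ltW := archi_boundP (ltW (mulr_gt0 (ltr0n _ 2) (C0 g0))).
  by move=> /le_trans; apply; rewrite ler_nat leqW.
exists N.+1%:R^-1 => // g k Kg k0; exact: (HN N (leqnn N) _ Kg).
Qed.

End ShortVectors.

(** * Children of a node *)

Section NodeStep.
Variables (R : realType) (d : nat) (g : 'M[R]_(d + 1)).
Hypothesis gU : g \in unitmx.
Local Notation C := (cst R d).

Definition center (v : 'cV[int]_(d + 1)) (i : 'I_d) : R := - vecp g v i / vecq g v.

Definition box (v : 'cV[int]_(d + 1)) (D : 'I_d -> R) : set 'cV[R]_d :=
  [set x | forall i, `|x i 0 - center v i| <= D i].

Definition vfree (v : 'cV[int]_(d + 1)) (b : 'I_d -> R) := forall m,
  pairing m v = 0 -> (forall i, `|form g m i| <= b i) -> m = 0.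

(** A good point has a centre within a quarter of this length. As boxes of the next level have
    half-length at most another quarter, such a box stays within half a cell of its grid point. *)
Definition cell (Q : R) (b : 'I_d -> R) (i : 'I_d) : R := 4 * C / (b i * Q).

Lemma box_center v D x i : 0 < vecq g v -> box v D x ->
  `|vecp g v i + vecq g v * x i 0| <= vecq g v * D i.
Proof.
move=> q0 /(_ i) h.
have -> : vecp g v i + vecq g v * x i 0 = vecq g v * (x i 0 - center v i).
  by rewrite /center; field; rewrite gt_eqF.
by rewrite normrM (gtr0_norm q0) ler_wpM2l // ltW.
Qed.

(** The value [s = 2 * d * C / Q] serves twice. The covering error [C / s] is at most [Q / 2], which
    keeps [q] within [Q / 2] of [3 / 2 * Q]. And a dual vector of the box [b] orthogonal to [u]
    satisfies [|formx| * Q <= d * C], so it would be bad for [x]. *)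
Lemma good_child (x : 'cV[R]_d) (Q : R) (b : 'I_d -> R) : (0 < d)%N -> 0 < Q ->
    (forall i, 0 < b i) -> ~ dual_bad g b (2 * d%:R * C / Q) x ->
  exists u, [/\ Q <= vecq g u <= 2 * Q, vfree u b &
    forall i, `|center u i - x i 0| <= cell Q b i / 4].
Proof.
move=> d0 Q0 b0 good.
have C0 : 0 < C by exact: lt_le_trans (cst_ge1 R d).
have dR : 0 < d%:R :> R by rewrite ltr0n.
have dR1 : 1 <= d%:R :> R by rewrite ler1n.
have s0 : 0 < 2 * d%:R * C / Q by rewrite divr_gt0 // !mulr_gt0.
have [u [hp hq]] := lattice_covering gU (3 / 2 * Q) b0 s0 good.
have CsQ : C / (2 * d%:R * C / Q) <= Q / 2.
  have -> : C / (2 * d%:R * C / Q) = Q / 2 / d%:R by field; rewrite !gt_eqF.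
  by rewrite ler_pdivrMr // ler_peMr // divr_ge0 // ltW.
have /andP[q1 q2] : Q <= vecq g u <= 2 * Q.
  have := le_trans hq CsQ; rewrite ler_norml => /andP[h1 h2].
  by apply/andP; split; move: h1 h2; lra.
have qu0 : 0 < vecq g u by exact: lt_le_trans q1.
exists u; split; first by rewrite q1.
- move=> m mu mb; apply: contrapT => /eqP m0; apply: good; exists m; split => //.
  have := pairingE gU x m u; rewrite mu => /esym/eqP.
  rewrite addrC addr_eq0 => /eqP fE.
  have h : `|formx g m x| * Q <= d%:R * C.
    apply: le_trans (_ : `|formx g m x * vecq g u| <= _).
      by rewrite normrM (gtr0_norm qu0) ler_wpM2l.
    rewrite fE normrN; apply: le_trans (ler_norm_sum _ _ _) _.
    apply: le_trans (_ : \sum_(i < d) C <= _); last by rewrite sumr_const card_ord mulr_natl.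
    apply: ler_sum => i _; rewrite normrM.
    apply: le_trans (_ : b i * (C / b i) <= _); first by rewrite ler_pM // hp.
    by rewrite mulrC divfK // gt_eqF.
  rewrite ler_pdivlMr //; apply: le_trans h _.
  by rewrite -mulrA ler_peMl ?ler1n // mulr_ge0 // ltW.
- move=> i.
  have -> : center u i - x i 0 = - ((vecp g u i + vecq g u * x i 0) / vecq g u).
    by rewrite /center; field; rewrite gt_eqF.
  rewrite normrN normrM normfV (gtr0_norm qu0) ler_pdivrMr //.
  apply: le_trans (hp i) _.
  have -> : cell Q b i / 4 * vecq g u = C / b i * (vecq g u / Q).
    by rewrite /cell; field; rewrite !gt_eqF.
  by rewrite ler_peMr ?divr_ge0 ?(ltW C0) ?(ltW (b0 i)) // ler_pdivlMr // mul1r.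
Qed.

(* [E1], [E2], [E3] of [bad_card] for the box of [v] and the dual box [b']. *)
Definition bad_ratio (i0 : 'I_d) (q Q' : R) (b b' D : 'I_d -> R) (M : nat) (N : 'I_d -> nat) : R :=
  let s := 2 * d%:R * C / Q' in
  8 * d%:R * q * s * (2 * harm R M * \prod_l (2 * (N l)%:R)) +
   \sum_(i | i != i0) 4 * s / (b i * D i) *
     (2 * harm R (N i) * \prod_(l | l != i) (2 * (N l)%:R)) +
   4 * s / (b i0 * D i0) * (2 * harm R (N i0) * 2 ^+ d).

(** The factor 2 in the count pays for the half of the grid that may be bad. Along axis [i], the
    children meeting a set of diameter [r] have indices that differ by at most [r / c i + 1]; hence
    they use at most [(r + 2 * c i) / c i] of the [n i] indices, and [D i <= n i * c i]. *)
Lemma node_step (i0 : 'I_d) v (b b' D D' : 'I_d -> R) (Q' : R) (M : nat) (N : 'I_d -> nat) :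
    let q := vecq g v in
    0 < q -> vfree v b -> (forall i, 0 < b i) -> (forall i, 0 < b' i) ->
    (forall i, 0 < D i) -> 0 < Q' -> q * (2 * d%:R * C / Q') <= 2^-1 ->
    (forall i, cell Q' b' i <= D i) -> (forall i, D' i <= cell Q' b' i / 4) ->
    (forall l, (0 < N l)%N) -> (forall i, b' i < b i * (N i)%:R) ->
    2 * q * \sum_i b' i * D i < M%:R ->
    bad_ratio i0 q Q' b b' D M N <= 2^-1 ->
  exists K (ch : 'I_K.+1 -> 'cV[int]_(d + 1)),
    [/\ forall a, Q' <= vecq g (ch a) <= 2 * Q' /\ vfree (ch a) b',
        forall a, box (ch a) D' `<=` box v D &
        forall (F : set 'cV[R]_d) r, 0 <= r ->
          (forall x y i, F x -> F y -> `|x i 0 - y i 0| <= r) ->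
          #|[set a | `[< box (ch a) D' `&` F !=set0 >]]%SET|%:R <=
          2 * \prod_i Num.min 1 ((r + 2 * cell Q' b' i) / D i) * K.+1%:R].
Proof.
move=> q q0 vf b0 b'0 D0 Q'0 qs cD D'c N0 hb' hM bad12.
have d0 : (0 < d)%N by exact: leq_ltn_trans (leq0n _) (ltn_ord i0).
have C0 : 0 < C by exact: lt_le_trans (cst_ge1 R d).
have dR : 0 < d%:R :> R by rewrite ltr0n.
set s := 2 * d%:R * C / Q' in qs.
have s0 : 0 < s by rewrite divr_gt0 // !mulr_gt0.
pose c := cell Q' b'.
have c0 i : 0 < c i by rewrite divr_gt0 ?mulr_gt0.
pose n i := Num.truncn (2 * D i / c i).
have n_le i : (n i)%:R * c i <= 2 * D i.
  rewrite -ler_pdivlMr; last exact: c0.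
  by rewrite truncn_le; apply: divr_ge0; [apply: mulr_ge0 => //; exact: ltW | exact: ltW].
have n_ge i : D i <= (n i)%:R * c i.
  have h1 : 2 * D i < (n i).+1%:R * c i by rewrite -ltr_pdivrMr // truncnS_gt.
  have h2 : 1 <= (n i)%:R :> R.
    rewrite ler1n /n truncn_gt0 ler_pdivlMr // mul1r.
    by apply: le_trans (cD i) _; rewrite ler_peMl // ?ler1n // ltW.
  move: h1; rewrite -natr1 mulrDl mul1r => h1.
  have h3 : c i <= (n i)%:R * c i by rewrite ler_peMl // ltW.
  by move: h1 h3; lra.
pose P := \max_i n i.
have nP i : (n i <= P)%N by exact: leq_bigmax.
pose W := (M + \max_i N i)%N.
(* Half a cell is left free at the lower face, and [n_le] leaves as much at the upper one, so that
   what lies within half a cell of a grid point is inside the box. *)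
pose x0 : 'cV[R]_d := \col_i (center v i - D i + c i / 2).
pose X := pt c x0 (P := P).
have Xbox t i : t \in grid P n -> `|X t i 0 - center v i| <= D i - c i / 2.
  rewrite inE => /forallP/(_ i) ti; rewrite !mxE ler_norml.
  have t1 : c i * (t i)%:R + c i <= (n i)%:R * c i.
    by rewrite [c i * _]mulrC -[X in _ + X]mul1r -mulrDl natr1 ler_wpM2r ?ler_nat // ltW.
  have t0 : 0 <= c i * (t i)%:R by rewrite mulr_ge0 // ltW.
  by apply/andP; split; move: t1 t0 (n_le i) (c0 i); lra.
have bc i : b' i * c i <= 2 * s.
  have -> : b' i * c i = 4 * C / Q' by rewrite /c /cell; field; rewrite !gt_eqF.
  have -> : 2 * s = d%:R * (4 * C / Q') by rewrite /s; ring.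
  by rewrite ler_peMl ?ler1n // divr_ge0 ?mulr_ge0 // ltW.
pose Good := [set t in grid P n | ~~ `[< dual_bad g b' s (X t) >]].
have cardG : \prod_i (n i)%:R <= 2 * #|Good|%:R :> R.
  have h : #|[set t in grid P n | `[< dual_bad g b' s (X t) >]]|%:R <=
      bad_ratio i0 q Q' b b' D M N * \prod_l (n l)%:R.
    apply: (bad_card gU q0 b0 D0 c0 s0 nP n_ge bc vf (W := W)) => //.
    - move=> l; rewrite N0 /= ltnW // ltnS (leq_trans _ (leq_addl _ _)) //.
      exact: leq_bigmax.
    - by rewrite /W; lia.
    - move=> t i tg; apply: box_center => // j.
      apply: le_trans (Xbox _ _ tg) _; rewrite gerBl divr_ge0 // ltW //.
  have e : (#|grid P n| = #|[set t in grid P n | `[< dual_bad g b' s (X t) >]]| + #|Good|)%N.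
    rewrite -(cardID [pred t | `[< dual_bad g b' s (X t) >]]); congr (_ + _)%N.
      by apply: eq_card => t; rewrite !inE.
    by apply: eq_card => t; rewrite !inE andbC.
  have e' : \prod_i (n i)%:R = #|grid P n|%:R :> R by rewrite card_grid // natr_prod.
  have h0 : 0 <= \prod_l (n l)%:R :> R by apply: prodr_ge0.
  have h2 := ler_wpM2r h0 bad12.
  have := le_trans h h2; rewrite e' e natrD; lra.
have prod0 : 0 < \prod_i (n i)%:R :> R.
  by apply: prodr_gt0 => i _; rewrite -(pmulr_lgt0 _ (c0 i)); exact: lt_le_trans (n_ge i).
have G0 : (0 < #|Good|)%N.
  by rewrite -(ltr0n R); move: (lt_le_trans prod0 cardG); lra.
have child t : exists u, t \in Good -> [/\ Q' <= vecq g u <= 2 * Q', vfree u b' &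
    forall i, `|center u i - X t i 0| <= c i / 4].
  have [tG|tG] := boolP (t \in Good); last by exists 0.
  have [||||u hu] := @good_child (X t) Q' b' => //.
    by move: tG; rewrite inE => /andP[_ /asboolPn].
  by exists u.
have [u hu] := choice child.
have eK : (#|Good|.-1.+1 = #|Good|)%N by rewrite prednK.
exists #|Good|.-1, (fun a => u (enum_val (cast_ord eK a))).
have inG a : enum_val (cast_ord eK a) \in Good by exact: enum_valP.
have near_cell t i x : t \in Good -> box (u t) D' x -> `|x i 0 - X t i 0| <= c i / 2.
  move=> tG /(_ i) h1; have [_ _ /(_ i) h2] := hu t tG.
  rewrite -[x i 0](subrK (center (u t) i)) -addrA.
  apply: le_trans (ler_normD _ _) _.
  by move: h1 h2 (D'c i); rewrite -/(c i); lra.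
split.
- by move=> a; have [] := hu _ (inG a).
- move=> a x bx i; have h1 := near_cell _ i _ (inG a) bx.
  have tg : enum_val (cast_ord eK a) \in grid P n by move: (inG a); rewrite inE => /andP[].
  have h2 := Xbox _ i tg.
  rewrite -[x i 0](subrK (X (enum_val (cast_ord eK a)) i 0)) -addrA.
  by apply: le_trans (ler_normD _ _) _; move: h1 h2; lra.
- move=> F r r0 Fr.
  pose H := [set t in Good | `[< box (u t) D' `&` F !=set0 >]]%SET.
  have le1 : (#|[set a | `[< box (u (enum_val (cast_ord eK a))) D' `&` F !=set0 >]]%SET| <= #|H|)%N.
    have inj : injective (fun a => enum_val (cast_ord eK a)).
      by move=> a a' /enum_val_inj/cast_ord_inj.
    rewrite -(card_imset _ inj); apply: subset_leq_card.
    apply/fintype.subsetP => t /imsetP[a]; rewrite inE => ha ->.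
    by rewrite !inE; move: (inG a); rewrite !inE => -> /=.
  pose A i := [set a | [exists t in H, t i == a]]%SET.
  have cA i : #|A i|%:R <= (n i)%:R * Num.min 1 ((r + 2 * c i) / D i) :> R.
    have ni0 : 0 < (n i)%:R :> R.
      by rewrite -(pmulr_lgt0 _ (c0 i)); exact: lt_le_trans (n_ge i).
    have [h1|h1] := leP 1 ((r + 2 * c i) / D i).
      rewrite mulr1 ler_nat -(card_ltn_ord (nP i)); apply: subset_leq_card.
      apply/fintype.subsetP => a; rewrite inE => /existsP[t /andP[tH /eqP <-]].
      by move: tH; rewrite !inE => /andP[/andP[/forallP/(_ i) ? _] _].
    apply: le_trans (_ : r / c i + 1 + 1 <= _).
      apply: card_ord_spread.
        by rewrite addr_ge0 // divr_ge0 // ltW.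
      move=> a a'; rewrite !inE => /existsP[t /andP[tH /eqP <-]] /existsP[t' /andP[t'H /eqP <-]] tt'.
      move: tH t'H; rewrite inE => /andP[tG /asboolP[z [zb zF]]].
      rewrite inE => /andP[t'G /asboolP[z' [z'b z'F]]].
      have l1 := near_cell _ i _ tG zb; have l2 := near_cell _ i _ t'G z'b.
      have l3 := Fr _ _ i zF z'F.
      rewrite natrB // -(ler_pM2r (c0 i)) [leRHS]mulrDl divfK ?gt_eqF // mul1r.
      have e1 : X t i 0 = x0 i 0 + c i * (t i)%:R by rewrite mxE.
      have e2 : X t' i 0 = x0 i 0 + c i * (t' i)%:R by rewrite mxE.
      move: l1 l2 l3; rewrite !ler_norml e1 e2 mulrBl ![_ * c i]mulrC.
      move=> /andP[? ?] /andP[? ?] /andP[? ?]; lra.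
    have -> : r / c i + 1 + 1 = (r + 2 * c i) / c i by field; rewrite gt_eqF.
    rewrite [leRHS]mulrCA; apply: ler_wpM2l.
      by rewrite addr_ge0 // mulr_ge0 // ltW.
    by rewrite ler_pdivlMr // mulrC ler_pdivrMr.
  have le2 : (#|H| <= \prod_i #|A i|)%N.
    rewrite -(card_box (fun i => mem (A i))); apply: subset_leq_card.
    apply/fintype.subsetP => t tH; rewrite inE; apply/forallP => i.
    suff : t i \in A i by []. by rewrite inE; apply/existsP; exists t; rewrite tH /=.
  rewrite [X in _ * X%:R]eK; apply: le_trans (_ : (\prod_i #|A i|)%:R <= _).
    by rewrite ler_nat (leq_trans le1).
  rewrite natr_prod; apply: le_trans (_ : \prod_i ((n i)%:R * Num.min 1 ((r + 2 * c i) / D i)) <= _).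
    by apply: ler_prod => i _; rewrite ler0n cA.
  rewrite big_split /= mulrAC ler_wpM2r //.
  apply: prodr_ge0 => i _; rewrite le_min ler01 divr_ge0 ?(ltW (D0 i)) //.
  by rewrite addr_ge0 // mulr_ge0 // ltW.
Qed.

End NodeStep.

Section AbstractStep.
Variables (R : realType) (d : nat) (g : 'M[R]_(d + 1)).
Hypothesis gU : g \in unitmx.
Local Notation C := (cst R d).

(** Numerical factor of the first term of [bad_ratio] when each [N l] is at most [2 * (b' l / b l)];
    it dominates those of the other two terms. *)
Definition big_cst : R := 32 * d%:R ^+ 2 * C * 4 ^+ d.

Lemma big_cst_ge : (0 < d)%N ->
  [/\ 1 <= big_cst, d%:R <= big_cst, 32 * C <= big_cst & 32 * d%:R * C <= big_cst].
Proof.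
move=> d0; have C1 := cst_ge1 R d.
have d1 : 1 <= d%:R :> R by rewrite ler1n.
have p1 : 1 <= 4 ^+ d :> R by rewrite exprn_ege1 // ler1n.
have h1 : 32 * d%:R * C <= big_cst.
  rewrite /big_cst -[leLHS]mulr1; apply: ler_pM => //.
    by rewrite !mulr_ge0 //; apply: le_trans C1.
  apply: ler_wpM2r; first exact: le_trans C1.
  by rewrite ler_wpM2l // expr2 ler_peMr.
have h2 : 32 * C <= 32 * d%:R * C.
  by apply: ler_wpM2r; [exact: le_trans C1 | rewrite ler_peMr].
split => //; last exact: le_trans h1.
  by apply: le_trans h1; apply: le_trans h2; move: C1; move: (cst R d) => z; lra.
apply: le_trans h1; rewrite -[leLHS]mulr1; apply: ler_pM => //.
by rewrite ler_peMl // ler1n.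
Qed.

Lemma bad_ratio_le i0 q Q' (b b' D : 'I_d -> R) M N h : 0 < q -> 0 < Q' ->
    (forall i, 0 < b i) -> (forall i, 0 < b' i) -> (forall i, 0 < D i) ->
    (forall l, (N l)%:R <= 2 * (b' l / b l)) -> harm R M <= h ->
    (forall l, harm R (N l) <= h) ->
  bad_ratio i0 q Q' b b' D M N <= big_cst * h *
   (q / Q' * \prod_l (b' l / b l) +
    \sum_(i | i != i0) (\prod_l (b' l / b l)) / (Q' * b' i * D i) +
    (Q' * b i0 * D i0)^-1).
Proof.
move=> q0 Q0 b0 b'0 D0 hN hM hh.
have d0 : (0 < d)%N by exact: leq_ltn_trans (leq0n _) (ltn_ord i0).
have C0 : 0 < C by exact: lt_le_trans (cst_ge1 R d).
have d1 : 1 <= d%:R :> R by rewrite ler1n.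
have dR : 0 < d%:R :> R by rewrite ltr0n.
have hp0 n : 0 <= harm R n by apply: sumr_ge0 => j _; rewrite invr_ge0.
have h0 : 0 <= h by exact: le_trans hM.
set P := \prod_l (b' l / b l).
have P0 : 0 < P by apply: prodr_gt0 => l _; rewrite divr_gt0.
have N2 l : 2 * (N l)%:R <= 4 * (b' l / b l) by have := hN l; lra.
have pN : \prod_l (2 * (N l)%:R) <= 4 ^+ d * P.
  rewrite /P -[X in 4 ^+ X](card_ord d) -prodr_const -big_split /=.
  by apply: ler_prod => l _; rewrite N2 mulr_ge0.
have pNi i : \prod_(l | l != i) (2 * (N l)%:R) <= 4 ^+ d * P * (b i / b' i).
  have e : P = b' i / b i * \prod_(l | l != i) (b' l / b l) by rewrite /P (bigD1 i).
  have -> : 4 ^+ d * P * (b i / b' i) = 4 ^+ d * \prod_(l | l != i) (b' l / b l).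
    by rewrite e; field; rewrite !gt_eqF.
  apply: le_trans (_ : \prod_(l | l != i) (4 * (b' l / b l)) <= _).
    by apply: ler_prod => l _; rewrite N2 mulr_ge0.
  rewrite big_split /= prodr_const; apply: ler_wpM2r.
    by apply: prodr_ge0 => l _; rewrite divr_ge0 // ltW.
  rewrite ler_weXn2l ?ler1n //.
  by apply: leq_trans (max_card _) _; rewrite card_ord.
have p40 : 0 < 4 ^+ d :> R by rewrite exprn_gt0.
rewrite /bad_ratio /big_cst.
rewrite !mulrDr; apply: lerD; first apply: lerD.
- apply: le_trans (_ : 8 * d%:R * q * (2 * d%:R * C / Q') * (2 * h * (4 ^+ d * P)) <= _).
    apply: ler_wpM2l; first by rewrite !mulr_ge0 ?invr_ge0 // ltW.
    apply: ler_pM => //; first by rewrite mulr_ge0.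
      by apply: prodr_ge0 => l _; rewrite mulr_ge0.
    by rewrite ler_pM2l.
  rewrite le_eqVlt; apply/orP; left; apply/eqP.
  by move: (4 ^+ d) => e4; field; rewrite !gt_eqF.
- rewrite mulr_sumr; apply: ler_sum => i _.
  apply: le_trans (_ : 4 * (2 * d%:R * C / Q') / (b i * D i) *
      (2 * h * (4 ^+ d * P * (b i / b' i))) <= _).
    apply: ler_wpM2l; first by rewrite !mulr_ge0 ?invr_ge0 ?mulr_ge0 // ltW.
    apply: ler_pM => //; first by rewrite mulr_ge0.
      by apply: prodr_ge0 => l _; rewrite mulr_ge0.
    by rewrite ler_pM2l.
  have -> : 4 * (2 * d%:R * C / Q') / (b i * D i) *
      (2 * h * (4 ^+ d * P * (b i / b' i))) = (16 * d%:R) * (C * 4 ^+ d * h * (P / (Q' * b' i * D i))).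
    by move: (4 ^+ d) => e4; field; rewrite !gt_eqF.
  have -> : 32 * d%:R ^+ 2 * C * 4 ^+ d * h * (P / (Q' * b' i * D i)) =
     (32 * d%:R ^+ 2) * (C * 4 ^+ d * h * (P / (Q' * b' i * D i))) by rewrite !mulrA.
  apply: ler_wpM2r; last by rewrite expr2; nra.
  by rewrite !mulr_ge0 ?invr_ge0 ?mulr_ge0 // ltW.
- apply: le_trans (_ : 4 * (2 * d%:R * C / Q') / (b i0 * D i0) * (2 * h * 4 ^+ d) <= _).
    apply: ler_wpM2l; first by rewrite !mulr_ge0 ?invr_ge0 ?mulr_ge0 // ltW.
    apply: ler_pM => //; first by rewrite mulr_ge0.
      by rewrite ler_pM2l.
    by rewrite lerXn2r ?nnegrE // ler_nat.
  have -> : 4 * (2 * d%:R * C / Q') / (b i0 * D i0) * (2 * h * 4 ^+ d) =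
      (16 * d%:R) * (C * 4 ^+ d * h * (Q' * b i0 * D i0)^-1).
    by move: (4 ^+ d) => e4; field; rewrite !gt_eqF.
  have -> : 32 * d%:R ^+ 2 * C * 4 ^+ d * h * (Q' * b i0 * D i0)^-1 =
     (32 * d%:R ^+ 2) * (C * 4 ^+ d * h * (Q' * b i0 * D i0)^-1) by rewrite !mulrA.
  apply: ler_wpM2r; last by rewrite expr2; nra.
  by rewrite !mulr_ge0 ?invr_ge0 ?mulr_ge0 // ltW.
Qed.

(** [M] and the [N i] become the least integers that the strict inequalities of [node_step] permit.
    All of them are at most [y], so one [h] bounds every harmonic sum. *)
Lemma node_step_sharp (i0 : 'I_d) v (b b' D D' : 'I_d -> R) (Q' h y : R) :
    let q := vecq g v in
    0 < q -> vfree g v b -> (forall i, 0 < b i) -> (forall i, b i <= b' i) ->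
    (forall i, 0 < D i) -> 0 < Q' -> q * (2 * d%:R * C / Q') <= 2^-1 ->
    (forall i, cell Q' b' i <= D i) -> (forall i, D' i <= cell Q' b' i / 4) ->
    2 * q * \sum_i b' i * D i + 1 <= y -> (forall i, 2 * (b' i / b i) <= y) ->
    (forall n : nat, n%:R <= y -> harm R n <= h) ->
    big_cst * h * (q / Q' * \prod_l (b' l / b l) +
      \sum_(i | i != i0) (\prod_l (b' l / b l)) / (Q' * b' i * D i) +
      (Q' * b i0 * D i0)^-1) <= 2^-1 ->
  exists K (ch : 'I_K.+1 -> 'cV[int]_(d + 1)),
    [/\ forall a, Q' <= vecq g (ch a) <= 2 * Q' /\ vfree g (ch a) b',
        forall a, box g (ch a) D' `<=` box g v D &
        forall (F : set 'cV[R]_d) r, 0 <= r ->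
          (forall x y i, F x -> F y -> `|x i 0 - y i 0| <= r) ->
          #|[set a | `[< box g (ch a) D' `&` F !=set0 >]]%SET|%:R <=
          2 * \prod_i Num.min 1 ((r + 2 * cell Q' b' i) / D i) * K.+1%:R].
Proof.
move=> q q0 vf b0 bb' D0 Q0 qs cD D'c My Ny hy hbad.
have b'0 i : 0 < b' i by exact: lt_le_trans (bb' i).
have tr (z : R) : 0 <= z -> (Num.truncn z).+1%:R <= z + 1.
  by move=> z0; rewrite -natr1 lerD2r truncn_le.
have z1 i : 1 <= b' i / b i by rewrite ler_pdivlMr // mul1r.
have z0 i : 0 <= b' i / b i by exact: le_trans (z1 i).
have S0 : 0 <= 2 * q * \sum_i b' i * D i.
  apply: mulr_ge0; first by rewrite mulr_ge0 // ltW.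
  by apply: sumr_ge0 => i _; rewrite mulr_ge0 // ltW.
have hN i : (Num.truncn (b' i / b i)).+1%:R <= 2 * (b' i / b i).
  by apply: le_trans (tr _ (z0 i)) _; have := z1 i; lra.
apply: (@node_step R d g gU i0 v b b' D D' Q' (Num.truncn (2 * q * \sum_i b' i * D i)).+1
  (fun i => (Num.truncn (b' i / b i)).+1)) => //.
- by move=> i; rewrite -ltr_pdivrMl // mulrC truncnS_gt.
- exact: truncnS_gt.
- apply: le_trans hbad; apply: bad_ratio_le => //.
    by apply: hy; apply: le_trans (tr _ S0) _.
  by move=> l; apply: hy; apply: le_trans (hN l) _.
Qed.

End AbstractStep.

(** * Choice of the scales *)

Section Bounds.
Variable R : realType.
Implicit Types x y : R.

Lemma harm_le (N : nat) y : 0 <= y -> N%:R <= expR y -> harm R N <= 1 + y.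
Proof.
move=> y0 Ny; have [->|N0] := posnP N; first by rewrite /harm big_geq // addr_ge0.
move: N0 Ny; case: N => // N _ Ny.
suff h : harm R N.+2 <= 1 + ln N.+1%:R.
  apply: le_trans (_ : 1 + ln N.+1%:R <= _); last first.
    by rewrite lerD2l -(expRK y) ler_ln ?posrE ?ltr0n ?expR_gt0.
  apply: le_trans h; rewrite /harm [leRHS]big_nat_recr //= lerDl invr_ge0 //.
elim: N {Ny} => [|N IH]; first by rewrite /harm big_nat1 ln1 addr0 invr1.
rewrite /harm big_nat_recr //= -/(harm R N.+2).
have key : ln (N.+1%:R / N.+2%:R) <= - N.+2%:R^-1 :> R.
  have -> : N.+1%:R / N.+2%:R = 1 + - N.+2%:R^-1 :> R.
    have N2 : N.+2%:R != 0 :> R by rewrite pnatr_eq0.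
    by apply: (mulIf N2); rewrite mulrDl divfK // mulNr mulVf // mul1r -[N.+2%:R]natr1 addrK.
  by apply: le_ln1Dx; rewrite ltrN2 invf_lt1 ?ltr0n // ltr1n.
rewrite ln_div ?posrE ?ltr0n // in key; move: IH key.
by move: (harm R N.+2) (ln N.+1%:R) (ln N.+2%:R) (N.+2%:R^-1) => a b c e; lra.
Qed.

(** The term [x ^ 6 / 6!] of the series is enough: the left side is at most [1 + 33 * x ^ 4], and
    [720 * 33 <= 200 ^ 2]. This is the origin of the threshold 200. *)
Lemma quartic_le_exp x (H : R) : 200 <= x -> 0 <= H -> H <= x ->
  1 + (x + 4 * H * (x + 2) ^+ 3) <= expR x.
Proof.
move=> x1 H0 Hx; apply: le_trans (expR_ge1Dxn 5 (_ : 0 <= x)); last by lra.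
rewrite lerD2l (_ : (6`!)%:R = 720%:R :> R); last by rewrite !factS fact0.
have x0 : 0 <= x by lra.
have h1 : (x + 2) ^+ 3 <= 8 * x ^+ 3.
  rewrite (_ : 8 * x ^+ 3 = (x + x) ^+ 3); last by ring.
  by rewrite lerXn2r ?nnegrE //; lra.
have x3 : 0 <= x ^+ 3 by rewrite exprn_ge0.
have h2 : H * (x + 2) ^+ 3 <= x * (8 * x ^+ 3).
  by apply: ler_pM => //; rewrite exprn_ge0 //; lra.
have h3 : x <= x * x ^+ 3 by rewrite ler_peMr // exprn_ege1 //; lra.
have u0 : 0 <= x * x ^+ 3 by rewrite mulr_ge0.
have h4 : 200 * 200 * (x * x ^+ 3) <= x ^+ 6.
  rewrite (_ : x ^+ 6 = x * x * (x * x ^+ 3)); last by ring.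
  by apply: (ler_wpM2r u0); apply: ler_pM; rewrite ?ler0n.
have z720 : 0 < 720%:R :> R by rewrite ltr0n.
rewrite (ler_pdivlMr _ _ z720) -[4 * H * _]mulrA.
rewrite (_ : x * (8 * x ^+ 3) = 8 * (x * x ^+ 3)) in h2; last by ring.
move: h2 h3 h4 u0; move: (x * x ^+ 3) (x ^+ 6) (H * _) => u v z; clear.
by lra.
Qed.

End Bounds.

Section Scales.
Variables (R : realType) (d : nat) (i0 : 'I_d) (w : 'I_d -> R) (H : R).
Hypothesis d_ge2 : (1 < d)%N.
Hypothesis w_sum1 : \sum_i w i = 1.
Hypothesis H5 : 5 <= H.
Hypothesis Hd : d%:R <= H.
Hypothesis wH4 : forall i, 4 <= w i * H.
Local Notation C := (cst R d).
Local Notation B := (big_cst R d).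

(* Logarithms of the denominators [Q], dual box sizes [b] and box sizes [D] at
   level [x].  The [b i] with [i != i0] are just below [Q (x + 1) ^ w i], and [b i0]
   is then as large as [\prod_i b i <= Q x] permits: [\sum_i lnb x i = lnQ x - x ^ 2].
   [D] is so small that the vector [v] stays short until the next one takes over. *)
Definition lnQ (x : R) : R := H * x ^+ 3.
Definition lnb (x : R) i : R :=
  if i == i0 then (3 * d%:R - 4) * x ^+ 2 + H * x ^+ 3 - (H - w i0 * H) * (x + 1) ^+ 3
  else - 3 * x ^+ 2 + w i * H * (x + 1) ^+ 3.
Definition lnD (x : R) i : R := - x ^+ 2 - w i * H * (x + 1) ^+ 3 - H * x ^+ 3.
Definition scQ x := expR (lnQ x).
Definition scb x i := expR (lnb x i).
Definition scD x i := expR (lnD x i) / 2.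

Lemma weight_gt0 i : 0 < w i.
Proof.
have H0 : 0 < H by move: H5; lra.
by rewrite -(pmulr_lgt0 _ H0); apply: lt_le_trans (wH4 i).
Qed.

Lemma wH_le i : w i * H <= H.
Proof.
rewrite ler_piMl //; first by move: H5; lra.
by rewrite -w_sum1 (bigD1 i) //= lerDl; apply: sumr_ge0 => j _; exact: ltW (weight_gt0 j).
Qed.

Lemma dR2 : 2 <= d%:R :> R. Proof. by rewrite ler_nat. Qed.

(** The coefficient [3 * d - 4] at [i0] outweighs the [- 3] of each of the [d - 1] other directions
    just enough to leave [- x ^ 2]. *)
Lemma sum_lnb x : \sum_i lnb x i = - x ^+ 2 + H * x ^+ 3.
Proof.
rewrite (bigD1 i0) //= {1}/lnb eqxx.
rewrite (eq_bigr (fun i => - 3 * x ^+ 2 + w i * (H * (x + 1) ^+ 3))); last first.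
  by move=> i /negbTE ne; rewrite /lnb ne mulrA.
rewrite big_split /= sumr_const -(mulr_suml _ _ _ (H * (x + 1) ^+ 3)).
have -> : \sum_(i | i != i0) w i = 1 - w i0.
  have := w_sum1; rewrite (bigD1 i0) //=; move: (\sum_(i | _) _) => S; lra.
have -> : #|(fun i : 'I_d => i != i0)| = d.-1.
  have := cardC1 i0; rewrite card_ord => <-; by apply: eq_card => i; rewrite !inE.
have dE : d%:R = 1 + (d.-1)%:R :> R by rewrite nat1r prednK // ltnW.
rewrite -mulr_natr dE; ring.
Qed.

Section Exponents.
Variable x : R.
Hypothesis x0 : 200 <= x.
Hypothesis xH : 14 * H <= x.

Let X1 : 0 <= x. Proof. by move: x0; lra. Qed.
Let del1 : 0 <= 3 * x ^+ 2 + 9 * x + 7.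
Proof. have := sqr_ge0 x; move: X1; lra. Qed.
Let del0 : 0 <= 3 * x ^+ 2 + 3 * x + 1.
Proof. have := sqr_ge0 x; move: X1; lra. Qed.
Let x2x : 200 * x <= x ^+ 2.
Proof. by rewrite expr2; apply: ler_wpM2r. Qed.
(** [H * (6 * x + 6)] is the second difference of [H * x ^ 3], which is what remains in the
    direction [i0] after the leading terms cancel; the condition [14 * H <= x] lets quadratic slack
    absorb it. *)
Let Hx : H * (6 * x + 6) <= x ^+ 2.
Proof.
have h : 14 * H * (6 * x + 6) <= x * (6 * x + 6).
  by apply: ler_wpM2r => //; move: X1; lra.
by move: h x2x X1; lra.
Qed.
Let H0 : 0 <= H. Proof. by move: H5; lra. Qed.

Lemma cell_lnD i : - lnQ (x + 1) - lnb (x + 1) i - lnD x i <= - x.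
Proof.
have hi : 0 <= (w i * H - 4) * (3 * x ^+ 2 + 9 * x + 7).
  by apply: mulr_ge0 => //; rewrite subr_ge0.
have hH : 0 <= H * (3 * x ^+ 2 + 3 * x + 1) by rewrite mulr_ge0.
rewrite /lnQ /lnb /lnD; case: eqP => [e|_]; last first.
  by move: hi hH x2x X1; lra.
subst i.
have h1 : 0 <= (w i0 * H - 4) * (3 * x ^+ 2 + 3 * x + 1).
  by apply: mulr_ge0 => //; rewrite subr_ge0.
have h2 : 0 <= w i0 * H * (6 * x + 6).
  by apply: mulr_ge0; [exact: le_trans (wH4 i0) | move: X1; lra].
have h3 : 0 <= (d%:R - 2) * (x + 1) ^+ 2.
  by apply: mulr_ge0; [rewrite subr_ge0 dR2 | exact: sqr_ge0].
move: h1 h2 h3 Hx x2x X1. by lra.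
Qed.

(** Along [i0] the deficit [H * ((x + 2) ^ 3 - (x + 1) ^ 3)] has to beat
    [(3 * d - 5) * (x + 1) ^ 2], which it does because [d <= H]. *)
Lemma lnD_cell i : lnD (x + 1) i <= - lnQ (x + 1) - lnb (x + 1) i.
Proof.
rewrite /lnQ /lnb /lnD; case: eqP => [e|_]; last first.
  by have := sqr_ge0 (x + 1); lra.
subst i.
have h1 : 0 <= (H - d%:R) * (x + 1) ^+ 2.
  by apply: mulr_ge0; [rewrite subr_ge0 | exact: sqr_ge0].
have h2 : 0 <= H * (3 * x + 4) by apply: mulr_ge0 => //; move: X1; lra.
have h3 := sqr_ge0 (x + 1).
by move: h1 h2 h3; lra.
Qed.

Lemma lnb_incr i : lnb x i <= lnb (x + 1) i.
Proof.
rewrite -subr_ge0 /lnb; case: eqP => [e|_]; last first.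
  have hi : 0 <= (w i * H - 4) * (3 * x ^+ 2 + 9 * x + 7).
    by apply: mulr_ge0 => //; rewrite subr_ge0.
  by move: hi x2x X1; lra.
have h1 : 0 <= (w i0 * H - 4) * (3 * x ^+ 2 + 3 * x + 1).
  by apply: mulr_ge0 => //; rewrite subr_ge0.
have h2 : 0 <= w i0 * H * (6 * x + 6).
  by apply: mulr_ge0; [exact: le_trans (wH4 i0) | move: X1; lra].
have h3 : 0 <= (d%:R - 2) * (2 * x + 1).
  by apply: mulr_ge0; [rewrite subr_ge0 dR2 | move: X1; lra].
move: h1 h2 h3 Hx x2x X1. by lra.
Qed.

Lemma cube_mono u v : 0 <= u -> u <= v -> u ^+ 3 <= v ^+ 3 :> R.
Proof. by move=> u0 uv; rewrite lerXn2r ?nnegrE //; exact: le_trans uv. Qed.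

Lemma lnb_le i : lnb (x + 1) i <= 4 * H * (x + 2) ^+ 3.
Proof.
have x13 : 0 <= (x + 1) ^+ 3 by rewrite exprn_ge0 // addr_ge0.
have x23 : 0 <= (x + 2) ^+ 3 by rewrite exprn_ge0 // addr_ge0.
have Hx3 : 0 <= H * (x + 2) ^+ 3 by rewrite mulr_ge0.
rewrite /lnb (_ : x + 1 + 1 = x + 2); last by ring.
rewrite -mulrA; case: eqP => [e|_]; last first.
  have h : w i * H * (x + 2) ^+ 3 <= H * (x + 2) ^+ 3 by apply: ler_wpM2r => //; exact: wH_le.
  have := sqr_ge0 (x + 1); move: h Hx3; lra.
have h1 : H * (x + 1) ^+ 3 <= H * (x + 2) ^+ 3.
  by apply: ler_wpM2l => //; apply: cube_mono; move: X1; lra.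
have h2 : 0 <= (H - w i0 * H) * (x + 2) ^+ 3.
  by apply: mulr_ge0 => //; rewrite subr_ge0 wH_le.
have h3 : (3 * d%:R - 4) * (x + 1) ^+ 2 <= 3 * (H * (x + 2) ^+ 3).
  rewrite mulrA; apply: ler_pM; rewrite ?sqr_ge0 //; first by have := dR2; lra.
    by move: Hd; lra.
  apply: le_trans (_ : (x + 2) ^+ 2 <= _).
    by rewrite lerXn2r ?nnegrE; move: X1; lra.
  by rewrite ler_weXn2l //; move: X1; lra.
move: h1 h2 h3; lra.
Qed.

Lemma lnb_diff_le i : lnb (x + 1) i - lnb x i <= 4 * H * (x + 2) ^+ 3.
Proof.
have x23 : 0 <= (x + 2) ^+ 3 by rewrite exprn_ge0 // addr_ge0.
have Hx3 : 0 <= H * (x + 2) ^+ 3 by rewrite mulr_ge0.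
rewrite -mulrA /lnb; case: eqP => [e|_]; last first.
  have h : w i * H * (3 * x ^+ 2 + 9 * x + 7) <= H * (x + 2) ^+ 3.
    apply: ler_pM => //; first exact: le_trans (wH4 i).
      exact: wH_le.
    by have := exprn_ge0 3 X1; move: x2x X1; lra.
  by move: h Hx3 X1; lra.
have h1 : 0 <= (H - w i0 * H) * (3 * x ^+ 2 + 9 * x + 7).
  by apply: mulr_ge0 => //; rewrite subr_ge0 wH_le.
have h3 : (3 * d%:R - 4) * (2 * x + 1) <= (3 * H) * (2 * x + 1).
  by apply: ler_wpM2r; [move: X1; lra | move: Hd; lra].
have h4 : 0 <= H * (3 * x ^+ 3) by rewrite !mulr_ge0 ?exprn_ge0.
have h5 : 0 <= H * (x ^+ 3 + 21 * x ^+ 2 + 39 * x + 28).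
  by rewrite mulr_ge0 ?addr_ge0 ?mulr_ge0 ?exprn_ge0.
by move: h1 h3 h4 h5; lra.
Qed.

(** The terms in [H] alone cancel, and [w i * H * (3 * x ^ 2 + 9 * x + 7)] with [4 <= w i * H]
    outweighs the quadratic slack, about [4 * x ^ 2]. *)
Lemma bad_expo i : i != i0 ->
  H * (3 * x ^+ 2 + 3 * x + 1) - (2 * x + 1) - lnQ (x + 1) - lnb (x + 1) i - lnD x i
    <= - (2 * x).
Proof.
move=> /negbTE ne; rewrite /lnQ /lnb /lnD ne.
have hi : 0 <= (w i * H - 4) * (3 * x ^+ 2 + 9 * x + 7).
  by apply: mulr_ge0 => //; rewrite subr_ge0.
by move: hi x2x X1; lra.
Qed.

(** All terms in [H] cancel: [b i0] is just large enough. Only the slack [- (3 * d - 5) * x ^ 2] is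
    left, and it is negative because [2 <= d]. *)
Lemma bad_expo0 : - lnQ (x + 1) - lnb x i0 - lnD x i0 <= - (2 * x).
Proof.
rewrite /lnQ /lnb /lnD eqxx.
have h3 : 0 <= (d%:R - 2) * x ^+ 2.
  by apply: mulr_ge0; [rewrite subr_ge0 dR2 | exact: sqr_ge0].
by move: h3 x2x X1; lra.
Qed.

Lemma Qexpo : lnQ x - lnQ (x + 1) <= - (2 * x).
Proof.
rewrite /lnQ.
have hH : 0 <= (H - 5) * (3 * x ^+ 2 + 3 * x + 1) by rewrite mulr_ge0 // subr_ge0.
by move: hH x2x X1; lra.
Qed.

Lemma qD_expo i : lnQ x + lnD x i <= 0.
Proof.
rewrite /lnQ /lnD.
have h : 0 <= w i * H * (x + 1) ^+ 3.
  by rewrite mulr_ge0 ?exprn_ge0 ?addr_ge0 //; exact: le_trans (wH4 i).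
by have := sqr_ge0 x; lra.
Qed.

End Exponents.
End Scales.

(** * One step down the tree at the chosen scales *)

Section InnerStep.
Variables (R : realType) (d : nat) (g : 'M[R]_(d + 1)).
Hypothesis gU : g \in unitmx.
Variables (i0 : 'I_d) (w : 'I_d -> R) (H : R).
Hypothesis d_ge2 : (1 < d)%N.
Hypothesis w_sum1 : \sum_i w i = 1.
Hypothesis H5 : 5 <= H.
Hypothesis Hd : d%:R <= H.
Hypothesis wH4 : forall i, 4 <= w i * H.
Local Notation C := (cst R d).
Local Notation B := (big_cst R d).
Local Notation lnQ := (lnQ H).
Local Notation lnb := (lnb i0 w H).
Local Notation lnD := (lnD w H).
Local Notation scQ := (scQ H).
Local Notation scb := (scb i0 w H).
Local Notation scD := (scD w H).

(** The three thresholds serve, in order, to bound logarithms by [expR x], to absorb second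
    differences of [H * x ^ 3], and to absorb multiplicative constants. *)
Definition large_scale x := [/\ 200 <= x, 14 * H <= x & 10 * B ^+ 2 <= expR x].

Lemma scD_gt0 x i : 0 < scD x i. Proof. by rewrite divr_gt0 ?expR_gt0. Qed.

Lemma cellE y i : cell (scQ y) (scb y) i = 4 * C * expR (- lnQ y - lnb y i).
Proof.
rewrite /cell /scb /scQ -expRD -expRN; congr (_ * expR _); ring.
Qed.

Lemma large_exp x : large_scale x -> B * expR (- x) <= 10^-1 /\ B ^+ 2 * expR (- x) <= 10^-1.
Proof.
move=> [_ _ hB].
have B1 : 1 <= B by have [] := big_cst_ge R (ltnW d_ge2).
have e : B ^+ 2 * expR (- x) <= 10^-1.
  rewrite expRN ler_pdivrMr ?expR_gt0 // ler_pdivlMl //.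
split=> //; apply: le_trans e; apply: ler_wpM2r; first exact: expR_ge0.
by rewrite expr2 ler_peMr //; apply: le_trans B1.
Qed.

Lemma scD_cell x i : large_scale x -> scD (x + 1) i <= cell (scQ (x + 1)) (scb (x + 1)) i / 4.
Proof.
move=> [x0 xH _]; rewrite cellE /scD.
have : lnD (x + 1) i <= - lnQ (x + 1) - lnb (x + 1) i by apply: lnD_cell.
rewrite -ler_expR.
have := cst_ge1 R d; have := expR_ge0 (- lnQ (x + 1) - lnb (x + 1) i).
by move: (expR (lnD _ _)) (expR _) (cst _ _) => a b c; nra.
Qed.

Lemma harm_scale x (n : nat) : large_scale x ->
  n%:R <= expR (x + 4 * H * (x + 2) ^+ 3) -> harm R n <= expR x.
Proof.
move=> [x0 xH _] hn; have H0 : 0 <= H by move: H5; lra.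
apply: le_trans (harm_le _ hn) (quartic_le_exp x0 H0 _); last by move: xH H0; lra.
by rewrite addr_ge0 ?mulr_ge0 ?exprn_ge0 ?addr_ge0 //; move: x0; lra.
Qed.

Lemma inner_step x v : large_scale x -> scQ x <= vecq g v <= 2 * scQ x ->
    vfree g v (scb x) ->
  exists K (ch : 'I_K.+1 -> 'cV[int]_(d + 1)),
    [/\ forall a, scQ (x + 1) <= vecq g (ch a) <= 2 * scQ (x + 1) /\ vfree g (ch a) (scb (x + 1)),
        forall a, box g (ch a) (scD (x + 1)) `<=` box g v (scD x) &
        forall (F : set 'cV[R]_d) r, 0 <= r ->
          (forall x y i, F x -> F y -> `|x i 0 - y i 0| <= r) ->
          #|[set a | `[< box g (ch a) (scD (x + 1)) `&` F !=set0 >]]%SET|%:R <=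
          2 * \prod_i Num.min 1 ((r + 2 * cell (scQ (x + 1)) (scb (x + 1)) i) / scD x i) * K.+1%:R].
Proof.
move=> lx /andP[q1 q2] vf.
have [x0 xH hB] := lx.
have [e1 e2] := large_exp lx.
have [B1 Bd BC BdC] := big_cst_ge R (ltnW d_ge2).
have C1 := cst_ge1 R d.
have E0 := expR_gt0 (- x).
have Q0 y : 0 < scQ y by exact: expR_gt0.
have q0 : 0 < vecq g v by exact: lt_le_trans q1.
have expQ : scQ x / scQ (x + 1) <= expR (- (2 * x)).
  by rewrite /scQ -expRN -expRD ler_expR; exact: Qexpo.
have eeE : expR (- (2 * x)) = expR (- x) * expR (- x).
  by rewrite -expRD; congr expR; ring.
have ee : expR (- (2 * x)) <= expR (- x).
  by rewrite ler_expR; move: x0; lra.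
have qQ : vecq g v / scQ (x + 1) <= 2 * expR (- (2 * x)).
  rewrite ler_pdivrMr //; apply: le_trans q2 _; rewrite -mulrA ler_pM2l //.
  by rewrite -ler_pdivrMr.
(* Bounds the logarithm of each [scb (x + 1) i] and of its ratio to [scb x i], hence the ranges of
   the codes; harmonic sums are then at most [expR x]. *)
set L := 4 * H * (x + 2) ^+ 3.
have H0 : 0 <= H by move: H5; lra.
have L0 : 0 <= L by rewrite ?mulr_ge0 ?exprn_ge0 ?addr_ge0 //; move: x0; lra.
have eL : 1 <= expR L by rewrite -expR0 ler_expR.
have bige : 2 * d%:R + 1 <= expR x.
  apply: le_trans hB; have : 0 <= B * (B - 1) by rewrite mulr_ge0 ?subr_ge0 //; exact: le_trans B1.
  by move: B1 Bd; lra.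
have dR := @dR2 R _ d_ge2.
have Pexp : \prod_l (scb (x + 1) l / scb x l) = expR (H * (3 * x ^+ 2 + 3 * x + 1) - (2 * x + 1)).
  rewrite (eq_bigr (fun l => expR (lnb (x + 1) l - lnb x l))); last by move=> l _; rewrite expRB.
  by rewrite -expR_sum sumrB !sum_lnb //; congr expR; ring.
apply: (node_step_sharp gU (i0 := i0) (b := scb x) (h := expR x) (y := expR (x + L))) => //.
- by move=> i; exact: expR_gt0.
- by move=> i; rewrite ler_expR; exact: lnb_incr.
- by move=> i; exact: scD_gt0.
- have -> : vecq g v * (2 * d%:R * C / scQ (x + 1)) = vecq g v / scQ (x + 1) * (2 * d%:R * C).
    by rewrite mulrCA -mulrA mulrC.
  apply: le_trans (_ : 2 * expR (- x) * (2 * d%:R * C) <= _).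
    apply: ler_wpM2r; first by rewrite !mulr_ge0 //; exact: le_trans C1.
    by apply: le_trans qQ _; rewrite ler_pM2l.
  have BdC' : 32 * (d%:R * C) <= B by rewrite mulrA.
  rewrite -[2 * d%:R * C]mulrA; move: BdC' e1 E0.
  move: (d%:R * C) (B) (expR (- x)) => u b e h1 h2 h3.
  have : 0 <= (b - 32 * u) * e by rewrite mulr_ge0 ?subr_ge0 // ltW.
  by lra.
- move=> i; rewrite cellE /scD.
  have h1 : expR (- lnQ (x + 1) - lnb (x + 1) i) <= expR (- x) * expR (lnD x i).
    rewrite -expRD ler_expR -lerBlDr; apply: cell_lnD => //.
  have h2 : 8 * C * expR (- x) <= 1.
    apply: le_trans (_ : B * expR (- x) <= _); last by apply: le_trans e1 _; lra.
    by apply: ler_wpM2r; [exact: ltW | apply: le_trans BC; move: C1; lra].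
  apply: le_trans (_ : 4 * C * (expR (- x) * expR (lnD x i)) <= _).
    by apply: ler_wpM2l => //; rewrite mulr_ge0 //; exact: le_trans C1.
  have := ler_wpM2r (expR_ge0 (lnD x i)) h2.
  by move: (expR (- x)) (expR (lnD _ _)) (C) => a b c; lra.
- by move=> i; exact: scD_cell.
- apply: le_trans (_ : 2 * d%:R * expR L + 1 <= _); last first.
    rewrite expRD; apply: le_trans (_ : (2 * d%:R + 1) * expR L <= _).
      by rewrite (mulrDl (2 * d%:R) 1) lerD2l mul1r.
    by apply: ler_wpM2r => //; exact: expR_ge0.
  rewrite lerD2r mulr_sumr.
  have -> : 2 * d%:R * expR L = \sum_(i < d) (2 * expR L).
    by rewrite sumr_const card_ord -[in RHS]mulr_natl; ring.
  apply: ler_sum => i _.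
  have qD : vecq g v * scD x i <= 1.
    apply: le_trans (_ : 2 * scQ x * scD x i <= _).
      by apply: ler_wpM2r => //; exact: ltW (scD_gt0 _ _).
    rewrite /scD /scQ (_ : 2 * expR (lnQ x) * (expR (lnD x i) / 2) =
      expR (lnQ x) * expR (lnD x i)); last by field.
    by rewrite -expRD -expR0 ler_expR; exact: qD_expo.
  rewrite (_ : 2 * vecq g v * _ = 2 * (scb (x + 1) i * (vecq g v * scD x i))); last by ring.
  rewrite ler_pM2l // -[leRHS]mulr1; apply: ler_pM => //.
    exact: expR_ge0.
    by rewrite mulr_ge0 // ltW // ?scD_gt0.
  by rewrite ler_expR; exact: lnb_le.
- move=> i; rewrite expRD /scb -expRB; apply: ler_pM => //.
    by move: bige dR; lra.
  by rewrite ler_expR; exact: lnb_diff_le.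
- by move=> n hn; exact: harm_scale hn.
rewrite Pexp.
(* The terms in [H] cancel, since [lnQ] grows as fast as the leading part of the sum of the [lnb];
   the exponent that remains is [- (2 * x + 1)]. A bound of order [expR (- (2 * x))] is aimed at
   because the harmonic sums cost a factor [expR x]. *)
have t1 : vecq g v / scQ (x + 1) * expR (H * (3 * x ^+ 2 + 3 * x + 1) - (2 * x + 1)) <= 2 * expR (- (2 * x)).
  apply: le_trans (_ : 2 * (scQ x / scQ (x + 1)) * expR (H * (3 * x ^+ 2 + 3 * x + 1) - (2 * x + 1)) <= _).
    apply: ler_wpM2r; first exact: expR_ge0.
    by rewrite mulrA; apply: ler_wpM2r => //; rewrite invr_ge0 ltW.
  rewrite -mulrA ler_pM2l // /scQ -expRN -!expRD ler_expR /lnQ.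
  by have := exprn_ge0 3 (_ : 0 <= x); lra.
have t2 i : i != i0 -> expR (H * (3 * x ^+ 2 + 3 * x + 1) - (2 * x + 1)) /
    (scQ (x + 1) * scb (x + 1) i * scD x i) <= 2 * expR (- (2 * x)).
  move=> ne.
  have -> : expR (H * (3 * x ^+ 2 + 3 * x + 1) - (2 * x + 1)) / (scQ (x + 1) * scb (x + 1) i * scD x i)
    = 2 * expR (H * (3 * x ^+ 2 + 3 * x + 1) - (2 * x + 1) - lnQ (x + 1) - lnb (x + 1) i - lnD x i).
    rewrite /scQ /scb /scD; move: (lnQ _) (lnb _ _) (lnD _ _) (H * _ - _) => a1 a2 a3 a4.
    by rewrite !expRB; field; rewrite !gt_eqF ?expR_gt0.
  by rewrite ler_pM2l // ler_expR; exact: bad_expo.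
have t3 : (scQ (x + 1) * scb x i0 * scD x i0)^-1 <= 2 * expR (- (2 * x)).
  have -> : (scQ (x + 1) * scb x i0 * scD x i0)^-1 = 2 * expR (- lnQ (x + 1) - lnb x i0 - lnD x i0).
    rewrite /scQ /scb /scD; move: (lnQ _) (lnb _ _) (lnD _ _) => a1 a2 a3.
    by rewrite !expRB expRN; field; rewrite !gt_eqF ?expR_gt0.
  by rewrite ler_pM2l // ler_expR; exact: bad_expo0.
have t2s : \sum_(i | i != i0) expR (H * (3 * x ^+ 2 + 3 * x + 1) - (2 * x + 1)) /
    (scQ (x + 1) * scb (x + 1) i * scD x i) <= d%:R * (2 * expR (- (2 * x))).
  apply: le_trans (ler_sum _ (fun i ne => t2 i ne)) _.
  rewrite sumr_const -[leLHS]mulr_natl; apply: ler_wpM2r.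
    by rewrite mulr_ge0 ?expR_ge0.
  by rewrite ler_nat; apply: leq_trans (max_card _) _; rewrite card_ord.
have Bh0 : 0 <= B * expR x by rewrite mulr_ge0 ?expR_ge0 //; exact: le_trans B1.
(* The total [(4 + 2 * d) * B * expR (- x)] is at most [4 * B ^ 2 * expR (- x) <= 4 / 10]. *)
apply: le_trans (ler_wpM2l Bh0 (lerD (lerD t1 t2s) t3)) _.
have -> : B * expR x * (2 * expR (- (2 * x)) + d%:R * (2 * expR (- (2 * x))) + 2 * expR (- (2 * x)))
   = (4 + 2 * d%:R) * B * expR (- x) * (expR x * expR (- x)).
  by rewrite eeE; ring.
rewrite -expRD subrr expR0 mulr1.
have B0 : 0 <= B by exact: le_trans B1.
have : 0 <= B * expR (- x) * (4 * B - 4 - 2 * d%:R).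
  by rewrite !mulr_ge0 ?(ltW E0) //; move: Bd BC C1; lra.
move: e2; rewrite expr2.
by move: (B) (expR (- x)) => b e; lra.
Qed.

End InnerStep.

(** * Entering the scales from an arbitrary box *)

Section RootStep.
Variables (R : realType) (d : nat) (g : 'M[R]_(d + 1)).
Hypothesis gU : g \in unitmx.
Variables (i0 : 'I_d) (w : 'I_d -> R) (H : R).
Hypothesis d_ge2 : (1 < d)%N.
Hypothesis w_sum1 : \sum_i w i = 1.
Hypothesis H5 : 5 <= H.
Hypothesis Hd : d%:R <= H.
Hypothesis wH4 : forall i, 4 <= w i * H.
Local Notation C := (cst R d).
Local Notation B := (big_cst R d).
Local Notation lnQ := (lnQ H).
Local Notation lnb := (lnb i0 w H).
Local Notation lnD := (lnD w H).
Local Notation scQ := (scQ H).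
Local Notation scb := (scb i0 w H).
Local Notation scD := (scD w H).

Lemma lnD_le x i : 0 <= x -> lnD x i <= - H * x ^+ 3.
Proof.
move=> x0; rewrite /lnD.
have h : 0 <= w i * H * (x + 1) ^+ 3.
  by rewrite mulr_ge0 ?exprn_ge0 ?addr_ge0 //; exact: le_trans (wH4 i).
by have := sqr_ge0 x; lra.
Qed.

Lemma lnQ_ge x : 200 <= x -> 2 * x <= lnQ (x + 1).
Proof.
move=> x0; rewrite /lnQ.
have h : 2 * x <= 2 * (x + 1) ^+ 3.
  rewrite ler_pM2l //; apply: le_trans (_ : x + 1 <= _); first lra.
  rewrite exprS ler_peMr //; first by lra.
  by rewrite exprn_ege1 //; lra.
apply: le_trans h _; apply: ler_wpM2r; last by move: H5; lra.
by rewrite exprn_ge0 //; lra.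
Qed.

Lemma lnb_ge x i : 200 <= x -> 14 * H <= x -> x <= lnb (x + 1) i.
Proof.
move=> x0 xH.
have X1 : 0 <= x by lra.
have x2x : 200 * x <= x ^+ 2 by rewrite expr2; apply: ler_wpM2r.
have x3 : 200 * x ^+ 2 <= x ^+ 3 by rewrite [x ^+ 3]exprS; apply: ler_wpM2r => //; exact: sqr_ge0.
have h : 0 <= (w i * H - 4) * (x + 2) ^+ 3.
  by rewrite mulr_ge0 ?subr_ge0 // exprn_ge0 // addr_ge0.
rewrite /lnb; case: eqP h => [->|_] h; last by move: h x3 x2x X1; lra.
have h3 : 0 <= (d%:R - 2) * (x + 1) ^+ 2.
  by apply: mulr_ge0; [rewrite subr_ge0 dR2 | exact: sqr_ge0].
have h4 : 0 <= (x - 14 * H) * (3 * x ^+ 2 + 9 * x + 7).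
  by rewrite mulr_ge0 ?subr_ge0 //; have := sqr_ge0 x; lra.
by move: h h3 h4 x3 x2x X1; lra.
Qed.

(** With [beta] and [r] fixed, the slack [expR (- (x + 1) ^ 2)] in the product of the
    [scb (x + 1) i], together with the size of [scQ (x + 1)], makes the three parts of the bad ratio
    at most constants times [expR (- (2 * x))]. The threshold [T] adds up positive bounds, one for
    each condition on [x]. *)
Lemma root_step v (beta r : R) : 0 < vecq g v -> 0 < beta -> 0 < r ->
    vfree g v (fun=> beta) ->
  exists T, forall x, large_scale d H x -> T <= expR x ->
    exists u, [/\ scQ (x + 1) <= vecq g u <= 2 * scQ (x + 1), vfree g u (scb (x + 1)) &
      box g u (scD (x + 1)) `<=` box g v (fun=> r)].
Proof.
move=> q0 beta0 r0 vf; set q := vecq g v in q0.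
have [B1 Bd BC BdC] := big_cst_ge R (ltnW d_ge2).
have B0 : 0 < B by exact: lt_le_trans B1.
have C1 := cst_ge1 R d.
have C0 : 0 < C by exact: lt_le_trans C1.
have dR := @dR2 R _ d_ge2.
have d0 : 0 < d%:R :> R by move: dR; lra.
have bd0 : 0 < beta ^+ d by rewrite exprn_gt0.
pose S := q / beta ^+ d + d%:R / (beta ^+ d * r) + (beta * r)^-1.
have S0 : 0 < S by rewrite !addr_gt0 ?divr_gt0 ?invr_gt0 ?mulr_gt0.
exists (4 * d%:R * C * q + 4 * C / r + beta + (2 * q * d%:R * r + 1) + 2 / beta + 2 * B * S).
move=> x lx hT; have [x0 xH hB] := lx.
have T1 : 0 < 4 * d%:R * C * q by rewrite !mulr_gt0.
have T2 : 0 < 4 * C / r by rewrite !mulr_gt0 ?invr_gt0.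
have T4 : 0 < 2 * q * d%:R * r by rewrite !mulr_gt0.
have T5 : 0 < 2 / beta by rewrite divr_gt0.
have T6 : 0 < 2 * B * S by rewrite !mulr_gt0.
have {T1 T2 T4 T5 T6 hT} [[T1 T2 T3 T4 T5] T6] : [/\ 4 * d%:R * C * q <= expR x, 4 * C / r <= expR x,
    beta <= expR x, 2 * q * d%:R * r + 1 <= expR x & 2 / beta <= expR x] /\ 2 * B * S <= expR x.
  move: T1 T2 T4 T5 T6 hT.
  move: (4 * _ * _ * _) (4 * C / _) (2 * _ * _ * _) (2 / _) (2 * B * _) => a1 a2 a3 a4 a5.
  by move=> *; split; [split|]; lra.
have X1 : 0 <= x by lra.
set L := 4 * H * (x + 2) ^+ 3.
have H0 : 0 <= H by move: H5; lra.
have L0 : 0 <= L by rewrite ?mulr_ge0 ?exprn_ge0 ?addr_ge0.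
have eL : 1 <= expR L by rewrite -expR0 ler_expR.
have Q0 : 0 < scQ (x + 1) by exact: expR_gt0.
have E0 := expR_gt0 x.
have Q1 : expR (2 * x) <= scQ (x + 1) by rewrite ler_expR lnQ_ge.
have e2x : expR (2 * x) = expR x * expR x by rewrite -expRD; congr expR; ring.
have ex1 : 1 <= expR x by rewrite -expR0 ler_expR.
have b1 i : expR x <= scb (x + 1) i by rewrite ler_expR lnb_ge.
have bL i : scb (x + 1) i <= expR L by rewrite ler_expR; apply: lnb_le.
have b0 i : 0 < scb (x + 1) i by exact: expR_gt0.
have Pexp : \prod_l (scb (x + 1) l / beta) = scQ (x + 1) * expR (- (x + 1) ^+ 2) / beta ^+ d.
  rewrite big_split /= prodr_const card_ord -expR_sum sum_lnb // exprVn; congr (_ / _).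
  by rewrite -expRD addrC.
have ex2 : expR (- (x + 1) ^+ 2) <= (expR x * expR x)^-1.
  by rewrite -e2x -expRN ler_expR; have := sqr_ge0 x; lra.
have [|||||||||||K [ch [h1 h2 _]]] := node_step_sharp gU (i0 := i0) (b := fun=> beta) (b' := scb (x + 1))
   (D := fun=> r) (D' := scD (x + 1)) (Q' := scQ (x + 1)) (h := expR x) (y := expR (x + L)) q0 vf.
- by [].
- by move=> i; exact: le_trans (b1 i).
- by [].
- by [].
- rewrite -/q (_ : q * _ = (4 * d%:R * C * q) / scQ (x + 1) / 2); last by field; rewrite gt_eqF.
  rewrite ler_pdivrMr // mulVf // ler_pdivrMr // mul1r.
  by apply: le_trans T1 _; apply: le_trans Q1; rewrite ler_expR; lra.
- move=> i; rewrite cellE.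
  apply: le_trans (_ : 4 * C * expR (- x) <= _).
    rewrite ler_pM2l ?mulr_gt0 // ler_expR.
    have h : - lnQ (x + 1) - lnb (x + 1) i - lnD x i <= - x by apply: cell_lnD.
    have h' := lnD_le i X1; have h'' : 0 <= H * x ^+ 3 by rewrite mulr_ge0 ?exprn_ge0.
    by move: h h' h''; lra.
  by rewrite expRN ler_pdivrMr // [r * _]mulrC -ler_pdivrMr //.
- by move=> i; exact: scD_cell.
- rewrite -/q -mulr_suml expRD; apply: le_trans (_ : 2 * q * d%:R * r * expR L + 1 <= _).
    rewrite lerD2r -[2 * q * d%:R * r]mulrA [d%:R * r]mulrC.
    rewrite (_ : 2 * q * (r * d%:R) * expR L = 2 * q * ((d%:R * expR L) * r)); last by ring.
    rewrite ler_pM2l ?mulr_gt0 //; apply: ler_wpM2r; first exact: ltW.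
    apply: le_trans (ler_sum _ (fun i _ => bL i)) _.
    by rewrite sumr_const card_ord mulr_natl.
  apply: le_trans (ler_wpM2r (expR_ge0 L) T4).
  by rewrite [leRHS]mulrDl lerD2l mul1r.
- move=> i; rewrite expRD (_ : 2 * _ = 2 / beta * scb (x + 1) i); last first.
    by field; rewrite gt_eqF.
  apply: ler_pM; rewrite ?T5 ?bL //; last exact/ltW/b0.
  by rewrite mulr_ge0 // invr_ge0 ltW.
- by move=> n hn; exact: (harm_scale H5 lx hn).
- rewrite Pexp -/q.
  have t1 : q / scQ (x + 1) * (scQ (x + 1) * expR (- (x + 1) ^+ 2) / beta ^+ d) <=
      q / beta ^+ d * (expR x * expR x)^-1.
    rewrite (_ : _ * (_ / _) = q / beta ^+ d * expR (- (x + 1) ^+ 2)); last first.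
      by field; rewrite !gt_eqF.
    by rewrite ler_pM2l // divr_gt0.
  have t2 i : scQ (x + 1) * expR (- (x + 1) ^+ 2) / beta ^+ d / (scQ (x + 1) * scb (x + 1) i * r) <=
     (beta ^+ d * r)^-1 * (expR x * expR x)^-1.
    rewrite (_ : _ / _ / _ = (beta ^+ d * r)^-1 * (expR (- (x + 1) ^+ 2) / scb (x + 1) i)); last first.
      by field; rewrite !gt_eqF.
    rewrite ler_pM2l ?invr_gt0 ?mulr_gt0 // ler_pdivrMr //.
    apply: le_trans ex2 _; rewrite ler_peMr ?invr_ge0 ?mulr_ge0 ?expR_ge0 //.
    exact: le_trans (b1 i).
  have t3 : (scQ (x + 1) * beta * r)^-1 <= (beta * r)^-1 * (expR x * expR x)^-1.
    rewrite -mulrA invfM mulrC ler_pM2l ?invr_gt0 ?mulr_gt0 //.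
    by rewrite lef_pV2 ?posrE ?mulr_gt0 // -e2x.
  have t2s : \sum_(i | i != i0)
      scQ (x + 1) * expR (- (x + 1) ^+ 2) / beta ^+ d / (scQ (x + 1) * scb (x + 1) i * r)
     <= d%:R * ((beta ^+ d * r)^-1 * (expR x * expR x)^-1).
    apply: le_trans (ler_sum _ (fun i _ => t2 i)) _.
    rewrite sumr_const -[leLHS]mulr_natl; apply: ler_wpM2r.
      by rewrite mulr_ge0 // invr_ge0 mulr_ge0 ?expR_ge0 // ltW.
    by rewrite ler_nat; apply: leq_trans (max_card _) _; rewrite card_ord.
  have Bh0 : 0 <= B * expR x by rewrite mulr_ge0 ?expR_ge0 // ltW.
  apply: le_trans (ler_wpM2l Bh0 (lerD (lerD t1 t2s) t3)) _.
  rewrite (_ : _ * _ * (_ + _) = 2 * B * S / expR x / 2); last first.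
    by rewrite /S; field; rewrite !gt_eqF.
  by rewrite ler_pdivrMr // mulVf // ler_pdivrMr // mul1r.
exists (ch ord0); have [? ?] := h1 ord0; split => //.
Qed.

End RootStep.

(** * Mass distribution *)

(** For [r >= D] the ratio of maxima is 1. Below [D], [r / D] is at most its [a]-th power as
    [a <= 1], and the term in [c] is worst when the maximum equals [D'], which is the case the
    hypothesis covers. The maxima with [r] are there so that the product over the levels
    telescopes. *)
Lemma min_ratio_le (R : realType) (r c D D' a om : R) :
    0 < r -> 0 < D' -> D' <= D -> 0 < a -> a <= 1 -> 0 <= c -> 1 <= om ->
    2 * (c / D) * (D / D') `^ a + 1 <= om ->
  Num.min 1 ((r + 2 * c) / D) <= om * (Num.max r D' / Num.max r D) `^ a.
Proof.
move=> r0 D'0 D'D a0 a1 c0 om1 hom.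
have D0 : 0 < D by exact: lt_le_trans D'D.
have [Dr|rD] := leP D r.
  rewrite (max_idPl (le_trans D'D Dr)) divff ?gt_eqF //.
  by rewrite powR1 mulr1 ge_min om1.
set t := Num.max r D'.
have t0 : 0 < t by rewrite lt_max r0.
have tD : t <= D by rewrite ge_max (ltW rD).
have tD0 : 0 < t / D by rewrite divr_gt0.
have tD1 : t / D <= 1 by rewrite ler_pdivrMr // mul1r.
have h1 : r / D <= (t / D) `^ a.
  apply: le_trans (_ : t / D <= _).
    by rewrite ler_pM2r ?invr_gt0 // le_max lexx.
  rewrite -[leLHS]powRr1 ?(ltW tD0) //; apply: ger_powR => //.
  by rewrite tD0.
have h2 : 2 * (c / D) <= (om - 1) * (t / D) `^ a.
  apply: le_trans (_ : 2 * (c / D) * (D / D') `^ a * (t / D) `^ a <= _); last first.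
    by apply: ler_wpM2r; [exact: powR_ge0 | rewrite lerBrDr].
  rewrite -mulrA -powRM ?divr_ge0 ?(ltW D0) ?(ltW D'0) ?(ltW t0) //.
  rewrite ler_peMr ?mulr_ge0 ?invr_ge0 ?(ltW D0) //.
  apply: le_trans (_ : 1 `^ a <= _); first by rewrite powR1.
  apply: ge0_ler_powR; rewrite ?nnegrE ?(ltW a0) //.
    by rewrite !mulr_ge0 ?invr_ge0 ?(ltW D0) ?(ltW D'0) ?(ltW t0).
  rewrite (_ : D / D' * (t / D) = t / D'); last by field; rewrite !gt_eqF.
  by rewrite ler_pdivlMr // mul1r le_max lexx orbT.
rewrite ge_min; apply/orP; right.
rewrite mulrDl -mulrA; move: h1 h2; move: (_ `^ a) (r / D) (c / D) => u v z; lra.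
Qed.

Lemma powR_sum (R : realType) (I : finType) (r : R) (F : I -> R) : 0 < r ->
  r `^ (\sum_i F i) = \prod_i r `^ F i.
Proof.
move=> r0; rewrite /powR gt_eqF // mulr_suml expR_sum.
by apply: eq_bigr => i _.
Qed.

Lemma prod_telescope (R : realType) (I : finType) (G f : nat -> R) (m : nat -> I -> R)
    (a : I -> R) (K : nat) :
    (forall k, 0 <= G k) -> (forall k i, 0 < m k i) ->
    (forall k, G k <= expR (f k) * \prod_i (m k.+1 i / m k i) `^ a i) ->
  \prod_(0 <= k < K) G k <=
  expR (\sum_(0 <= k < K) f k) * \prod_i (m K i / m 0%N i) `^ a i.
Proof.
move=> G0 m0 hG; elim: K => [|K IH].
  rewrite !big_geq // expR0 mul1r big1 // => i _.
  by rewrite divff ?powR1 // gt_eqF.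
rewrite big_nat_recr // [X in expR X]big_nat_recr //= expRD.
apply: le_trans (ler_pM _ _ IH (hG K)) _ => //.
  by apply: prodr_ge0 => k _.
rewrite le_eqVlt; apply/orP; left; apply/eqP.
rewrite mulrACA -big_split /=; congr (_ * _); apply: eq_bigr => i _.
rewrite -powRM ?divr_ge0 ?(ltW (m0 _ _)) //; congr (_ `^ _).
by field; rewrite !gt_eqF.
Qed.

Section Mass.
Variables (R : realType) (d : nat).
Variables (i0 : 'I_d) (w : 'I_d -> R) (H : R).
Hypothesis d_ge2 : (1 < d)%N.
Hypothesis w_sum1 : \sum_i w i = 1.
Hypothesis H5 : 5 <= H.
Hypothesis Hd : d%:R <= H.
Hypothesis wH4 : forall i, 4 <= w i * H.
Local Notation C := (cst R d).
Local Notation B := (big_cst R d).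
Local Notation lnQ := (lnQ H).
Local Notation lnb := (lnb i0 w H).
Local Notation lnD := (lnD w H).
Local Notation scQ := (scQ H).
Local Notation scb := (scb i0 w H).
Local Notation scD := (scD w H).

Definition expo i : R := if i == i0 then w i0 / (1 + w i0) else 1.

Definition frac x r : R :=
  2 * \prod_i Num.min 1 ((r + 2 * cell (scQ (x + 1)) (scb (x + 1)) i) / scD x i).

Let w0 i : 0 < w i. Proof. exact: (weight_gt0 H5 wH4). Qed.

Lemma expo_bounds i : 0 < expo i <= 1.
Proof.
rewrite /expo; case: eqP => _; last by rewrite ltr01 lexx.
have := w0 i0 => h; rewrite divr_gt0 ?addr_gt0 //= ler_pdivrMr ?addr_gt0 //.
by rewrite mul1r lerDr.
Qed.

Lemma sum_expo : \sum_i expo i = d%:R - (1 + w i0)^-1.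
Proof.
rewrite (bigD1 i0) //= /expo eqxx (eq_bigr (fun=> 1)); last by move=> i /negbTE ->.
rewrite sumr_const.
have -> : #|(fun i : 'I_d => i != i0)| = d.-1.
  have := cardC1 i0; rewrite card_ord => <-; by apply: eq_card => i; rewrite !inE.
have dE : d%:R = 1 + (d.-1)%:R :> R by rewrite nat1r prednK // ltnW.
rewrite dE; have := w0 i0 => h.
by field; rewrite gt_eqF // addr_gt0.
Qed.

Lemma lnD_decr x i : 0 <= x -> lnD (x + 1) i <= lnD x i.
Proof.
move=> x0; rewrite /lnD.
have h1 : 0 <= w i * H * (3 * x ^+ 2 + 9 * x + 7).
  apply: mulr_ge0; first exact: le_trans (wH4 i).
  by have := sqr_ge0 x; lra.
have h2 : 0 <= H * (3 * x ^+ 2 + 3 * x + 1).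
  by apply: mulr_ge0; [move: H5; lra | have := sqr_ge0 x; lra].
by have := sqr_ge0 x; move: h1 h2; lra.
Qed.

(** [expo i] is the exponent at which the number of places in a box and the shrinking of the boxes
    have the same leading term in [H * x ^ 2]. Only quadratic slack with constants free of [H] and
    second differences of [H * x ^ 3] remain. *)
Lemma gain_expo x i : 200 <= x -> 14 * H <= x ->
  - lnQ (x + 1) - lnb (x + 1) i - lnD x i + expo i * (lnD x i - lnD (x + 1) i) <= 5 * x ^+ 2.
Proof.
move=> x0 xH.
have X1 : 0 <= x by lra.
have x2x : 200 * x <= x ^+ 2 by rewrite expr2; apply: ler_wpM2r.
rewrite /expo /lnb; case: eqP => [->|ne]; last first.
  by rewrite /lnQ /lnD; lra.
have W0 : 0 < 1 + w i0 by rewrite addr_gt0.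
have aE : w i0 / (1 + w i0) * (lnD x i0 - lnD (x + 1) i0) =
   w i0 / (1 + w i0) * (2 * x + 1) + w i0 * H * (3 * x ^+ 2 + 3 * x + 1)
   + w i0 / (1 + w i0) * (w i0 * H * (6 * x + 6)).
  by rewrite /lnD; field; rewrite gt_eqF.
rewrite {}aE; have /andP[a0 a1] := expo_bounds i0; move: a0 a1; rewrite /expo eqxx.
move: (w i0 / (1 + w i0)) => a a0 a1.
have h1 : 0 <= (1 - a) * (2 * x + 1) by rewrite mulr_ge0 ?subr_ge0 //; lra.
have h2 : 0 <= (1 - a) * (w i0 * H * (6 * x + 6)).
  rewrite mulr_ge0 ?subr_ge0 // mulr_ge0 //; last by lra.
  exact: le_trans (wH4 i0).
have h3 : 0 <= (x - 14 * H) * (6 * x + 6) by rewrite mulr_ge0 ?subr_ge0 //; lra.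
have h4 : 0 <= (d%:R - 2) * (x + 1) ^+ 2.
  by apply: mulr_ge0; [rewrite subr_ge0 dR2 | exact: sqr_ge0].
by rewrite /lnQ /lnD; move: h1 h2 h3 h4 x2x X1; lra.
Qed.

Lemma min_frac_le x r i : large_scale d H x -> 0 < r ->
  Num.min 1 ((r + 2 * cell (scQ (x + 1)) (scb (x + 1)) i) / scD x i) <=
  expR (6 * x ^+ 2) * (Num.max r (scD (x + 1) i) / Num.max r (scD x i)) `^ expo i.
Proof.
move=> lx r0; have [x0 xH hB] := lx.
have [B1 Bd BC BdC] := big_cst_ge R (ltnW d_ge2).
have C1 := cst_ge1 R d.
have /andP[a0 a1] := expo_bounds i.
have X1 : 0 <= x by lra.
have hh : 16 * C * expR (5 * x ^+ 2) + 1 <= expR (6 * x ^+ 2).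
  have e0 : 1 <= expR (5 * x ^+ 2) by rewrite -expR0 ler_expR mulr_ge0 ?sqr_ge0.
  rewrite (_ : 6 * x ^+ 2 = x ^+ 2 + 5 * x ^+ 2); last by ring.
  rewrite expRD; apply: le_trans (_ : (16 * C + 1) * expR (5 * x ^+ 2) <= _).
    by rewrite [leRHS]mulrDl lerD2l mul1r.
  apply: ler_wpM2r; first exact: expR_ge0.
  apply: le_trans (_ : expR x <= _); last by rewrite ler_expR expr2 ler_peMl //; lra.
  apply: le_trans hB; have : 0 <= B * (B - 1) by rewrite mulr_ge0 ?subr_ge0 //; exact: le_trans B1.
  by move: BC C1; lra.
apply: min_ratio_le => //.
- exact: scD_gt0.
- by rewrite /scD ler_pM2r ?invr_gt0 // ler_expR lnD_decr.
- by rewrite cellE !mulr_ge0 ?expR_ge0 //; exact: le_trans C1.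
- by rewrite -expR0 ler_expR mulr_ge0 ?sqr_ge0.
apply: le_trans hh; rewrite lerD2r cellE.
have -> : scD x i / scD (x + 1) i = expR (lnD x i - lnD (x + 1) i).
  by rewrite expRB /scD; field; rewrite !gt_eqF ?expR_gt0.
rewrite -expRM [_ * expo i]mulrC.
have -> : 2 * (4 * C * expR (- lnQ (x + 1) - lnb (x + 1) i) / scD x i) *
    expR (expo i * (lnD x i - lnD (x + 1) i)) =
  16 * C * expR (- lnQ (x + 1) - lnb (x + 1) i - lnD x i + expo i * (lnD x i - lnD (x + 1) i)).
  rewrite /scD [in RHS]expRD.
  have aux (z1 z2 z3 : R) : 2 * (4 * C * expR z2 / (expR z3 / 2)) * expR z1 =
      16 * C * (expR (z2 - z3) * expR z1).
    by rewrite expRB; field; rewrite gt_eqF ?expR_gt0.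
  exact: aux.
rewrite ler_pM2l; last by move: C1; lra.
by rewrite ler_expR gain_expo.
Qed.

Lemma frac_ge0 x r : 0 <= r -> 0 <= frac x r.
Proof.
move=> r0; rewrite mulr_ge0 // prodr_ge0 // => i _; rewrite le_min ler01 /=.
have C1 := cst_ge1 R d.
rewrite divr_ge0 ?addr_ge0 ?(ltW (scD_gt0 _ _ _ _)) // cellE !mulr_ge0 ?expR_ge0 //.
exact: le_trans C1.
Qed.

Lemma frac_le x r : large_scale d H x -> 0 < r ->
  frac x r <= expR (7 * d%:R * x ^+ 2) *
    \prod_i (Num.max r (scD (x + 1) i) / Num.max r (scD x i)) `^ expo i.
Proof.
move=> lx r0; have [x0 xH hB] := lx.
have [B1 Bd BC BdC] := big_cst_ge R (ltnW d_ge2).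
have dR := @dR2 R _ d_ge2.
have h : frac x r <= 2 * \prod_(i < d) (expR (6 * x ^+ 2) *
    (Num.max r (scD (x + 1) i) / Num.max r (scD x i)) `^ expo i).
  rewrite ler_pM2l //; apply: ler_prod => i _; rewrite min_frac_le // andbT.
  have C1 := cst_ge1 R d.
  rewrite le_min ler01 /= divr_ge0 ?addr_ge0 ?(ltW r0) ?(ltW (scD_gt0 _ _ _ _)) //.
  by rewrite cellE !mulr_ge0 ?expR_ge0 //; exact: le_trans C1.
apply: le_trans h _; rewrite big_split /= mulrA; apply: ler_wpM2r.
  by apply: prodr_ge0 => i _; exact: powR_ge0.
rewrite prodr_const card_ord -expRM_natl.
rewrite (_ : 7 * d%:R * x ^+ 2 = d%:R * x ^+ 2 + d%:R * (6 * x ^+ 2)); last by ring.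
rewrite expRD; apply: ler_wpM2r; first exact: expR_ge0.
apply: le_trans (expR_ge1Dx _).
have : 1 * 1 <= d%:R * x ^+ 2 by apply: ler_pM => //; [lra | rewrite exprn_ege1 //; lra].
by lra.
Qed.

Section Telescope.
Variables (x0 : R).
Hypothesis large : forall k : nat, large_scale d H (x0 + k%:R).

Lemma prod_frac_le (K : nat) r : 0 < r ->
  \prod_(0 <= k < K) frac (x0 + k%:R) r <=
  expR (\sum_(0 <= k < K) 7 * d%:R * (x0 + k%:R) ^+ 2) *
  \prod_i (Num.max r (scD (x0 + K%:R) i) / Num.max r (scD x0 i)) `^ expo i.
Proof.
move=> r0.
have x00 : x0 + 0%:R = x0 by rewrite addr0.
pose m k i := Num.max r (scD (x0 + k%:R) i).
have m00 i : Num.max r (scD x0 i) = m 0%N i by rewrite /m x00.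
under [X in _ <= _ * X]eq_bigr do rewrite m00.
apply: (prod_telescope (m := m)).
- by move=> k; apply: frac_ge0; exact: ltW.
- by move=> k i; rewrite lt_max r0.
by move=> k; have := frac_le (large k) r0; rewrite -addrA natr1.
Qed.

(** The level is the first at which all sides are at most [r], so that every maximum has become [r].
    One level earlier, at scale [X], some side still exceeds [r], so [r <= expR (- H * X ^ 3)]. As
    there are at most [X] levels, the loss is at most [expR (7 * d * X ^ 3)], which [r ^ (- eta)]
    covers. *)
Lemma cover_mass eta r : 0 < eta -> 7 * d%:R <= H * eta -> 0 < r ->
    (forall i, r < scD x0 i) ->
  exists K : nat, \prod_(0 <= k < K) frac (x0 + k%:R) r <=
    (\prod_i (scD x0 i `^ expo i)^-1) * r `^ (d%:R - (1 + w i0)^-1 - eta).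
Proof.
move=> eta0 He r0 rD.
have x200 : 200 <= x0 by have [] := large 0%N; rewrite addr0.
have X0 : 0 <= x0 by lra.
pose P (k : nat) := [forall i, scD (x0 + k%:R) i <= r].
have exP : exists k, P k.
  exists (Num.truncn r^-1).+1; apply/forallP => i.
  have kr := truncnS_gt r^-1; set k := (_).+1 in kr *.
  set y := x0 + k%:R.
  have y1 : 1 <= y by rewrite /y; have : 0 <= k%:R :> R by []; lra.
  apply: le_trans (_ : expR (- y) <= _).
    rewrite /scD ler_pdivrMr // -[leLHS]mulr1; apply: ler_pM => //; rewrite ?expR_ge0 ?ler1n //.
    rewrite ler_expR; apply: le_trans (lnD_le wH4 _ _) _; first by lra.
    rewrite mulNr lerN2 -[leLHS]mul1r; apply: ler_pM => //; [by lra | by move: H5; lra|].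
    by rewrite exprS ler_peMr // ?exprn_ege1 //; lra.
  rewrite expRN invf_ple ?posrE ?expR_gt0 //.
  apply: le_trans (ltW kr) _; apply: le_trans (expR_ge1Dx y).
  by rewrite /y; lra.
pose K := ex_minn exP; have : K = ex_minn exP by [].
(* The minimum cannot be 0 because [r] is smaller than every side at [x0]; this gives a preceding
   level. *)
case: ex_minnP => K' PK minK _ {K}; case: K' PK minK => [|K] PK minK.
  have /forallP/(_ i0) := PK; rewrite addr0 leNgt.
  by rewrite rD.
exists K.+1; apply: le_trans (prod_frac_le _ r0) _.
have [i hi] : exists i, r < scD (x0 + K%:R) i.
  apply/not_existsP => h; have : P K.
    by apply/forallP => i; rewrite leNgt; apply/negP/h.
  by move=> /minK; rewrite ltnn.
set X := x0 + K%:R in hi.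
have XK : K.+1%:R <= X by rewrite -natr1 /X; lra.
have X1 : 0 <= X by rewrite addr_ge0.
have rX : r <= expR (- H * X ^+ 3).
  apply: le_trans (ltW hi) _; rewrite /scD ler_pdivrMr //.
  apply: le_trans (_ : expR (- H * X ^+ 3) * 1 <= _); last first.
    by apply: ler_wpM2l; [exact: expR_ge0 | rewrite ler1n].
  by rewrite mulr1 ler_expR; exact: lnD_le.
have S1 : \sum_(0 <= k < K.+1) 7 * d%:R * (x0 + k%:R) ^+ 2 <= H * eta * X ^+ 3.
  apply: le_trans (_ : \sum_(0 <= k < K.+1) 7 * d%:R * X ^+ 2 <= _).
    rewrite big_nat_cond [leRHS]big_nat_cond; apply: ler_sum => k /andP[/andP[_ kK] _].
    apply: ler_wpM2l; first by rewrite mulr_ge0.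
    rewrite lerXn2r ?nnegrE ?addr_ge0 // /X lerD2l ler_nat.
    by rewrite -ltnS.
  rewrite sumr_const_nat subn0 -[leLHS]mulr_natl mulrCA.
  apply: ler_pM => //; first by rewrite mulr_ge0 ?sqr_ge0 ?ler0n.
  by rewrite [leRHS]exprS; apply: ler_wpM2r => //; exact: sqr_ge0.
have e1 : expR (\sum_(0 <= k < K.+1) 7 * d%:R * (x0 + k%:R) ^+ 2) <= r `^ (- eta).
  rewrite powRN; apply: le_trans (_ : expR (H * eta * X ^+ 3) <= _); first by rewrite ler_expR.
  rewrite -[leLHS]invrK -expRN lef_pV2 ?posrE ?expR_gt0 ?powR_gt0 //.
  rewrite (_ : - (H * eta * X ^+ 3) = - H * X ^+ 3 * eta); last by ring.
  rewrite expRM; apply: ge0_ler_powR => //; rewrite ?nnegrE ?expR_ge0 ?(ltW r0) //.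
  exact: ltW.
have -> : \prod_i (Num.max r (scD (x0 + K.+1%:R) i) / Num.max r (scD x0 i)) `^ expo i =
   \prod_i (scD x0 i `^ expo i)^-1 * r `^ (d%:R - (1 + w i0)^-1).
  rewrite -sum_expo powR_sum //.
  rewrite -big_split /=; apply: eq_bigr => j _.
  have /forallP/(_ j) hj := PK.
  rewrite (max_idPl hj) (max_idPr (ltW (rD j))) powRM ?invr_ge0 ?(ltW r0) ?(ltW (scD_gt0 _ _ _ _)) //.
  by rewrite mulrC -[(scD x0 j)^-1]powR_inv1 ?(ltW (scD_gt0 _ _ _ _)) // -powRrM mulN1r powRN.
rewrite mulrCA; apply: ler_wpM2l.
  by apply: prodr_ge0 => j _; rewrite invr_ge0 powR_ge0.
rewrite [leRHS](_ : _ = r `^ (- eta) * r `^ (d%:R - (1 + w i0)^-1)); last first.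
  rewrite -powRD; first by rewrite addrC.
  by rewrite (gt_eqF r0) implybT.
by apply: ler_wpM2r => //; exact: powR_ge0.
Qed.

End Telescope.
End Mass.

(** * Root of the tree and divergence *)

Section Roots.
Variables (R : realType) (d : nat) (g : 'M[R]_(d + 1)).
Hypothesis gU : g \in unitmx.

(** For a dual vector orthogonal to [v], the last coordinate is a fixed combination of the others.
    If these are small enough, the integral vector [m] has norm at most 1/2, so it vanishes. *)
Lemma vfree_small v : 0 < vecq g v -> exists2 beta : R, 0 < beta & vfree g v (fun=> beta).
Proof.
move=> q0.
pose S : R := 1 + \sum_i `|vecp g v i| / vecq g v.
have S1 : 1 <= S.
  by rewrite lerDl sumr_ge0 // => i _; rewrite divr_ge0 // ltW.
have S0 : 0 < S by exact: lt_le_trans S1.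
pose M : R := (d + 1)%:R * `|g| * S + 1.
have M0 : 0 < M by rewrite ltr_wpDl // !mulr_ge0 // ltW.
exists (2 * M)^-1; first by rewrite invr_gt0 mulr_gt0.
move=> m mv mb; set b := (2 * M)^-1 in mb.
have b0 : 0 < b by rewrite invr_gt0 mulr_gt0.
have hf0 : `|form0 g m| <= b * S.
  have e : form0 g m * vecq g v = - \sum_i form g m i * vecp g v i.
    have := pairingE gU 0 m v; rewrite mv /formx => /esym.
    rewrite (eq_bigr (fun i => form g m i * vecp g v i)); last by move=> i _; rewrite mxE mulr0 addr0.
    rewrite [X in form0 g m - X]big1; last by move=> i _; rewrite mxE mulr0.
    by rewrite subr0 => /eqP; rewrite addrC addr_eq0 => /eqP.
  rewrite -(ler_pM2r q0) -[X in `|_| * X](gtr0_norm q0) -normrM e normrN.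
  apply: le_trans (ler_norm_sum _ _ _) _.
  apply: le_trans (_ : \sum_i b * `|vecp g v i| <= _).
    by apply: ler_sum => i _; rewrite normrM; apply: ler_wpM2r.
  rewrite -mulr_sumr -mulrA ler_pM2l // /S mulrDl mulr_suml.
  rewrite (eq_bigr (fun i => `|vecp g v i| / vecq g v * vecq g v)).
    by rewrite lerDr mul1r ltW.
  by move=> i _; rewrite divfK // gt_eqF.
pose phi := map_mx intr m *m invmx g.
have hphi : `|phi| <= b * S.
  apply: norm_le_coord => [|i j]; first by rewrite mulr_ge0 ?ltW.
  rewrite ord1; case: (split_ordP j) => j' ->; last by rewrite [j']ord1.
  by apply: le_trans (mb j') _; rewrite ler_peMr // ltW.
have hm : `|map_mx intr m : 'rV[R]_(d + 1)| <= 2^-1.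
  have -> : map_mx intr m = phi *m g by rewrite /phi mulmxKV.
  apply: le_trans (norm_mulmx _ _) _.
  apply: le_trans (_ : b * M <= _).
    apply: le_trans (_ : (d + 1)%:R * (b * S) * `|g| <= _).
      by apply: ler_wpM2r => //; apply: ler_wpM2l.
    rewrite (_ : _ * _ * _ = b * ((d + 1)%:R * `|g| * S)); last by ring.
    by rewrite ler_pM2l // lerDl.
  by rewrite /b invfM -mulrA mulVf ?mulr1 // gt_eqF.
apply/matrixP => i j; rewrite mxE; apply/eqP/negPn/negP => mij.
have := le_trans (coord_le_norm _ i j) hm; rewrite mxE -intr_norm => h1.
have h2 : 1 <= (`|m i j|)%:~R :> R by rewrite ler1z -gtz0_ge1 normr_gt0.
by have := le_trans h2 h1; lra.
Qed.

(** Round a far point of the ray through [(- x0, 1)] to the lattice: the error is bounded by [M],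
    and dividing by a large [q] makes it small. *)
Lemma center_dense (x0 : 'I_d -> R) (e : R) : 0 < e ->
  exists v, 0 < vecq g v /\ forall i, `|center g v i - x0 i| <= e.
Proof.
move=> e0.
pose M : R := (d + 1)%:R * `|g| + 1.
have M0 : 0 < M by rewrite ltr_wpDl // mulr_ge0.
have round (y : 'cV[R]_(d + 1)) : exists k : 'cV[int]_(d + 1), `|g *m map_mx intr k - y| <= M.
  have /choice[k hk] : forall i, exists j : int, `|(invmx g *m y) i 0 - j%:~R| <= 2^-1.
    by move=> i; exact: nearest_int.
  exists (\col_i k i).
  have -> : g *m map_mx intr (\col_i k i) - y = g *m (map_mx intr (\col_i k i) - invmx g *m y).
    by rewrite mulmxBr mulKVmx.
  apply: le_trans (norm_mulmx _ _) _.
  apply: le_trans (_ : (d + 1)%:R * `|g| * 1 <= _); last by rewrite mulr1 lerDl.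
  apply: ler_wpM2l; first by rewrite mulr_ge0.
  move: (invmx g *m y) k hk => z k hk.
  apply: norm_le_coord => // i j; rewrite ord1 !mxE distrC.
  by apply: le_trans (hk i) _; rewrite invf_le1 ?ler1n.
pose X : R := 1 + \sum_i `|x0 i|.
have X1 : 1 <= X by rewrite lerDl sumr_ge0.
have xX i : `|x0 i| <= X.
  by rewrite /X (bigD1 i) //= addrCA lerDl addr_ge0 // sumr_ge0.
pose t : R := M + 2 * M * X / e + 1.
have [v hv] := round (col_mx (\col_i (- (t * x0 i))) (const_mx t)).
have q1 : `|vecq g v - t| <= M.
  have := le_trans (coord_le_norm _ (rshift d 0) 0) hv.
  by rewrite mxE [X in _ + X]mxE col_mxEd [const_mx t _ _]mxE.
have q2 i : `|vecp g v i + t * x0 i| <= M.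
  have := le_trans (coord_le_norm _ (lshift 1 i) 0) hv.
  by rewrite mxE [X in _ + X]mxE col_mxEu [X in - X]mxE opprK.
have T0 : 0 < 2 * M * X / e by rewrite !mulr_gt0 ?invr_gt0 //; exact: lt_le_trans X1.
have qe : 2 * M * X / e <= vecq g v.
  by move: q1; rewrite ler_norml /t => /andP[h _]; move: h; lra.
have q0 : 0 < vecq g v by exact: lt_le_trans qe.
exists v; split => // i.
have -> : center g v i - x0 i = - ((vecp g v i + vecq g v * x0 i) / vecq g v).
  by rewrite /center; field; rewrite gt_eqF.
rewrite normrN normrM normfV (gtr0_norm q0) ler_pdivrMr //.
have -> : vecp g v i + vecq g v * x0 i = (vecp g v i + t * x0 i) + (vecq g v - t) * x0 i by ring.
apply: le_trans (ler_normD _ _) _; rewrite normrM.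
apply: le_trans (lerD (q2 i) (ler_pM _ _ q1 (xX i))) _ => //.
move: qe; rewrite ler_pdivrMr // [_ * e]mulrC => qe; apply: le_trans qe.
have h : M * 1 <= M * X by rewrite ler_pM2l.
by move: h; lra.
Qed.

End Roots.

(** * Divergence of the trajectories in a nested intersection *)

Section Divergence.
Variables (R : realType) (d : nat) (w : 'I_d -> R).
Hypothesis w_gt0 : forall i, 0 < w i.
Hypothesis w_sum1 : \sum_i w i = 1.

Lemma flow_coord (h : SL R (d + 1)) (x : 'cV[R]_d) t (k : 'cV[int]_(d + 1)) (e : R) : 0 <= e ->
    (forall i, expR (w i * t) * `|vecp (SLmx h) k i + vecq (SLmx h) k * x i 0| <= e) ->
    expR (- t) * `|vecq (SLmx h) k| <= e ->
  `|SLmx (mulSL (flow w_sum1 t) (mulSL (horo x) h)) *m map_mx intr k| <= e.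
Proof.
move=> e0 hp hq.
have -> : SLmx (mulSL (flow w_sum1 t) (mulSL (horo x) h)) *m map_mx intr k =
   flow_mx w t *m (hmx x *m (SLmx h *m map_mx intr k)) by rewrite /= -!mulmxA.
apply: norm_le_coord => // i j; rewrite ord1 /flow_mx mul_diag_mx mxE.
case: (split_ordP i) => i' ->.
  by rewrite row_mxEl mxE vecpE normrM ger0_norm ?expR_ge0.
by rewrite row_mxEr mxE [i']ord1 vecqE normrM ger0_norm ?expR_ge0.
Qed.

(** The slack [x ^ 2] in [lnD] is shared between the ends of the time interval of [v k]. Starting
    [x ^ 2 / 2] after [lnQ x] makes [q] contract to at most [2 * expR (- x)]; at the end,
    [w i * (x + 1) ^ 2 / 2 - x ^ 2 <= - x] bounds the expanded coordinates. *)
Lemma divergent_of_short (H X : R) (L : lattice_space R (d + 1)) (x : 'cV[R]_d)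
    (v : nat -> 'cV[int]_(d + 1)) : 1 <= H -> 200 <= X ->
    let g := SLmx (repr L) in
    (forall k, 0 < vecq g (v k) <= 2 * scQ H (X + k%:R)) ->
    (forall k i, `|vecp g (v k) i + vecq g (v k) * x i 0| <=
       vecq g (v k) * scD w H (X + k%:R) i) ->
  divergent (fun t => lattice_act (flow w_sum1 t) (lattice_act (horo x) L)).
Proof.
move=> H1 X200 g hq hp K cK.
have [eta eta0 hK] := compact_no_short cK.
pose xx k : R := X + k%:R.
have xx200 k : 200 <= xx k by rewrite /xx; have : 0 <= k%:R :> R by []; lra.
(* [v k] is short for [t] between [tau k] and [tau k.+1] *)
pose tau k : R := lnQ H (xx k) + xx k ^+ 2 / 2.
have tau_ge k : k%:R <= tau k.
  have x1 := xx200 k; rewrite /tau /lnQ.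
  have : 0 <= xx k ^+ 2 by exact: sqr_ge0.
  have : xx k <= H * xx k ^+ 3.
    rewrite -[leLHS]mul1r; apply: ler_pM => //; first by lra.
    by rewrite exprS ler_peMr ?exprn_ege1 //; lra.
  by rewrite {1}/xx; lra.
pose N := (Num.truncn (2 / eta)).+1.
exists (tau N); split; first exact: num_real.
move=> t Nt; rewrite {2}/lattice_act lattice_actE => Kt.
(* The vector used at time [t] is that of the last level [k] with [tau k <= t]; starting at [N]
   ensures [2 * expR (- xx k) < eta]. *)
have exP : exists k, (N <= k)%N && (tau k <= t) by exists N; rewrite leqnn ltW.
have ubP k : (N <= k)%N && (tau k <= t) -> (k <= Num.truncn t)%N.
  move=> /andP[_ kt]; have := le_trans (tau_ge k) kt => kt'.
  by rewrite truncn_ge_nat // (le_trans _ kt').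
case: (ex_maxnP exP ubP) => k /andP[Nk kt] maxk.
have tk : t < tau k.+1.
  rewrite ltNge; apply/negP => h; have := maxk k.+1.
  by rewrite h (leq_trans Nk) // ltnn => /(_ isT).
have vn0 : v k != 0.
  apply/eqP => v0; have := hq k; rewrite v0 /vecq map_mx0 mulmx0 mxE.
  by rewrite ltxx.
have [q0 q2] := andP (hq k); rewrite -/(xx k) in q2.
have := hK _ _ Kt vn0; apply/negP; rewrite -ltNge.
have x1 := xx200 k; set y := xx k in x1.
have yy : 200 * y <= y ^+ 2 by rewrite expr2; apply: ler_wpM2r => //; lra.
have xk1 : xx k.+1 = y + 1 by rewrite /y /xx -natr1 addrA.
apply: (@le_lt_trans _ _ (2 * expR (- y))); last first.
  have h1 : 2 / eta < y.
    apply: lt_le_trans (truncnS_gt _) _; rewrite -/N /y /xx.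
    apply: le_trans (_ : k%:R <= _); first by rewrite ler_nat.
    by move: X200; lra.
  have h2 : 2 / eta < expR y.
    by apply: lt_le_trans h1 _; apply: le_trans (expR_ge1Dx y); rewrite lerDr.
  by rewrite expRN ltr_pdivrMr ?expR_gt0 // mulrC -ltr_pdivrMr.
apply: flow_coord => [|i|]; first by rewrite mulr_ge0 ?expR_ge0.
- apply: le_trans (_ : expR (w i * t) * (vecq g (v k) * scD w H y i) <= _).
    by apply: ler_wpM2l; rewrite ?expR_ge0.
  have h1 : vecq g (v k) * scD w H y i <= expR (lnQ H y + lnD w H y i).
    apply: le_trans (_ : 2 * scQ H y * scD w H y i <= _).
      by apply: ler_wpM2r => //; apply: ltW; exact: scD_gt0.
    by rewrite expRD /scQ /scD le_eqVlt; apply/orP; left; apply/eqP; field.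
  apply: le_trans (_ : expR (w i * tau k.+1) * expR (lnQ H y + lnD w H y i) <= _).
    apply: ler_pM => //; first by rewrite mulr_ge0 ?ltW // scD_gt0.
    by rewrite ler_expR ler_pM2l // ltW.
  rewrite -expRD; apply: le_trans (_ : expR (- y) <= _); last first.
    by rewrite ler_peMl ?expR_ge0 // ler1n.
  have w1 : w i <= 1.
    by rewrite -w_sum1 (bigD1 i) //= lerDl sumr_ge0 // => j _; exact: ltW.
  rewrite ler_expR /tau xk1 /lnQ /lnD.
  have h2 : w i * (y + 1) ^+ 2 <= 1 * (y + 1) ^+ 2 by apply: ler_wpM2r => //; exact: sqr_ge0.
  by move: h2 yy x1; lra.
- rewrite gtr0_norm //; apply: le_trans (_ : expR (- tau k) * (2 * scQ H y) <= _).
    apply: ler_pM; rewrite ?expR_ge0 ?(ltW q0) //.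
    by rewrite ler_expR lerN2.
  rewrite mulrCA ler_pM2l // /scQ -expRD ler_expR /tau -/y.
  by move: yy x1; lra.
Qed.

(** Coordinatewise nested intervals: each box contains its own centre, so every lower end lies below
    every upper end, and the supremum of the lower ends is in all of them. *)
Lemma nested_boxes (g : 'M[R]_(d + 1)) (D : nat -> 'I_d -> R) (v : nat -> 'cV[int]_(d + 1)) :
    (forall k i, 0 <= D k i) ->
    (forall k, box g (v k.+1) (D k.+1) `<=` box g (v k) (D k)) ->
  exists x, forall k, box g (v k) (D k) x.
Proof.
move=> D0 nest.
pose c k i := center g (v k) i.
have cin k : box g (v k) (D k) (\col_i c k i) by move=> i; rewrite mxE subrr normr0.
have sub k l : (k <= l)%N -> box g (v l) (D l) `<=` box g (v k) (D k).
  move=> /subnK <-; elim: (l - k)%N => [//|n IH]; rewrite addSn.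
  exact: subset_trans (nest _) IH.
pose E i : set R := range (fun k => c k i - D k i).
have ub i k : ubound (E i) (c k i + D k i).
  move=> _ [l _ <-].
  have hk := sub k (maxn k l) (leq_maxl _ _) _ (cin _) i.
  have hl := sub l (maxn k l) (leq_maxr _ _) _ (cin _) i.
  move: hk hl; rewrite mxE -/(c k i) -/(c l i) !ler_norml => /andP[_ h1] /andP[h2 _].
  by move: h1 h2; lra.
exists (\col_i sup (E i)) => k i; rewrite mxE.
have sE : has_sup (E i) by split; [exists (c 0%N i - D 0%N i), 0%N | exists (c k i + D k i)].
have h1 : c k i - D k i <= sup (E i) by apply: sup_upper_bound => //; exists k.
have h2 : sup (E i) <= c k i + D k i by exact: ge_sup (proj1 sE) (ub i k).
by rewrite ler_norml; apply/andP; split; move: h1 h2; rewrite /c; lra.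
Qed.
End Divergence.

(** * The lower bound for the Hausdorff dimension *)

Lemma large_scaleD (R : realType) d (H x y : R) : 0 <= y ->
  large_scale d H x -> large_scale d H (x + y).
Proof.
move=> y0 [h1 h2 h3]; split; rewrite ?(le_trans h1) ?(le_trans h2) ?lerDl //.
by apply: le_trans h3 _; rewrite ler_expR lerDl.
Qed.

Lemma coord_le_dist (R : realType) d (x y : 'cV[R]_d) i : `|x i 0 - y i 0| <= euclidean_dist x y.
Proof.
rewrite -sqrtr_sqr ler_wsqrtr // (bigD1 i) //= lerDl.
by apply: sumr_ge0 => j _; exact: sqr_ge0.
Qed.

Lemma open_box (R : realType) d (U : set 'cV[R]_d) x : open U -> U x ->
  exists2 e : R, 0 < e & forall y : 'cV[R]_d, (forall i, `|y i 0 - x i 0| <= e) -> U y.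
Proof.
move=> Uo Ux; have /nbhs_ballP[e /= e0 he] : nbhs x U by exact: open_nbhs_nbhs.
exists (e / 2); first by rewrite divr_gt0.
move=> y hy; apply: he; rewrite mx_norm_ball /ball_ /= distrC.
apply: (@le_lt_trans _ _ (e / 2)); last by rewrite ltr_pdivrMr // ltr_pMr // ltr1n.
apply: norm_le_coord => [|i j]; first by rewrite divr_ge0 // ltW.
by rewrite ord1 !mxE.
Qed.

Theorem theorem1p2 (R : realType) (d : nat) (d_ge2 : (1 < d)%N)
    (w : 'I_d -> R) (w_gt0 : forall i, 0 < w i) (w_sum1 : \sum_i w i = 1)
    (w_noninc : forall i j : 'I_d, (i <= j)%N -> w j <= w i)
    (L : lattice_space R (d + 1)) (U : set 'cV[R]_d)
    (U_open : open U) (U_neq0 : U !=set0) :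
  ((d%:R - (1 + w (Ordinal (ltnW d_ge2)))^-1)%:E <=
   hausdorff_dim (@euclidean_dist R d)
     [set x | U x /\
        divergent (fun t => lattice_act (flow w_sum1 t)
                              (lattice_act (horo x) L))])%E.
Proof.
set i0 := Ordinal (ltnW d_ge2).
set A := [set x | _].
have [x0 Ux0] := U_neq0; have [e e0 he] := open_box U_open Ux0.
set s0 := d%:R - _; apply: hausdorff_dim_ge => s s_ge0 ss0.
(* Half of the gap: [eta] is the loss granted to [cover_mass], and [s0 - eta] still exceeds [s]. *)
pose eta := (s0 - s) / 2.
have eta0 : 0 < eta by rewrite divr_gt0 ?subr_gt0 ?ltr0n.
(* The summands secure [5 <= H], [d <= H], [4 <= w i * H] and [7 * d <= H * eta] respectively. *)
pose H : R := 5 + d%:R + \sum_i 4 / w i + 7 * d%:R / eta.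
have sw : 0 <= \sum_i 4 / w i by apply: sumr_ge0 => i _; rewrite divr_ge0 // ltW.
have de : 0 <= 7 * d%:R / eta by rewrite !mulr_ge0 ?invr_ge0 ?ler0n ?(ltW eta0).
have dn : 0 <= d%:R :> R by rewrite ler0n.
have H5 : 5 <= H by rewrite /H; lra.
have Hd : d%:R <= H by rewrite /H; lra.
have wH4 i : 4 <= w i * H.
  rewrite mulrC -ler_pdivrMr // /H.
  have : 4 / w i <= \sum_i 4 / w i.
    rewrite (bigD1 i) //= lerDl; apply: sumr_ge0 => j _; rewrite divr_ge0 //; exact: ltW.
  by move: sw de dn; lra.
have Heta : 7 * d%:R <= H * eta by rewrite -ler_pdivrMr // /H; move: sw de dn; lra.
pose g := SLmx (repr L).
have gU : g \in unitmx by rewrite unitmxE det_SLmx unitr1.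
have [v [q0 hv]] := center_dense gU (fun i => x0 i 0) (divr_gt0 e0 (ltr0Sn _ 1)).
have [beta beta0 vf] := vfree_small gU q0.
have [T hT] := root_step gU i0 d_ge2 w_sum1 H5 Hd wH4 q0 beta0 (divr_gt0 e0 (ltr0Sn _ 1)) vf.
(* The thresholds are added up; those that concern [expR y] follow from [y <= expR y]. *)
pose y : R := 200 + 14 * H + 10 * big_cst R d ^+ 2 + `|T|.
have B0 : 0 <= 10 * big_cst R d ^+ 2 by rewrite mulr_ge0 ?sqr_ge0.
have yexp : y <= expR y by apply: le_trans (expR_ge1Dx y); rewrite lerDr.
have T0 := normr_ge0 T.
have H0 : 0 <= H by move: H5; lra.
have ly : large_scale d H y.
  by split; [| |apply: le_trans yexp]; rewrite /y; move: B0 T0 H0; lra.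
have Ty : T <= expR y.
  by apply: le_trans yexp; have := ler_norm T; rewrite /y; move: B0 H0; lra.
have [u0 [qu0 uf0 ubox]] := hT y ly Ty.
pose X := y + 1.
have lX k : large_scale d H (X + k%:R).
  by rewrite /X -addrA; apply: large_scaleD => //; rewrite addr_ge0.
rewrite -/X in qu0 uf0 ubox; clearbody X.
have [X200 XH _] := lX 0%N; rewrite addr0 in X200 XH.
have X0 : 0 <= X by lra.
pose M := \prod_i (scD w H X i `^ expo i0 w i)^-1.
have M0 : 0 < M by apply: prodr_gt0 => i _; rewrite invr_gt0 powR_gt0 // scD_gt0.
have X13 : 0 <= (X + 1) ^+ 3 by apply: exprn_ge0; lra.
have X3 : 0 <= X ^+ 3 by apply: exprn_ge0.
(* The exponent is [lnD] at [X] with [w i] replaced by 1, hence a lower bound in every direction;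
   dividing by 4 instead of 2 makes the comparison with [scD] strict. *)
pose r0 := expR (- X ^+ 2 - H * (X + 1) ^+ 3 - H * X ^+ 3) / 4.
have r00 : 0 < r0 by rewrite divr_gt0 ?expR_gt0.
have E1 : expR (- X ^+ 2 - H * (X + 1) ^+ 3 - H * X ^+ 3) <= 1.
  have h1 : 0 <= H * (X + 1) ^+ 3 by rewrite mulr_ge0.
  have h2 : 0 <= H * X ^+ 3 by rewrite mulr_ge0.
  by rewrite -[leRHS]expR0 ler_expR; have := sqr_ge0 X; move: h1 h2; lra.
have r01 : r0 <= 1 by rewrite /r0 ler_pdivrMr ?ltr0n // mul1r (le_trans E1) // ler1n.
have r0D i : r0 < scD w H X i.
  have h : lnD w H X i >= - X ^+ 2 - H * (X + 1) ^+ 3 - H * X ^+ 3.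
    rewrite /lnD lerD2r lerD2l lerN2; apply: ler_wpM2r => //.
    exact: wH_le.
  have aux (z1 z2 : R) : 0 < z1 -> z1 <= z2 -> z1 / 4 < z2 / 2 by lra.
  by apply: aux; rewrite ?expR_gt0 // ler_expR.
apply: (@hausdorff_measure_neq0 _ _ _ A s (s0 - eta) M^-1 r0) => //.
- by rewrite /eta; lra.
- by rewrite invr_gt0.
move=> F r hr Fr Fsum.
have rpos j : 0 < r j by have /andP[] := hr j.
have /choice[K hK] : forall j, exists K : nat,
    \prod_(0 <= k < K) frac i0 w H (X + k%:R) (r j) <= M * r j `^ (s0 - eta).
  move=> j; apply: cover_mass => // i.
  by apply: le_lt_trans (r0D i); have /andP[] := hr j.
pose valid k u := scQ H (X + k%:R) <= vecq g u <= 2 * scQ H (X + k%:R) /\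
  vfree g u (scb i0 w H (X + k%:R)).
pose Bx k u := box g u (scD w H (X + k%:R)).
have [||||p [p0 pv pB pF]] := @avoiding_path R _ _ valid Bx F
  (fun k j => frac i0 w H (X + k%:R) (r j)) K _ _ u0.
- by move=> k j; apply: frac_ge0; exact: ltW.
- move=> k u [qu uf].
  have [N [ch [h1 h2 h3]]] := inner_step gU d_ge2 w_sum1 H5 Hd wH4 (lX k) qu uf.
  have Xk : X + k.+1%:R = X + k%:R + 1 by rewrite -natr1 addrA.
  exists N, ch; split.
  + by move=> i; rewrite /valid Xk; exact: h1.
  + by move=> i; rewrite /Bx Xk; exact: h2.
  move=> j; rewrite /Bx Xk; apply: h3; first exact: ltW.
  by move=> x1 x2 i F1 F2; apply: le_trans (coord_le_dist _ _ i) (Fr j _ _ F1 F2).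
- by rewrite /valid addr0; split.
- apply: (@le_lt_trans _ _ (\sum_(0 <= j <oo) (M%:E * (r j `^ (s0 - eta))%:E))%E).
    apply: lee_nneseries => [j _ _|j _].
      by rewrite lee_fin; apply: prodr_ge0 => k _; apply: frac_ge0; exact: ltW.
    by rewrite -EFinM lee_fin; exact: hK.
  rewrite nneseriesZl; last by move=> j _; rewrite lee_fin powR_ge0.
  rewrite -lte_pdivlMl // mule1.
  exact: Fsum.
have [x hx] := nested_boxes (fun k i => ltW (scD_gt0 _ _ _ _)) pB.
exists x.
  split.
    have := hx 0%N; rewrite p0 addr0 => /ubox hb; apply: he => i.
    have := hb i; have := hv i => h1 h2.
    rewrite -(subrKA (center g v i)); apply: le_trans (ler_normD _ _) _.
    by move: h1 h2; lra.
  have H1 : 1 <= H by move: H5; lra.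
  apply: (divergent_of_short w_gt0 w_sum1 H1 X200 (v := p)).
  - move=> k; have [/andP[h1 h2] _] := pv k; rewrite h2 andbT.
    by apply: lt_le_trans h1; exact: expR_gt0.
  - move=> k i; apply: box_center; last exact: hx.
    have [/andP[h1 h2] _] := pv k; by apply: lt_le_trans h1; exact: expR_gt0.
move=> j Fx; have : (Bx (K j) (p (K j)) `&` F j) x by split => //; exact: hx.
by rewrite pF.
Qed.
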